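(* Let $r>0$ and let $f:C^0([-r,0];\mathbb{R}^n)\to\mathbb{R}^n$ satisfy $f(0)=0$ and be Lipschitz on bounded sets of $C^0([-r,0];\mathbb{R}^n)$. Let $p\in(1,+\infty)$ and let $X=W^{1,p}([-r,0])$. Suppose that for every $x_0\in C^{0,1-1/p}([-r,0])$ the solution $x(t)\in\mathbb{R}^n$ of $\dot x(t)=f(x_t)$ with initial condition $x_0$ exists for all $t\ge0$. Then the following statements are equivalent for the system $\dot x(t)=f(x_t)$. (i) Property (GAS-X) holds. (ii) Property (UGAS-X) holds. (iii) There exist a functional $V:X\to\mathbb{R}_+$ which is Lipschitz on bounded sets of $X$ and functions $a_1,a_2\in K_\infty$ such that for all $x\in X$: $$a_1(\|x\|_X)\le V(x)\le a_2(\|x\|_X),\qquad \limsup_{t\to0^+}\left(t^{-1}\left(V(\phi(t,x))-V(x)\right)\right)\le -V(x).$$ (iv) There exist a functional $V:X\to\mathbb{R}_+$ which is Lipschitz on bounded sets of $X$, a continuous positive definite function $Q:\mathbb{R}^n\to\mathbb{R}_+$ and functions $a_1,a_2\in K_\infty$ such that for all $x\in X$: $$a_1(|x(0)|)\le V(x)\le a_2(\|x\|_X),\qquad \limsup_{t\to0^+}\left(t^{-1}\left(V(\phi(t,x))-V(x)\right)\right)\le -Q(x(0)).$$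
   Context: $|\cdot|$ is the Euclidean norm on $\mathbb{R}^n$ and $\mathbb{R}_+=[0,+\infty)$. $C^0([-r,0];\mathbb{R}^n)$ is the space of continuous functions with norm $\|x\|_\infty=\max_{s\in[-r,0]}|x(s)|$. $f$ is Lipschitz on bounded sets of $C^0([-r,0];\mathbb{R}^n)$ if there is a non-decreasing function $L:\mathbb{R}_+\to\mathbb{R}_+$ such that for every $R\ge 0$, $|f(x)-f(y)|\le L(R)\|x-y\|_\infty$ for all $x,y$ with $\|x\|_\infty\le R$, $\|y\|_\infty\le R$. For the system $\dot x(t)=f(x_t)$, $x(t)\in\mathbb{R}^n$ and $x_t\in C^0([-r,0];\mathbb{R}^n)$ is defined by $x_t(s)=x(t+s)$, $s\in[-r,0]$. For $x_0\in C^0([-r,0];\mathbb{R}^n)$, $\phi(t,x_0)$ denotes $x_t$, where $x(t)$ is the (unique, maximally defined for $t\ge0$) solution with initial condition $x_0$. Function spaces. $W^{1,p}([-r,0])$ is the space of absolutely continuous $x:[-r,0]\to\mathbb{R}^n$ with $\dot x\in L^p((-r,0);\mathbb{R}^n)$, with norm $\|x\|_X=\|x\|_\infty+\|\dot x\|_p$, where $\|\dot x\|_p=(\int_{-r}^0|\dot x(s)|^p ds)^{1/p}$. For $a\in(0,1]$, $C^{0,a}([-r,0])$ is the space of $x\in C^0([-r,0];\mathbb{R}^n)$ with $\sup_{t,s\in[-r,0],t\ne s}|x(t)-x(s)|/|t-s|^a<+\infty$. If $x_0\in W^{1,p}([-r,0])$ then $\phi(t,x_0)\in W^{1,p}([-r,0])$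 whenever it exists. A functional $V:X\to\mathbb{R}_+$ is Lipschitz on bounded sets of $X$ if for every $R\ge0$ there is a constant $M\ge 0$ with $|V(x)-V(y)|\le M\|x-y\|_X$ for all $x,y\in X$ with $\|x\|_X\le R$, $\|y\|_X\le R$. $Q$ is positive definite if $Q(0)=0$ and $Q(\xi)>0$ for all $\xi\ne0$. Class $K$: strictly increasing continuous functions $\rho:\mathbb{R}_+\to\mathbb{R}_+$ with $\rho(0)=0$. Class $K_\infty$: functions $\rho$ of class $K$ with $\lim_{s\to+\infty}\rho(s)=+\infty$. Class $KL$: functions $\sigma:\mathbb{R}_+\times\mathbb{R}_+\to\mathbb{R}_+$ such that $\sigma(\cdot,t)$ is of class $K$ for each $t\ge0$, and $\sigma(s,\cdot)$ is non-increasing with $\lim_{t\to+\infty}\sigma(s,t)=0$ for each $s\ge0$. (LS-X): for every $\varepsilon>0$ there exists $\delta(\varepsilon)>0$ such that $\sup\{\|\phi(t,x_0)\|_X: t\ge0,\ x_0\in X,\ \|x_0\|_X\le\delta(\varepsilon)\}\le\varepsilon$. (GA-X): for every $x_0\in X$, $\lim_{t\to+\infty}\|\phi(t,x_0)\|_X=0$. (GAS-X): both (LS-X) and (GA-X) hold. (UGAS-X): there exists $\sigma\in KL$ such that $\|\phi(t,x_0)\|_X\le\sigma(\|x_0\|_X,t)$ for all $t\ge0$ and all $x_0\in X$. *)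

(* Defs.v *)
From HB Require Import structures.
From mathcomp Require Import all_boot all_order all_algebra.
From mathcomp Require Import all_classical all_reals all_analysis.

Set Implicit Arguments.
Unset Strict Implicit.
Unset Printing Implicit Defensive.

Import Order.TTheory GRing.Theory Num.Theory.
Import numFieldNormedType.Exports.

Local Open Scope classical_set_scope.
Local Open Scope ring_scope.

(* A function x : [-r, 0] -> R^n is represented by a total function
   x : R -> 'rV[R]_n whose values outside [-r, 0] are irrelevant.  All the
   spaces and norms below only look at x on [-r, 0].  A functional on such a
   space is a map on total functions; being Lipschitz on bounded sets forces it
   to take the same value on two members of the space that agree on [-r, 0]. *)

Section EuclideanNorm.
Context {R : realType} {n : nat}.

(* `|v| on 'rV[R]_n is the max norm; it induces the same topology. *)
Definition enorm (v : 'rV[R]_n) : R := Num.sqrt (\sum_(i < n) v ord0 i ^+ 2).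

End EuclideanNorm.

Section FunctionSpaces.
Context {R : realType} {n : nat}.
Implicit Types (r p a : R) (x y : R -> 'rV[R]_n).

Definition C0 r : set (R -> 'rV[R]_n) :=
  [set x | {within `[- r, 0], continuous x}].

(* For x in C0 r this supremum is a maximum. *)
Definition sup_norm r x : R := sup [set enorm (x s) | s in `[- r, 0]].

Definition holder_space r a : set (R -> 'rV[R]_n) :=
  [set x | C0 r x /\
    has_ubound [set q : R | exists t s : R,
      [/\ t \in `[- r, 0], s \in `[- r, 0], t != s &
          q = enorm (x t - x s) / `|t - s| `^ a]]].

(* The finitely many intervals [I k.1, I k.2] have pairwise disjoint
   interiors. *)
Definition absolutely_continuous r x :=
  forall e : R, 0 < e -> exists2 d : R, 0 < d &
    forall (m : nat) (I : 'I_m -> R * R),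
      (forall k, [/\ - r <= (I k).1, (I k).1 <= (I k).2 & (I k).2 <= 0]) ->
      (forall k l, k != l -> (I k).2 <= (I l).1 \/ (I l).2 <= (I k).1) ->
      \sum_(k < m) ((I k).2 - (I k).1) < d ->
      \sum_(k < m) enorm (x (I k).2 - x (I k).1) < e.

(* derive1 x is the pointwise derivative, which exists almost everywhere when x is
   absolutely continuous; only its values on ]-r, 0[ are used. *)
Definition W1p r p : set (R -> 'rV[R]_n) :=
  [set x | absolutely_continuous r x /\
    forall i : 'I_n, (fun s => derive1 x s ord0 i) \_ `]- r, 0[
                       \in Lfun lebesgue_measure p%:E].

Definition derive_norm r p x : R :=
  fine (Lnorm lebesgue_measure p%:E
          (EFin \o ((fun s => enorm (derive1 x s)) \_ `]- r, 0[))).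

Definition W1p_norm r p x : R := sup_norm r x + derive_norm r p x.

Definition lipschitz_on_bounded_C0 r (f : (R -> 'rV[R]_n) -> 'rV[R]_n) :=
  exists L : R -> R,
    [/\ forall s, 0 <= s -> 0 <= L s,
        forall s t, 0 <= s -> s <= t -> L s <= L t &
        forall K, 0 <= K -> forall x y, C0 r x -> C0 r y ->
          sup_norm r x <= K -> sup_norm r y <= K ->
          enorm (f x - f y) <= L K * sup_norm r (x - y)].

Definition lipschitz_on_bounded_W1p r p (V : (R -> 'rV[R]_n) -> R) :=
  forall K, 0 <= K -> exists2 M : R, 0 <= M &
    forall x y, W1p r p x -> W1p r p y ->
      W1p_norm r p x <= K -> W1p_norm r p y <= K ->
      `|V x - V y| <= M * W1p_norm r p (x - y).

End FunctionSpaces.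

Section Comparison.
Context {R : realType}.

(* Functions on R_+ are total functions used only at nonnegative arguments. *)
Definition class_K (rho : R -> R) :=
  [/\ {within `[0, +oo[, continuous rho},
      (forall s t, 0 <= s -> s < t -> rho s < rho t) & rho 0 = 0].

Definition class_Kinfty (rho : R -> R) :=
  class_K rho /\ rho s @[s --> +oo] --> +oo.

Definition class_KL (sigma : R -> R -> R) :=
  (forall t, 0 <= t -> class_K (sigma ^~ t)) /\
  (forall s, 0 <= s ->
     (forall t u, 0 <= t -> t <= u -> sigma s u <= sigma s t) /\
     sigma s t @[t --> +oo] --> 0).

End Comparison.

Section Delay.
Context {R : realType} {n : nat}.
Variables (r : R) (f : (R -> 'rV[R]_n) -> 'rV[R]_n).
Implicit Types (x : R -> 'rV[R]_n).

Definition segment_at x (t : R) : R -> 'rV[R]_n := fun s => x (t + s).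

(* A solution on [-r, +oo[.  Since t |-> f (x_t) is continuous on [0, +oo[, the
   equation at t = 0, with the right-hand derivative, is a consequence. *)
Definition is_solution x0 x :=
  [/\ {in `[- r, 0], x =1 x0},
      {within `[- r, +oo[, continuous x} &
      forall t : R, 0 < t -> is_derive t 1 x (f (segment_at x t))].

(* When f is Lipschitz on bounded sets, a solution on [-r, +oo[ is unique there
   and is the maximally defined one, so this is the flow at every x0 whose
   solution exists for all t >= 0. *)
Definition phi (t : R) x0 : R -> 'rV[R]_n :=
  segment_at (get [set x | is_solution x0 x]) t.

Variable p : R.

Definition LS_X := forall e : R, 0 < e -> exists2 d : R, 0 < d &
  (ereal_sup [set u : \bar R | exists t x0,
     [/\ (0 <= t)%R, W1p r p x0, (W1p_norm r p x0 <= d)%R &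
         u = (W1p_norm r p (phi t x0))%:E]] <= e%:E)%E.

Definition GA_X := forall x0, W1p r p x0 ->
  W1p_norm r p (phi t x0) @[t --> +oo] --> 0.

Definition GAS_X := LS_X /\ GA_X.

Definition UGAS_X := exists2 sigma : R -> R -> R, class_KL sigma &
  forall (t : R) x0, 0 <= t -> W1p r p x0 ->
    W1p_norm r p (phi t x0) <= sigma (W1p_norm r p x0) t.

Definition upper_dini (V : (R -> 'rV[R]_n) -> R) x : \bar R :=
  limf_esup (fun t : R => (t^-1 * (V (phi t x) - V x))%:E) 0^'+.

End Delay.

Definition positive_definite {R : realType} {n : nat} (Q : 'rV[R]_n -> R) :=
  Q 0 = 0 /\ forall xi, xi != 0 -> 0 < Q xi.

(* Main.v *)
Require Import Defs.
From HB Require Import structures.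
From mathcomp Require Import all_boot all_order all_algebra.
From mathcomp Require Import all_classical all_reals all_analysis.
From mathcomp Require Import measurable_realfun.
From mathcomp Require Import ring lra.

Import Order.TTheory GRing.Theory Num.Theory.
Import numFieldNormedType.Exports.

Set Implicit Arguments.
Unset Strict Implicit.
Unset Printing Implicit Defensive.

Local Open Scope classical_set_scope.
Local Open Scope ring_scope.

(** The flow is studied in the Sobolev space [W1p], whose norm adds the [L^p] norm
    of the derivative to the uniform norm.  By [wder_segment] the derivative of a
    segment of a solution is the initial derivative, translated, followed by the
    velocity [f (x_t)].  Hence, as [f] is Lipschitz on bounded sets, a Gronwall
    estimate ([sol_growth]) makes the flow Lipschitz in the initial state on compact
    time intervals, as long as the solutions stay bounded ([norm_segment_dist]).
    After time [r] the initial derivative has left the segment: Sobolev norms and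
    distances are then controlled by uniform ones ([norm_segment_le_late],
    [norm_segment_dist_late]).

    Asymptotic stability implies uniform asymptotic stability.  Balls of [W1p] are
    not compact, but by [W1p_hoelder] their members are equi-Hoelder of exponent
    [1 - p^-1] and so lie in a compact set of paths ([holder_ball_uniform]).  Every
    path in this set has a global solution, by hypothesis, and its segment at time
    [r] is in [W1p], so it is attracted to [0].  Entering at a given time the ball
    from which local stability takes over is an open condition in the uniform
    topology, by [sol_stay_close] and [norm_segment_dist_late].  Compactness
    therefore gives a common entrance time and a common bound
    ([uniform_attractivity]).  The largest norm reached after time [t] from the ball
    of radius [s] tends to [0] in [t], and [class_KL_majorant] puts a comparison
    function above it.

    For the converse Lyapunov theorem, from a uniform decay rate one takes
    [V x = sup_(k, t) c_k * e^t * max 0 (|phi t x| - 1 / (k + 1))].  On a ball each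
    excess vanishes after a common time, so each term is Lipschitz there, and a
    diagonal choice of the weights [c_k] makes the supremum Lipschitz on every ball
    ([excess_weights]).  The exponential factor gives [V (phi h x) <= e^-h * V x],
    whence the differential inequality ([UGAS_converse_functional]).  Since
    [enorm (x 0)] is at most the norm of [x], the same functional satisfies the
    weaker condition, with [Q] the composition of its lower bound with [enorm].

    Last, let [V] satisfy the weaker condition.  A trajectory is continuous in the
    Sobolev norm because translations are continuous in [L^p]
    ([segment_continuous]), so [V] is continuous along it and the inequality between
    Dini derivatives integrates ([increment_le_of_right_slope]).  Thus
    [a1 (enorm (x t)) <= V (phi 0 x) <= a2 (|x|)], which is stability for [x t], and
    every excursion of [x t] away from [0] costs a fixed amount of [V], so [x t]
    tends to [0] ([sol_vanishes]).  Both conclusions pass to the Sobolev norm of the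
    segments by [norm_segment_le] and [norm_segment_le_late].

    The underlying real analysis is the fundamental theorem of calculus for
    absolutely continuous functions ([ac_on_ftc]), which makes the pointwise
    derivative additive almost everywhere and bounds increments by its [L^p] norm,
    and the continuity of translations in [L^p]
    ([Lnorm_translation_continuous]). *)

(** * The Euclidean norm and vector-valued derivatives *)

Section EuclideanNormTheory.
Context {R : realType} {n : nat}.
Implicit Types u v w : 'rV[R]_n.

Lemma enorm_ge0 v : 0 <= enorm v.
Proof. exact: sqrtr_ge0. Qed.

Lemma enorm_sqr v : enorm v ^+ 2 = \sum_(i < n) v ord0 i ^+ 2.
Proof. by rewrite sqr_sqrtr// sumr_ge0// => i _; exact: sqr_ge0. Qed.

Lemma enorm0 : enorm (0 : 'rV[R]_n) = 0.
Proof.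
by rewrite /enorm big1 ?sqrtr0// => i _; rewrite mxE expr0n.
Qed.

Lemma enormN v : enorm (- v) = enorm v.
Proof. by congr Num.sqrt; apply: eq_bigr => i _; rewrite mxE sqrrN. Qed.

Lemma enormB v w : enorm (v - w) = enorm (w - v).
Proof. by rewrite -enormN opprB. Qed.

Lemma coord_le_enorm v i : `|v ord0 i| <= enorm v.
Proof.
rewrite -sqrtr_sqr ler_wsqrtr// (bigD1 i)//= lerDl sumr_ge0// => j _.
exact: sqr_ge0.
Qed.

Lemma enorm_eq0 v : enorm v = 0 -> v = 0.
Proof.
move=> v0; apply/rowP => i; rewrite mxE; apply/eqP.
by rewrite -normr_le0 -v0 coord_le_enorm.
Qed.

Lemma dot_le_enorm u v :
  \sum_(i < n) u ord0 i * v ord0 i <= enorm u * enorm v.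
Proof.
have [u0|un0] := eqVneq (enorm u) 0.
  by rewrite (enorm_eq0 u0) enorm0 mul0r big1// => i _; rewrite mxE mul0r.
have [v0|vn0] := eqVneq (enorm v) 0.
  by rewrite (enorm_eq0 v0) enorm0 mulr0 big1// => i _; rewrite mxE mulr0.
have up : 0 < enorm u by rewrite lt_def un0 enorm_ge0.
have vp : 0 < enorm v by rewrite lt_def vn0 enorm_ge0.
have : 0 <= \sum_(i < n) (enorm v * u ord0 i - enorm u * v ord0 i) ^+ 2.
  by apply: sumr_ge0 => i _; exact: sqr_ge0.
rewrite (_ : \sum_(i < n) _ = 2 * (enorm u * enorm v) *
    (enorm u * enorm v - \sum_(i < n) u ord0 i * v ord0 i)).
  by rewrite pmulr_rge0 ?mulr_gt0// subr_ge0.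
transitivity (\sum_(i < n) (enorm v ^+ 2 * u ord0 i ^+ 2 +
    (- (2 * (enorm u * enorm v)) * (u ord0 i * v ord0 i) +
     enorm u ^+ 2 * v ord0 i ^+ 2))).
  by apply: eq_bigr => i _; ring.
rewrite !big_split/= -!mulr_sumr -!enorm_sqr; ring.
Qed.

Lemma enormD u v : enorm (u + v) <= enorm u + enorm v.
Proof.
rewrite -ler_sqr ?nnegrE ?addr_ge0 ?enorm_ge0// enorm_sqr.
under eq_bigr do rewrite mxE sqrrD.
under eq_bigr do rewrite -mulr_natl.
rewrite !big_split/= -!enorm_sqr sqrrD lerD2r lerD2l -mulr_sumr.
by have := dot_le_enorm u v; lra.
Qed.

Lemma enorm_distD w u v : enorm (u - v) <= enorm (u - w) + enorm (w - v).
Proof. by rewrite (le_trans _ (enormD _ _))// addrA subrK. Qed.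

Lemma enorm_le_sum v : enorm v <= \sum_(i < n) `|v ord0 i|.
Proof.
rewrite -ler_sqr ?nnegrE ?enorm_ge0 ?sumr_ge0// enorm_sqr.
have H : forall (s : seq 'I_n),
    \sum_(i <- s) v ord0 i ^+ 2 <= (\sum_(i <- s) `|v ord0 i|) ^+ 2.
  elim=> [|i s IH]; first by rewrite !big_nil expr0n.
  rewrite !big_cons sqrrD real_normK ?num_real// -addrA lerD2l.
  by rewrite (le_trans IH)// lerDr mulrn_wge0// mulr_ge0// sumr_ge0.
exact: H.
Qed.

Lemma ler_enormB u v : `|enorm u - enorm v| <= enorm (u - v).
Proof.
rewrite ler_norml lerNl opprB !lerBlDr; apply/andP; split.
  by rewrite enormB (le_trans _ (enormD _ _))// subrK.
by rewrite (le_trans _ (enormD _ _))// subrK.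
Qed.

Lemma mxnorm_leP v (M : R) :
  0 <= M -> `|v| <= M <-> forall i, `|v ord0 i| <= M.
Proof.
move=> M0; rewrite [`|v|]mx_normrE; split.
  by move=> /bigmax_leP[_ /= + i] => /(_ (ord0, i) isT).
by move=> vM; apply/bigmax_leP; split=> // -[i j] _ /=; rewrite (ord1 i).
Qed.

Lemma coord_le_mxnorm v i : `|v ord0 i| <= `|v|.
Proof. by have /mxnorm_leP := lexx `|v|; exact. Qed.

Lemma mxnorm_le_enorm v : `|v| <= enorm v.
Proof. by apply/mxnorm_leP; [exact: enorm_ge0|exact: coord_le_enorm]. Qed.

Lemma enorm_le_mxnorm v : enorm v <= n%:R * `|v|.
Proof.
rewrite (le_trans (enorm_le_sum v))// -[X in X%:R * _](card_ord n).
rewrite -sum1_card natr_sum mulr_suml ler_sum// => i _; rewrite mul1r.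
exact: coord_le_mxnorm.
Qed.

Lemma enorm_continuous : continuous (enorm : 'rV[R]_n -> R).
Proof.
move=> v; apply/(@cvgrPdist_lt _ _ _ (nbhs v)) => e e0.
have d0 : 0 < e / (n%:R + 1) by rewrite divr_gt0// ltr_wpDl.
apply/nbhs_ballP; exists (e / (n%:R + 1)) => //= w; rewrite -ball_normE /=.
rewrite ltr_pdivlMr ?ltr_wpDl// => vw.
rewrite (le_lt_trans (ler_enormB _ _))// (le_lt_trans (enorm_le_mxnorm _))//.
by apply: le_lt_trans vw; rewrite mulrC ler_wpM2l// lerDl.
Qed.

Lemma cvg_rowP (T : Type) (F : set_system T) {FF : Filter F}
    (f : T -> 'rV[R]_n) v :
  f x @[x --> F] --> v <-> forall i, f x ord0 i @[x --> F] --> v ord0 i.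
Proof.
split=> [fv i|fv].
  apply: (@cvg_comp _ _ _ f (fun w : 'rV[R]_n => w ord0 i) _ _ _ fv).
  exact: coord_continuous.
have H (e : R) : 0 < e ->
    \forall x \near F, forall i, `|v ord0 i - f x ord0 i| <= e.
  by move=> e0; apply: filter_forall => i; move/cvgrPdist_le : (fv i); exact.
apply/cvgrPdist_le => e e0; apply: filterS (H _ e0) => x fx.
by apply/mxnorm_leP => [|i]; [exact: ltW|rewrite !mxE].
Qed.

End EuclideanNormTheory.

Section DerivativeRow.
Context {R : realType} {n : nat}.

Lemma is_derive1P (V : normedModType R) (f : R -> V) (t : R) (d : V) :
  is_derive t 1 f d <-> h^-1 *: (f (h + t) - f t) @[h --> 0^'] --> d.
Proof.
have E : (fun h : R => h^-1 *: (f (h *: (1 : R) + t) - f t)) =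
         (fun h => h^-1 *: (f (h + t) - f t)).
  by apply/funext => h; rewrite [h *: 1]mulr1.
split.
  case=> dv <-; rewrite -E; exact: dv.
move=> cv; apply: DeriveDef.
  by apply/cvg_ex; exists d; rewrite /= E.
by rewrite /derive /= E; apply/cvg_lim => //; exact: norm_hausdorff.
Qed.

Lemma derive1_is_derive (V : normedModType R) (f : R -> V) (t : R) (d : V) :
  is_derive t 1 f d -> derive1 f t = d.
Proof. by move=> fd; rewrite derive1E; exact: derive_val. Qed.

Lemma derivable_derive1 (V : normedModType R) (f : R -> V) (t : R) :
  derivable f t 1 -> is_derive t 1 f (derive1 f t).
Proof. by move=> fd; rewrite derive1E; exact: DeriveDef. Qed.

Lemma is_derive_rowP (x : R -> 'rV[R]_n) (t : R) (d : 'rV[R]_n) :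
  is_derive t 1 x d <->
  forall i, is_derive t 1 (fun s => x s ord0 i) (d ord0 i).
Proof.
split=> [/is_derive1P /cvg_rowP xd i|xd].
  apply/is_derive1P; apply: cvg_trans (xd i).
  by apply: near_eq_cvg; near=> h; rewrite !mxE.
apply/is_derive1P/cvg_rowP => i; have /is_derive1P := xd i.
apply: cvg_trans; apply: near_eq_cvg; near=> h; by rewrite !mxE.
Unshelve. all: by end_near. Qed.

(** Applying the scalar theorem to the projection of [x] on its own increment
    keeps the Euclidean norm on both sides. *)
Lemma mean_value_inequality (x dx : R -> 'rV[R]_n) (a b M : R) : a <= b ->
  {within `[a, b], continuous x} ->
  (forall t, t \in `]a, b[ -> is_derive t 1 x (dx t)) ->
  (forall t, t \in `]a, b[ -> enorm (dx t) <= M) ->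
  enorm (x b - x a) <= M * (b - a).
Proof.
rewrite le_eqVlt => /predU1P[<-|ab] cx dxx dxM.
  by rewrite !subrr enorm0 mulr0.
pose v := x b - x a.
pose g t := \sum_(i < n) v ord0 i * x t ord0 i.
pose dg t := \sum_(i < n) v ord0 i * dx t ord0 i.
have [c cab gab] : exists2 c, c \in `]a, b[ & g b - g a = dg c * (b - a).
  apply: (MVT ab) => [t tab|].
    rewrite /g /dg.
    rewrite (_ : (fun t => _) =
        \sum_(i < n) (fun t => v ord0 i *: x t ord0 i)); last first.
      by apply/funext => s; rewrite fct_sumE.
    apply: is_derive_sum => i; apply: is_deriveZ.
    by have /is_derive_rowP := dxx _ tab; exact.
  have cG : continuous (fun w : 'rV[R]_n => \sum_(i < n) v ord0 i * w ord0 i).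
    apply: continuous_big => [|i _ w]; first exact: add_continuous.
    by apply: (@cvgMr _ _ (nbhs w)); exact: coord_continuous.
  by move=> t; apply: continuous_comp (cx t) (cG _).
have vv : enorm v ^+ 2 = g b - g a.
  rewrite enorm_sqr /g -sumrB; apply: eq_bigr => i _.
  by rewrite -mulrBr expr2 [in LHS]/v !mxE.
have [->|v0] := eqVneq (enorm v) 0.
  rewrite mulr_ge0 ?subr_ge0 ?(ltW ab)//.
  by rewrite (le_trans (enorm_ge0 _) (dxM _ cab)).
have vp : 0 < enorm v by rewrite lt_def v0 enorm_ge0.
rewrite -/v -(ler_pM2l vp) -expr2 vv gab mulrA ler_wpM2r ?subr_ge0 ?(ltW ab)//.
by rewrite (le_trans (dot_le_enorm _ _))// ler_pM2l// dxM.
Qed.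

End DerivativeRow.

(** * Continuous paths and the supremum norm *)

Section ContinuousPaths.
Context {R : realType} {n : nat}.
Implicit Types (x y : R -> 'rV[R]_n) (r s t u : R).

Lemma within_continuousP (A : set R) x :
  {within A, continuous x} <->
  (forall s, A s -> forall e : R, 0 < e -> exists2 d : R, 0 < d &
    forall u, A u -> `|u - s| < d -> enorm (x u - x s) < e).
Proof.
split=> [/subspace_continuousP xA s As e e0|xA].
  have d0 : 0 < e / (n%:R + 1) by rewrite divr_gt0// ltr_wpDl.
  have /nbhs_ballP[d /= dp dA] :
      nbhs s [set u | A u -> `|x s - x u| < e / (n%:R + 1)].
    by have /cvgrPdist_lt := xA s As; exact.
  exists d => // u Au us; have := dA u.
  rewrite -ball_normE /= distrC us => /(_ isT Au).
  rewrite ltr_pdivlMr ?ltr_wpDl// => vw.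
  rewrite enormB (le_lt_trans (enorm_le_mxnorm _))//.
  by apply: le_lt_trans vw; rewrite mulrC ler_wpM2l// lerDl.
apply/subspace_continuousP => s As; apply/cvgrPdist_lt => e e0.
have [d d0 dA] := xA s As e e0.
apply/nbhs_ballP; exists d => //= u; rewrite -ball_normE /= distrC => us Au.
rewrite (le_lt_trans (mxnorm_le_enorm _))// enormB; exact: dA.
Qed.

Lemma within_continuous_eq (A : set R) x y :
  (forall s, A s -> x s = y s) ->
  {within A, continuous x} -> {within A, continuous y}.
Proof.
move=> xy /within_continuousP xA; apply/within_continuousP => s As e e0.
by have [d d0 dA] := xA s As e e0; exists d => // u Au us; rewrite -!xy// dA.
Qed.

Lemma within_continuous_shift (A : set R) x t :
  {within A, continuous x} ->
  {within [set s | A (t + s)], continuous (fun s => x (t + s))}.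
Proof.
move=> /within_continuousP xA; apply/within_continuousP => s As e e0.
have [d d0 dA] := xA (t + s) As e e0; exists d => // u Au us.
by apply: dA => //; rewrite opprD addrACA subrr add0r.
Qed.

Lemma within_uniform_continuous x (a b : R) :
  {within `[a, b], continuous x} ->
  forall e : R, 0 < e -> exists2 d : R, 0 < d &
    forall s u, s \in `[a, b] -> u \in `[a, b] -> `|s - u| < d ->
      enorm (x s - x u) < e.
Proof.
move=> /within_continuousP cx e e0.
have /compact_near_coveringP := @segment_compact R a b.
move=> /(_ _ (0^'+ : set_system R) (fun d s => s \in `[a, b] ->
  forall u, u \in `[a, b] -> `|s - u| < d -> enorm (x s - x u) < e)).
have H s : `[a, b]%classic s -> \forall s' \near s & d \near 0^'+,
    s' \in `[a, b] -> forall u, u \in `[a, b] -> `|s' - u| < d ->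
      enorm (x s' - x u) < e.
  have e20 : 0 < e / 2 by rewrite divr_gt0.
  move=> sab; have [d d0 dA] := cx s sab _ e20.
  have d20 : 0 < d / 2 by rewrite divr_gt0.
  exists (ball s (d / 2), [set d' | d' < d / 2]) => /=.
    by split; [exact: nbhsx_ballx|exact: nbhs_right_lt].
  case=> s' d' [/=]; rewrite -ball_normE /= distrC => ss' dd' s'ab u uab s'u.
  have := dA s' s'ab; have := dA u uab.
  have -> : `|u - s| < d.
    rewrite [d]splitr (le_lt_trans (ler_distD s' _ _))// ltrD//.
    by rewrite distrC (lt_trans s'u).
  have -> : `|s' - s| < d by rewrite (lt_trans ss')// ltr_pdivrMr// ltr_pMr// ltr1n.
  move=> /(_ isT) us /(_ isT) s's.
  rewrite (le_lt_trans (enorm_distD (x s) _ _))// [ltRHS]splitr ltrD//.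
  by rewrite enormB.
move=> /(_ _ H) [d /= d0 dA].
exists (d / 2) => [|s u sab uab su]; first by rewrite divr_gt0.
apply: (dA (d / 2)) => //=; last by rewrite divr_gt0.
by rewrite sub0r normrN gtr0_norm ?divr_gt0// ltr_pdivrMr// ltr_pMr// ltr1n.
Qed.

Lemma within_bounded x (a b : R) : {within `[a, b], continuous x} ->
  exists2 M : R, 0 <= M & forall s, s \in `[a, b] -> enorm (x s) <= M.
Proof.
have [ab cx|ba _] := leP a b; last first.
  by exists 0 => // s; rewrite in_itv/= => /andP[/le_trans h /h]; rewrite leNgt ba.
have [|c cab cM] := @EVT_max R (enorm \o x) a b ab.
  move=> t; apply: (@continuous_comp (subspace `[a, b]) _ _ x enorm t (cx t)).
  exact: enorm_continuous.
by exists (enorm (x c)); [exact: enorm_ge0|].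
Qed.

End ContinuousPaths.

Section SupNorm.
Context {R : realType} {n : nat}.
Implicit Types (x y : R -> 'rV[R]_n) (r s t u : R).

Lemma ler_dist_of_le (a b c : R) : a <= c + b -> b <= c + a -> `|a - b| <= c.
Proof. by move=> ab ba; rewrite ler_norml; lra. Qed.

Lemma le_sup_norm r x s : C0 r x -> s \in `[- r, 0] -> enorm (x s) <= sup_norm r x.
Proof.
move=> /within_bounded[M M0 xM] sr; apply: sup_upper_bound; last by exists s.
by split; [exists (enorm (x s)), s|exists M => _ [u ur <-]; exact: xM].
Qed.

Lemma sup_norm_le r x (M : R) : 0 <= M ->
  (forall s, s \in `[- r, 0] -> enorm (x s) <= M) -> sup_norm r x <= M.
Proof.
move=> M0 xM; rewrite /sup_norm.
have [->|/set0P A0] := eqVneq [set enorm (x s) | s in `[- r, 0]] set0.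
  by rewrite sup0.
by apply: ge_sup => // _ [s sr <-]; exact: xM.
Qed.

Lemma sup_norm_ge0 r x : 0 <= sup_norm r x.
Proof.
have [hs|/sup_out] := pselect (has_sup [set enorm (x s) | s in `[- r, 0]]);
  last by rewrite /sup_norm => ->.
case: (hs) => -[_ [s sr _]] _.
rewrite (le_trans (enorm_ge0 (x s)))//; apply: sup_upper_bound => //.
by exists s.
Qed.

Lemma eq_sup_norm r x y : {in `[- r, 0], x =1 y} -> sup_norm r x = sup_norm r y.
Proof.
move=> xy; congr sup; apply/seteqP; split => _ [s sr <-]; exists s => //.
  by rewrite xy.
by rewrite xy.
Qed.

Lemma eq_C0 r x y : {in `[- r, 0], x =1 y} -> C0 r x -> C0 r y.
Proof. by move=> xy; apply: within_continuous_eq => s sr; exact: xy. Qed.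

Lemma C0B r x y : C0 r x -> C0 r y -> C0 r (x - y).
Proof. by move=> cx cy t; exact: cvgB (cx t) (cy t). Qed.

Lemma C0_cst r (v : 'rV[R]_n) : C0 r (cst v).
Proof. by apply: continuous_subspaceT => t; exact: cvg_cst. Qed.

Lemma sup_normD r x y : C0 r x -> C0 r y ->
  sup_norm r (x + y) <= sup_norm r x + sup_norm r y.
Proof.
move=> cx cy; apply: sup_norm_le => [|s sr].
  by rewrite addr_ge0// sup_norm_ge0.
by rewrite (le_trans (enormD _ _))// lerD// le_sup_norm.
Qed.

Lemma sup_normB r x y : sup_norm r (x - y) = sup_norm r (y - x).
Proof.
congr sup; apply/seteqP; split => _ [s sr <-]; exists s => //.
  exact: (enormB (y s) (x s)).
exact: (enormB (x s) (y s)).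
Qed.

Lemma sup_norm0 r : sup_norm r (cst 0 : R -> 'rV[R]_n) = 0.
Proof.
apply/eqP; rewrite eq_le sup_norm_ge0 andbT; apply: sup_norm_le => // s _.
by rewrite enorm0.
Qed.

Lemma C0_segment r x t T : 0 <= t <= T -> {within `[- r, T], continuous x} ->
  C0 r (segment_at x t).
Proof.
move=> /andP[t0 tT] cx; apply: (continuous_subspaceW _ (within_continuous_shift (t := t) cx)).
move=> s /=; rewrite !in_itv/= => /andP[rs s0]; apply/andP; split.
  by rewrite (le_trans rs)// lerDr.
by rewrite (le_trans _ tT)// gerDl.
Qed.

End SupNorm.

Opaque sup_norm.

(** * The fundamental theorem of calculus for absolutely continuous functions *)

Section AbsoluteContinuity.
Context {R : realType}.
Implicit Types (F G : R -> R) (a b : R).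
Local Notation mu := (@lebesgue_measure R).

Definition nonoverlap (I J : R * R) := (I.2 <= J.1) || (J.2 <= I.1).

Definition subpair a b (I : R * R) := [&& a <= I.1, I.1 <= I.2 & I.2 <= b].

(** Families of intervals are sequences here, because the proofs below refine and
    concatenate them. *)
Definition ac_on a b F :=
  forall e : R, 0 < e -> exists2 d : R, 0 < d &
    forall s : seq (R * R), all (subpair a b) s -> pairwise nonoverlap s ->
      \sum_(I <- s) (I.2 - I.1) < d -> \sum_(I <- s) `|F I.2 - F I.1| < e.

Definition clamp a b (x : R) := Num.max a (Num.min x b).

Lemma clamp_homo a b : {homo clamp a b : x y / x <= y}.
Proof.
move=> x y xy; rewrite /clamp ge_max !le_max lexx/=.
by rewrite le_min !ge_min xy lexx orbT/= orbT.
Qed.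

Lemma clampP a b x : a <= b -> a <= clamp a b x <= b.
Proof. by move=> ab; rewrite /clamp le_max lexx ge_max ab ge_min lexx orbT. Qed.

Lemma clampB a b x y : x <= y -> clamp a b y - clamp a b x <= y - x.
Proof.
move=> xy; suff: clamp a b y - y <= clamp a b x - x by lra.
rewrite /clamp !maxEle !minEle.
by do !case: ifPn; rewrite -?ltNge => *; lra.
Qed.

Lemma clamp_id a b x : a <= x <= b -> clamp a b x = x.
Proof. by move=> /andP[ax xb]; rewrite /clamp (min_idPl xb) (max_idPr ax). Qed.

Lemma ac_on_dist a b F : ac_on a b F -> forall e : R, 0 < e ->
  exists2 d : R, 0 < d & forall x y, a <= x -> x <= y -> y <= b -> y - x < d ->
    `|F y - F x| < e.
Proof.
move=> acF e /acF[d d0 dF]; exists d => // x y ax xy yb yxd.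
have := dF [:: (x, y)]; rewrite !big_seq1 /= /subpair/= ax xy yb/=.
by move=> /(_ isT isT yxd).
Qed.

(** An open set of small Lebesgue measure is a countable disjoint union of open
    intervals; absolute continuity bounds the increments of [G] over any
    finitely many of them. *)
Lemma ac_on_null a b (G : cumulative R R) : a <= b -> ac_on a b G ->
  (forall x, G x = G (clamp a b x)) ->
  forall A : set R, measurable A -> A `<=` `]a, b] -> mu A = 0%E ->
  lebesgue_stieltjes_measure G A = 0%E.
Proof.
move=> ab acG Gclamp A mA Aab A0.
pose nu := lebesgue_stieltjes_measure G.
have nu_oc x y : x <= y -> nu `]x, y]%classic = (G y - G x)%:E.
  move=> xy; rewrite /nu /lebesgue_stieltjes_measure /measure_extension.
  by rewrite measurable_mu_extE/= ?wlength_itv_bnd//; exact: is_ocitv.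
apply/eqP; rewrite eq_le measure_ge0 andbT; apply/lee_addgt0Pr => e e0.
rewrite add0e; have [d d0 dG] := acG e e0.
have Afin : (mu A < +oo)%E by rewrite A0 ltry.
have [U0 [oU0 AU0 U0d]] := lebesgue_regularity_outer mA Afin d0.
(* The bounded window makes the components of the open set bounded intervals. *)
pose U := U0 `&` `]a - 1, b + 1[%classic.
have oU : open U by apply: openI => //; exact: interval_open.
have mU : measurable U by exact: open_measurable.
have AU : A `<=` U.
  move=> t At; split; first exact: AU0.
  have := Aab _ At; rewrite /= !in_itv/= => /andP[at_ tb]; apply/andP; split.
    by rewrite (lt_trans _ at_)// ltrBlDr ltrDl.
  by rewrite (le_lt_trans tb)// ltrDl.
have Ud : (mu U < d%:E)%E.
  have mD : measurable (U0 `\` A).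
    by apply: measurableD => //; exact: open_measurable.
  suff H : (mu U <= mu (U0 `\` A))%E by exact: le_lt_trans H U0d.
  have -> : mu (U0 `\` A) = mu ((U0 `\` A) `|` A).
    rewrite measureU//; first by rewrite [X in (_ + X)%E]A0 adde0.
    by apply/seteqP; split => t // [[]].
  apply: le_measure; rewrite ?inE//; first exact: measurableU.
  by move=> t [Ut _]; have [|] := pselect (A t); [right|left].
pose I := open_disjoint_itv oU.
have UI : U = \bigcup_k I k by exact: open_disjoint_itv_bigcup.
have oI k : open (I k) by exact: open_disjoint_itv_open.
have mI k : measurable (I k) by exact: open_measurable.
have IU k : I k `<=` U by rewrite UI; exact: bigcup_sup.
pose al k := inf (I k); pose be k := sup (I k).
have Iab k t : I k t -> a - 1 < t < b + 1.
  by move=> /IU[_]; rewrite /= in_itv.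
have IE k : I k = `]al k, be k[%classic.
  have /interior_id {1}<- := oI k; rewrite interval_bounded_interior//.
  - exact: open_disjoint_itv_is_interval.
  - by exists (a - 1) => t /Iab/andP[/ltW].
  - by exists (b + 1) => t /Iab/andP[_ /ltW].
(* The k-th component clamped to `[a, b], or a trivial pair if it is empty. *)
pose pr k := if al k < be k then (clamp a b (al k), clamp a b (be k)) else (a, a).
have nuI k : (nu (I k) <= (G (pr k).2 - G (pr k).1)%:E)%E.
  rewrite IE /pr; case: ltP => [ab'|ba] /=; last first.
    have -> : `]al k, be k[%classic = set0.
      by rewrite set_itv_ge// bnd_simp -leNgt.
    by rewrite subrr /nu measure0.
  rewrite -!Gclamp -nu_oc ?(ltW ab')//; apply: le_measure; rewrite ?inE//.
  by apply: subset_itvl; rewrite bnd_simp.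
have lamI k : (((pr k).2 - (pr k).1)%:E <= mu (I k))%E.
  rewrite IE /pr; case: ltP => [ab'|ba] /=; last by rewrite subrr.
  rewrite lebesgue_measure_itv/= lte_fin ab' -EFinB lee_fin.
  by rewrite clampB// ltW.
have prsub k : subpair a b (pr k).
  rewrite /pr; case: ifPn => [ab'|_]; last by rewrite /subpair/= lexx.
  rewrite /subpair/=; have /andP[-> _] := clampP (al k) ab.
  by have /andP[_ ->] := clampP (be k) ab; rewrite clamp_homo// ltW.
have prdisj k l : k != l -> nonoverlap (pr k) (pr l).
  move=> kl; rewrite /nonoverlap {1}/pr {2}/pr.
  have /andP[ak _] : subpair a b (pr k) by [].
  have /andP[al' _] : subpair a b (pr l) by [].
  case: (ltP (al k) (be k)) => [abk|_]; last by rewrite /= al'.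
  rewrite {2}/pr; case: (ltP (al l) (be l)) => [abl|_]; last first.
    by move: ak; rewrite /pr abk /= => ->; rewrite orbT.
  rewrite /pr abk abl /=.
  have [h|h] := leP (be k) (al l); first by rewrite clamp_homo.
  have [h'|h'] := leP (be l) (al k); first by rewrite (clamp_homo a b h') orbT.
  exfalso; have := open_disjoint_itv_trivIset (oU := oU) (i := k) (j := l) Logic.I Logic.I.
  have : I k `&` I l !=set0.
    have : Num.max (al k) (al l) < Num.min (be k) (be l).
      by rewrite gt_max !lt_min abk h' h abl.
    move=> /midf_lt[]; set m := _ / 2; rewrite gt_max lt_min.
    move=> /andP[km lm] /andP[mk ml]; exists m.
    by rewrite !IE /= !in_itv/= km lm mk ml.
  move=> ne /(_ ne) kl'; by rewrite kl' eqxx in kl.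
apply: (@le_trans _ _ (nu U)); first by apply: le_measure; rewrite ?inE.
have -> : nu U = (\sum_(k <oo) nu (I k))%E.
  rewrite UI; apply: measure_semi_bigcup; rewrite -?UI//.
  exact: open_disjoint_itv_trivIset.
apply: lime_le; first by apply: is_cvg_nneseries => k _ _; exact: measure_ge0.
apply: nearW => m.
pose s := [seq pr k | k <- iota 0 m].
apply: (@le_trans _ _ (\sum_(0 <= k < m) (G (pr k).2 - G (pr k).1)%:E)%E).
  exact: lee_sum.
rewrite sumEFin lee_fin; apply: ltW.
have := dG s; rewrite /s !big_map -/(index_iota 0 m).
have -> : iota 0 m = index_iota 0 m by rewrite /index_iota subn0.
move=> H; apply: le_lt_trans (H _ _ _).
- by apply: ler_sum => k _; exact: ler_norm.
- by rewrite all_map; apply/allP => k _ /=.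
- rewrite pairwise_map; have := iota_uniq 0 m; rewrite uniq_pairwise.
  by rewrite /index_iota subn0; apply: sub_pairwise => k l; exact: prdisj.
- rewrite -lte_fin -sumEFin; apply: le_lt_trans Ud.
  apply: (@le_trans _ _ (\sum_(0 <= k < m) mu (I k))%E); first exact: lee_sum.
  have -> : mu U = (\sum_(k <oo) mu (I k))%E.
    rewrite UI; apply: measure_semi_bigcup; rewrite -?UI//.
    exact: open_disjoint_itv_trivIset.
  by apply: nneseries_lim_ge => k _ _; exact: measure_ge0.
Qed.

End AbsoluteContinuity.

Section Density.
Context {R : realType}.
Implicit Types (F G : R -> R) (a b : R).
Local Notation mu := (@lebesgue_measure R).

Lemma ac_on_clamp_continuous a b F : a <= b -> ac_on a b F ->
  continuous (fun x => F (clamp a b x)).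
Proof.
move=> ab acF x; apply/cvgrPdist_lt => e /(ac_on_dist acF)[d d0 dF].
apply/nbhs_ballP; exists d => //= y; rewrite /ball /= => xy.
have [axc xcb] : a <= clamp a b x /\ clamp a b x <= b by apply/andP/clampP.
have [ayc ycb] : a <= clamp a b y /\ clamp a b y <= b by apply/andP/clampP.
have [le_xy|le_yx] := leP x y.
  rewrite distrC dF ?clamp_homo// (le_lt_trans (clampB a b le_xy))//.
  by rewrite (le_lt_trans (ler_norm _))// distrC.
rewrite dF ?clamp_homo ?(ltW le_yx)//.
by rewrite (le_lt_trans (clampB a b (ltW le_yx)))// (le_lt_trans (ler_norm _)).
Qed.

(** The density is the Radon-Nikodym derivative of the Lebesgue-Stieltjes measure
    of [G], which is finite once [G] is extended by constants outside [[a, b]]. *)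
Lemma ac_nondecreasing_density a b G : a < b -> ac_on a b G ->
  (forall x y, a <= x -> x <= y -> y <= b -> G x <= G y) ->
  exists2 g : R -> R, mu.-integrable [set: R] (EFin \o g) &
    forall x y, a <= x -> x <= y -> y <= b ->
      (G y - G x)%:E = (\int[mu]_(t in `]x, y]) (g t)%:E)%E.
Proof.
move=> ab acG ndG; have leab := ltW ab.
pose Gc x := G (clamp a b x).
have Gc_nd : nondecreasing Gc.
  move=> x y xy; rewrite /Gc.
  have /andP[ax _] := clampP x leab; have /andP[_ yb] := clampP y leab.
  by apply: ndG => //; exact: clamp_homo.
have Gc_rc : right_continuous Gc.
  by apply: right_continuousW; exact: ac_on_clamp_continuous.
pose Gm := isCumulative.Build R _ R Gc Gc_nd Gc_rc.
pose G' : cumulative R R := HB.pack Gc Gm.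
pose nu := lebesgue_stieltjes_measure G'.
have nu_oc x y : a <= x -> x <= y -> y <= b ->
    nu `]x, y]%classic = (G y - G x)%:E.
  move=> ax xy yb; rewrite /nu /lebesgue_stieltjes_measure /measure_extension.
  rewrite measurable_mu_extE/= ?wlength_itv_bnd//; last exact: is_ocitv.
  rewrite /Gc !clamp_id//; first by rewrite ax (le_trans xy).
  by rewrite (le_trans ax).
pose nu' : {measure set (measurableTypeR R) -> \bar R} :=
  lebesgue_stieltjes_measure G'.
have mab : measurable (`]a, b]%classic : set (measurableTypeR R)) by [].
have nuab : (nu' `]a, b]%classic < +oo)%E by rewrite [nu' _]nu_oc// ltry.
pose m : {finite_measure set (measurableTypeR R) -> \bar R} := mfrestr mab nuab.
have m_mu : m `<< (@lebesgue_measure R).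
  move=> N N0 A mA AN; rewrite /m /= /mfrestr /mrestr.
  have mAab : measurable (A `&` `]a, b]%classic : set R) by exact: measurableI.
  have acG' : ac_on a b G'.
    move=> e /acG[d d0 dG]; exists d => // s /[dup] sab /dG H /H{}H /H.
    congr (_ < _); rewrite !big_seq; apply: eq_bigr => -[x y] /(allP sab).
    rewrite /subpair /= => /and3P[ax xy yb].
    by rewrite /Gc !clamp_id// ?ax ?yb ?(le_trans ax)// (le_trans xy).
  apply: (ac_on_null leab acG') => //.
  - move=> x /=; rewrite /Gc; congr G; rewrite [RHS]clamp_id//; exact: clampP.
  - by apply: (N0 (A `&` _)) => // t [/AN].
have [g [g0 gfin gint gE]] := radon_nikodym_sigma_finite m_mu.
have gE' : EFin \o (fine \o g) = g by apply/funext => t /=; rewrite fineK.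
exists (fine \o g); first by rewrite gE'.
move=> x y ax xy yb.
have -> : (\int[mu]_(t in `]x, y]) ((fine \o g) t)%:E)%E =
          (\int[mu]_(t in `]x, y]) g t)%E.
  by apply: eq_integral => t _ /=; rewrite fineK.
rewrite -gE// /m/= /mfrestr /mrestr -nu_oc//; congr (nu _).
apply/seteqP; split => t /= => [|[]//].
rewrite !in_itv/= => /andP[xt ty]; rewrite xt ty (le_lt_trans ax)//.
by rewrite (le_trans ty).
Qed.

End Density.

Section TotalVariation.
Context {R : realType}.
Implicit Types (F G : R -> R) (a b x y : R) (l : seq R) (s L : seq (R * R)).
Local Notation mu := (@lebesgue_measure R).

(** The consecutive intervals cut out by the points [x :: l], so that variations
    become sums over families of intervals. *)
Definition pieces x l : seq (R * R) := pairmap pair x l.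

Lemma variation_pieces x y F l :
  variation x y F l = \sum_(I <- pieces x l) `|F I.2 - F I.1|.
Proof.
elim: l x => [|z l IH] x; first by rewrite /variation /= !big_nil.
rewrite /= big_cons -IH /variation /= big_nat_recl//=; congr (_ + _).
Qed.

Lemma pieces_subpair x y l : path <%R x l -> last x l = y ->
  all (subpair x y) (pieces x l) /\ x <= y.
Proof.
elim: l x => [|z l IH] x /=; first by move=> _ ->.
move=> /andP[xz zl] /(IH _ zl)[lz zy]; split; last by rewrite (le_trans (ltW xz)).
rewrite /subpair /= lexx (ltW xz) zy/=.
apply: sub_all lz => -[u v]; rewrite /subpair /= => /and3P[zu -> ->].
by rewrite (le_trans (ltW xz)).
Qed.

Lemma pieces_nonoverlap x l : path <%R x l -> pairwise nonoverlap (pieces x l).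
Proof.
elim: l x => [|z l IH] x //= /andP[xz zl]; rewrite IH// andbT.
have [lz _] := pieces_subpair zl (erefl _).
by apply: sub_all lz => -[u v]; rewrite /subpair/nonoverlap /= => /and3P[->].
Qed.

Lemma pieces_length x l : \sum_(I <- pieces x l) (I.2 - I.1) = last x l - x.
Proof.
elim: l x => [|z l IH] x /=; first by rewrite big_nil subrr.
by rewrite big_cons IH/= addrC addrA subrK.
Qed.

(** Refining, one after the other, the intervals of [L] into partitions only
    produces longer admissible families, so the bound for the increments of
    [F] passes to its total variations. *)
Lemma ac_on_sum_tv a b F (e d : R) :
  (forall s, all (subpair a b) s -> pairwise nonoverlap s ->
      \sum_(I <- s) (I.2 - I.1) < d -> \sum_(I <- s) `|F I.2 - F I.1| < e) ->
  forall L s, all (subpair a b) (s ++ L) -> pairwise nonoverlap (s ++ L) ->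
    \sum_(I <- s ++ L) (I.2 - I.1) < d ->
    ((\sum_(I <- s) `|F I.2 - F I.1|)%:E +
     \sum_(I <- L) total_variation I.1 I.2 F <= e%:E)%E.
Proof.
move=> Fed; elim=> [|[x y] L IH] s.
  by rewrite cats0 big_nil adde0 lee_fin => sab sno sd; rewrite ltW// Fed.
rewrite all_cat pairwise_cat big_cat /= !big_cons allrel_consr /=.
move=> /and3P[sab]; rewrite {1}/subpair /= => /and3P[ax xy yb] Lab.
move=> /and4P[/andP[sJ sL] sno JL Lno] len.
have tv0 (I : R * R) : I \in L -> (0 <= total_variation I.1 I.2 F)%E.
  by move=> /(allP Lab)/and3P[_ + _]; exact: total_variation_ge0.
have T0 : (0 <= \sum_(I <- L) total_variation I.1 I.2 F)%E.
  by rewrite big_seq sume_ge0// => I /tv0.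
have Tfin : (\sum_(I <- L) total_variation I.1 I.2 F)%E \is a fin_num.
  rewrite ge0_fin_numE//; apply: le_lt_trans (ltry e).
  apply: le_trans (IH [::] _ _ _) => //=; first by rewrite big_nil add0e.
  apply: le_lt_trans len; rewrite -[leLHS]add0r lerD//.
    rewrite big_seq sumr_ge0// => I /(allP sab)/and3P[_ + _].
    by rewrite subr_ge0.
  by rewrite lerDr subr_ge0.
rewrite addeCA -leeBrDr; last by rewrite fin_numD Tfin.
apply/ge_ereal_sup => _ [_ [l [xl /eqP ly] <-] <-].
rewrite leeBrDr; last by rewrite fin_numD Tfin.
rewrite addeA -EFinD variation_pieces (addrC (\sum_(I <- pieces x l) _)) -big_cat.
have [lxy _] := pieces_subpair xl ly.
have inxy (P : R * R) : P \in pieces x l -> x <= P.1 /\ P.2 <= y.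
  by move=> /(allP lxy)/and3P[].
apply: IH.
- rewrite !all_cat sab Lab andbT/=; apply: sub_all lxy => -[u v].
  rewrite /subpair/= => /and3P[xu -> vy].
  by rewrite (le_trans ax xu)// (le_trans vy).
- rewrite !pairwise_cat sno Lno pieces_nonoverlap// allrel_catl sL !andbT/=.
  apply/andP; split.
    apply/allrelP => P I Pin Iin; have [xP Py] := inxy _ Pin.
    have := allP JL _ Iin; rewrite /nonoverlap/= => /orP[yI|Ix]; first by rewrite (le_trans Py).
    by rewrite (le_trans Ix xP) orbT.
  apply/allrelP => I P Iin Pin; have [xP Py] := inxy _ Pin.
  have := allP sJ _ Iin; rewrite /nonoverlap/= => /orP[Ix|yI]; first by rewrite (le_trans Ix).
  by rewrite (le_trans Py yI) orbT.
- by rewrite !big_cat/= pieces_length ly -addrA.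
Qed.

(** Over an interval shorter than the [d] that answers [1], the variation is at most
    [1]; finitely many such intervals cover [[a, b]]. *)
Lemma ac_on_bounded_variation a b F : a < b -> ac_on a b F ->
  bounded_variation a b F.
Proof.
move=> ab acF; have [d d0 dF] := acF 1 ltr01.
have small x y : a <= x -> x <= y -> y <= b -> y - x < d ->
    (total_variation x y F < +oo)%E.
  move=> ax xy yb xyd; apply: le_lt_trans (ltry 1).
  have := ac_on_sum_tv dF (L := [:: (x, y)]) (s := [::]).
  rewrite big_nil add0e big_seq1 /= /subpair /= ax xy yb big_seq1.
  exact.
apply/bounded_variationP; first exact: ltW.
rewrite ge0_fin_numE; last by rewrite total_variation_ge0// ltW.
have d20 : 0 < d / 2 by rewrite divr_gt0.
have step (k : nat) :
    (total_variation a (Num.min b (a + k%:R * (d / 2)))%R F < +oo)%E.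
  elim: k => [|k IH].
    by rewrite mul0r addr0 (min_idPr (ltW ab)) total_variationxx ltry.
  set u := Num.min _ _ in IH; set v := Num.min _ _.
  have au : a <= u by rewrite /u le_min (ltW ab) lerDl mulr_ge0// ltW.
  have vb : v <= b by rewrite /v ge_min lexx.
  have uv : u <= v.
    by rewrite /u /v le_min !ge_min lexx/= lerD2l ler_wpM2r ?ler_nat ?orbT// ltW.
  have vu : v - u < d.
    rewrite /v /u -natr1 mulrDl mul1r.
    by rewrite !minEle; do !case: ifPn; rewrite -?ltNge => *; lra.
  by rewrite (total_variationD _ au uv) lte_add_pinfty// small.
have [k bk] : exists k, b <= a + k%:R * (d / 2).
  exists (Num.truncn ((b - a) / (d / 2))).+1.
  rewrite -lerBlDl -ler_pdivrMr// ltW// truncnS_gt//.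
have := step k; by rewrite (min_idPl bk).
Qed.

Lemma ac_on_tv a b F : a < b -> ac_on a b F ->
  ac_on a b (fun x => fine (total_variation a x F)).
Proof.
move=> ab acF e e0; have e20 : 0 < e / 2 by rewrite divr_gt0.
have [d d0 dF] := acF _ e20; exists d => // s sab sno sd.
have bv := ac_on_bounded_variation ab acF.
have tvE I : I \in s -> total_variation I.1 I.2 F =
    (`|fine (total_variation a I.2 F) - fine (total_variation a I.1 F)|)%:E.
  move=> /(allP sab)/and3P[aI I12 Ib].
  have fin1 : total_variation a I.1 F \is a fin_num.
    apply/bounded_variationP => //; apply: bounded_variationl bv => //.
    exact: le_trans Ib.
  have fin2 : total_variation I.1 I.2 F \is a fin_num.
    apply/bounded_variationP => //.
    apply: (@bounded_variationr _ a) => //.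
    by apply: bounded_variationl bv => //; exact: le_trans I12.
  rewrite (total_variationD F aI I12) fineD// addrAC subrr add0r.
  by rewrite ger0_norm ?fineK// fine_ge0// total_variation_ge0.
have := ac_on_sum_tv dF (L := s) (s := [::]) sab sno sd.
rewrite big_nil add0e big_seq (eq_bigr _ tvE) -big_seq sumEFin lee_fin.
move=> /le_lt_trans; apply; lra.
Qed.

Lemma ac_onB a b F G : ac_on a b F -> ac_on a b G ->
  ac_on a b (fun x => F x - G x).
Proof.
move=> acF acG e e0; have e20 : 0 < e / 2 by rewrite divr_gt0.
have [d1 d10 dF] := acF _ e20; have [d2 d20 dG] := acG _ e20.
exists (Num.min d1 d2) => [|s sab sno]; first by rewrite lt_min d10.
rewrite lt_min => /andP[sd1 sd2].
rewrite [e]splitr; apply: le_lt_trans (ltrD (dF s sab sno sd1) (dG s sab sno sd2)).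
rewrite -big_split/=; apply: ler_sum => I _.
have -> : F I.2 - G I.2 - (F I.1 - G I.1) =
  (F I.2 - F I.1) - (G I.2 - G I.1) by ring.
exact: ler_normB.
Qed.

(** The fundamental theorem of calculus for absolutely continuous functions:
    [F] is the difference of the nondecreasing functions [T] and [T - F], where
    [T] is its total variation; the Lebesgue-Stieltjes measures of both are
    dominated by the Lebesgue measure, so both have densities, and Lebesgue's
    differentiation theorem identifies the density with the derivative. *)
Theorem ac_on_ftc a b F : a < b -> ac_on a b F ->
  exists g : R -> R, [/\ mu.-integrable [set: R] (EFin \o g),
    forall x y, a <= x -> x <= y -> y <= b ->
      F y - F x = (\int[mu]_(t in `]x, y]) g t)%R &
    {ae mu, forall t : R, a < t < b -> is_derive t 1 F (g t)}].
Proof.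
move=> ab acF; pose T x := fine (total_variation a x F).
have bv := ac_on_bounded_variation ab acF.
have fin1 x : a <= x -> x <= b -> total_variation a x F \is a fin_num.
  move=> ax xb; apply/bounded_variationP => //.
  exact: bounded_variationl bv.
have TD x y : a <= x -> x <= y -> y <= b -> `|F y - F x| <= T y - T x.
  move=> ax xy yb; rewrite -lee_fin (le_trans (total_variation_ge F xy))//.
  have fxy : total_variation x y F \is a fin_num.
    apply/bounded_variationP => //.
    apply: (@bounded_variationr _ a) => //.
    by apply: bounded_variationl bv => //; exact: le_trans xy.
  rewrite /T (total_variationD F ax xy) fineD// ?fin1// ?(le_trans xy)//.
  by rewrite addrAC subrr add0r fineK.
have acT : ac_on a b T by exact: ac_on_tv.
have ndT x y : a <= x -> x <= y -> y <= b -> T x <= T y.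
  by move=> ax xy yb; rewrite -subr_ge0 (le_trans _ (TD _ _ ax xy yb)).
have [g1 ig1 g1E] := ac_nondecreasing_density ab acT ndT.
have ndH x y : a <= x -> x <= y -> y <= b -> T x - F x <= T y - F y.
  move=> ax xy yb; have := TD _ _ ax xy yb; have := ler_norm (F y - F x); lra.
have [g2 ig2 g2E] := ac_nondecreasing_density ab (ac_onB acT acF) ndH.
pose g t := g1 t - g2 t.
have ig : mu.-integrable [set: R] (EFin \o g).
  by rewrite (_ : EFin \o g = ((EFin \o g1) \- (EFin \o g2))%E)//; exact: integrableB.
have gE x y : a <= x -> x <= y -> y <= b ->
    F y - F x = (\int[mu]_(t in `]x, y]) g t)%R.
  move=> ax xy yb; apply: EFin_inj; rewrite /Rintegral fineK; last first.
    apply: integrable_fin_num => //.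
    by apply: integrableS ig.
  rewrite /g; under eq_integral do rewrite EFinB.
  rewrite integralB//; [|exact: integrableS ig1|exact: integrableS ig2].
  rewrite -g1E// -g2E// -EFinB; congr (_%:E); lra.
exists g; split => //.
have locg : locally_integrable setT g.
  by apply: open_integrable_locally => //; exact: openT.
have := @FTC1 _ g (BRight a) _ locg; case=> [y|N [mN N0 NE]].
  by apply: integrableS ig.
exists N; split=> // s /= sF; apply: NE => /= H; apply: sF.
move=> /andP[asx sb]; have [dF1 F1s] := H asx.
set F1 := fun x => (\int[mu]_(t in _) g t)%R in dF1 F1s.
have /is_derive1P F1d : is_derive s 1 F1 (g s).
  by rewrite -F1s; exact: derivable_derive1.
apply/is_derive1P; apply: cvg_trans F1d; apply: near_eq_cvg.
have nab : \forall h \near (0:R)^', a < h + s < b.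
  have : \forall u \near s, a < u < b.
    by apply: near_in_itvoo; rewrite in_itv/= asx.
  move=> /nbhs_ballP[d /= d0 dab]; apply/nbhs_ballP; exists d => //= h h0 _.
  apply: dab; rewrite /ball /= in h0 *.
  by have -> : s - (h + s) = 0 - h by ring.
apply: filterS nab => h /andP[ah hb]; congr (_ *: _).
have F1E u : a < u -> u < b -> F u = F1 u + F a.
  by move=> au ub; rewrite /F1 -gE ?lexx ?(ltW au) ?(ltW ub)// subrK.
rewrite (F1E _ ah hb) (F1E _ asx sb).
by rewrite opprD addrACA subrr addr0.
Qed.

End TotalVariation.

(** * Translations in Lebesgue spaces *)

Section IntegralMonotone.
Import HBNNSimple.
Local Open Scope ereal_scope.
Context d (T : measurableType d) (R : realType) (mu : {measure set T -> \bar R}).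

(** Neither function need be measurable, because the integral of a nonnegative
    function is a supremum over the simple functions below it, and these may be
    cut off on a null set. *)
Lemma ae_ge0_le_integral_nonmeasurable (f g : T -> \bar R) :
  (forall t, 0 <= f t) -> (forall t, 0 <= g t) ->
  {ae mu, forall t, f t <= g t} -> \int[mu]_t f t <= \int[mu]_t g t.
Proof.
move=> f0 g0 [N [mN N0 fgN]].
rewrite (ge0_integralTE mu f0); apply: ge_ereal_sup => _ [h /= hf <-].
have mNC : measurable (~` N) by exact: measurableC.
have [Nh NhE] : exists h' : {nnsfun T >-> R}, h' = h \_ (~` N) :> (T -> R).
  by exists (proj_nnsfun h mNC); rewrite (mrestrict h mNC).
have -> : sintegral mu h = sintegral mu Nh.
  rewrite -!integralT_nnsfun (ge0_negligible_integral mN)//; last 2 first.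
  - exact/measurable_EFinP.
  - by move=> t _; rewrite lee_fin.
  rewrite setTD integral_mkcond; apply: eq_integral => t _.
  by rewrite NhE /= !patchE; case: ifP.
rewrite (ge0_integralTE mu g0); apply: ereal_sup_ubound; exists Nh => //= t.
rewrite NhE patchE; case: ifPn => [|_]; last exact: g0.
rewrite inE => Nt; apply: (le_trans (hf t)); apply: contrapT => fgt.
exact/Nt/fgN.
Qed.

Lemma ae_le_Lnorm (p : R) (f g : T -> R) : (0 < p)%R ->
  {ae mu, forall t, (`|f t| <= `|g t|)%R} ->
  'N[mu]_p%:E[EFin \o f] <= 'N[mu]_p%:E[EFin \o g].
Proof.
move=> p0 fg; rewrite unlock.
apply: gt0_ler_poweR.
- by rewrite invr_ge0 ltW.
- by rewrite in_itv/= leey andbT; apply: integral_ge0 => t _ /=;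
  rewrite lee_fin powR_ge0.
- by rewrite in_itv/= leey andbT; apply: integral_ge0 => t _ /=;
  rewrite lee_fin powR_ge0.
apply: ae_ge0_le_integral_nonmeasurable => [t|t|].
- exact: poweR_ge0.
- exact: poweR_ge0.
apply: filterS fg => t fgt; rewrite !poweR_EFin lee_fin.
by rewrite ge0_ler_powR// ?nnegrE ?(ltW p0).
Qed.

Lemma Lnorm_le_EFin (p e : R) (f : T -> R) : (0 < p)%R -> (0 <= e)%R ->
  \int[mu]_t (`|f t| `^ p)%:E <= (e `^ p)%:E -> 'N[mu]_p%:E[EFin \o f] <= e%:E.
Proof.
move=> p0 e0 fe; rewrite unlock.
have -> : e%:E = (e `^ p)%:E `^ p^-1.
  by rewrite poweR_EFin -powRrM mulfV ?gt_eqF// powRr1.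
apply: gt0_ler_poweR => //.
- by rewrite invr_ge0 ltW.
- by rewrite in_itv/= leey andbT; apply: integral_ge0 => t _ /=;
  rewrite lee_fin powR_ge0.
- by rewrite in_itv/= leey andbT lee_fin powR_ge0.
Qed.

End IntegralMonotone.

Section Translation.
Context {R : realType}.
Local Notation mu := (@lebesgue_measure R).
Implicit Types (u v : R -> R) (h p : R).

Lemma measurable_shift (h : R) : measurable_fun [set: R] (fun s : R => s + h).
Proof. by apply: measurable_funD => //; exact: measurable_cst. Qed.

Lemma lebesgue_measure_shift (h : R) (A : set R) : measurable A ->
  pushforward mu ((fun s : R => s + h) : _ -> measurableTypeR R) A = mu A.
Proof.
have mh := measurable_shift h.
move=> mA; apply/esym/lebesgue_measure_unique => //= _ [[a b]] _ <-.
rewrite /pushforward (_ : _ @^-1` _ = `]a - h, b - h]%classic); last first.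
  by apply/seteqP; split => t /=; rewrite !in_itv/= ltrBlDr lerBrDr.
rewrite !lebesgue_measure_itv/= !lte_fin ltrD2r; case: ifP => // _.
by congr (_%:E); ring.
Qed.

Lemma ge0_integral_shift (f : R -> \bar R) h :
  measurable_fun setT f -> (forall t, (0 <= f t)%E) ->
  (\int[mu]_t f (t + h)%R = \int[mu]_t f t)%E.
Proof.
move=> mf f0.
have := @ge0_integral_pushforward _ _ (measurableTypeR R) (measurableTypeR R) R
  (fun s : R => s + h) (measurable_shift h) mu setT f measurableT mf.
move=> /(_ (fun t _ => f0 t)); rewrite preimage_setT /= => <-.
have mh := measurable_shift h.
by apply: eq_measure_integral => //= A mA _; exact: lebesgue_measure_shift.
Qed.

Lemma Lnorm_shift p u h : measurable_fun setT u ->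
  ('N[mu]_p%:E[EFin \o (fun s => u (s + h)%R)] = 'N[mu]_p%:E[EFin \o u])%E.
Proof.
move=> mu_; rewrite unlock /=; congr poweR.
rewrite -(@ge0_integral_shift (fun t => `|(u t)%:E| `^ p)%E h)//.
- under eq_fun do rewrite abse_EFin poweR_EFin.
  apply/measurable_EFinP; apply: measurableT_comp (measurable_powR p) _.
  exact: measurableT_comp.
- by move=> t; exact: poweR_ge0.
Qed.

End Translation.

Section TranslationContinuity.
Context {R : realType}.
Local Notation mu := (@lebesgue_measure R).
Implicit Types (u v g : R -> R) (h p : R).

(** A bounded function of compact support is close in mean to a continuous one,
    which is uniformly continuous near the support. *)
Lemma integral_translation_continuous v (A M e : R) : 0 <= A -> 0 < e ->
  measurable_fun setT v -> (forall t, `|v t| <= M) ->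
  (forall t, A < `|t| -> v t = 0) ->
  exists2 d : R, 0 < d & forall h, `|h| < d ->
    (\int[mu]_t (`|v (t + h) - v t|)%:E <= e%:E)%E.
Proof.
move=> A0 e0 mv vM vA.
pose B := A + 1.
pose E : set R := `[- (B + 1), B + 1]%classic.
have mE : measurable E by exact: measurable_itv.
have muE : (mu E < +oo)%E by rewrite lebesgue_measure_itv/=; case: ifP; rewrite ?ltry.
have iv : mu.-integrable E (EFin \o v).
  apply: measurable_bounded_integrable => //; first exact: measurable_funTS.
  by exists M; split; [exact: num_real|move=> x Mx t _ /=; exact: le_trans (vM t) (ltW Mx)].
have [g_ [cg ig gv]] := approximation_continuous_integrable mE muE iv.
have e4 : (0 < (e / 4)%:E)%E by rewrite lte_fin divr_gt0.
have [n vg] : exists n, (\int[mu]_(z in E) `|(v z - g_ n z)%:E| <= (e / 4)%:E)%E.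
  have /fine_cvgP[fin /cvgrPdist_lt/(_ (e / 4))] := gv.
  rewrite divr_gt0// => /(_ isT) H.
  have [n _ /(_ n (leqnn n))[]] := filterI fin H.
  move=> fn; rewrite sub0r normrN => Hn; exists n.
  by rewrite -[leLHS]fineK// lee_fin ltW// (le_lt_trans (ler_norm _)).
set g := g_ n in vg; have {}cg : continuous g by exact: cg.
have B0 : 0 < B by rewrite /B ltr_wpDl.
have w0 : 0 < e / (4 * B) by rewrite divr_gt0// mulr_gt0.
have [d1 d10 gd1] : exists2 d : R, 0 < d & forall s u : R, s \in `[- (B + 1), B + 1] ->
    u \in `[- (B + 1), B + 1] -> `|s - u| < d -> `|g s - g u| < e / (4 * B).
  (* A scalar function is seen as a path in dimension one. *)
pose x := fun t => (\row_(i < 1) g t : 'rV[R]_1).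
  have [|d d0 dx] := @within_uniform_continuous R 1 x (- (B + 1)) (B + 1) _ _ w0.
    apply: continuous_subspaceT => t; apply/cvg_rowP => i.
    by under eq_fun do rewrite mxE; rewrite mxE; exact: cg.
  exists d => // s u sE uE /(dx _ _ sE uE); apply: le_lt_trans.
  by have := coord_le_enorm (x s - x u) ord0; rewrite !mxE.
exists (Num.min d1 1) => [|h]; first by rewrite lt_min d10 ltr01.
rewrite lt_min => /andP[hd1 h1].
pose k t := `|(v \- g) t| * \1_E t.
have k0 t : 0 <= k t by rewrite mulr_ge0.
have mk : measurable_fun setT k.
  apply: measurable_funM; last exact: measurable_indic.
  apply: measurableT_comp => //; apply: measurable_funB => //.
  exact: continuous_measurable_fun.
have kE : (\int[mu]_t (k t)%:E <= (e / 4)%:E)%E.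
  apply: le_trans vg; rewrite [in leRHS]integral_mkcond le_eqVlt; apply/orP; left.
  apply/eqP; apply: eq_integral => t _; rewrite /k patchE indicE.
  by case: ifP; rewrite ?mulr1 ?mulr0.
pose c t := e / (4 * B) * \1_(`[- B, B]%classic) t.
have c0 t : 0 <= c t by rewrite mulr_ge0// ltW.
have mc : measurable_fun setT c.
  by apply: measurable_funM; [exact: measurable_cst|exact: measurable_indic].
have Ic : (\int[mu]_t (c t)%:E = (e / 2)%:E)%E.
  under eq_integral do rewrite /c EFinM.
  rewrite ge0_integralZl//; last 2 first.
  - exact/measurable_EFinP/measurable_indic.
  - by rewrite lee_fin ltW.
  rewrite integral_indic//.
  have muB : mu `[- B, B]%classic = (2 * B)%:E.
    rewrite lebesgue_measure_itv/= lte_fin ifT; last by lra.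
    by rewrite -EFinB; congr (_%:E); ring.
  rewrite setIT [X in (_ * X)%E]muB -EFinM; congr (_%:E); field.
  by rewrite gt_eqF.
have inE_h t : t \in `[- B, B] -> t + h \in `[- (B + 1), B + 1].
  move: h1; rewrite ltr_norml !in_itv/= => /andP[? ?] /andP[? ?]; lra.
have inE_0 t : t \in `[- B, B] -> t \in `[- (B + 1), B + 1].
  rewrite !in_itv/= => /andP[? ?]; lra.
have key t : `|v (t + h) - v t| <= k (t + h) + (c t + k t).
  have [tB|tB] := boolP (t \in `[- B, B]); last first.
    have [v1 v2] : v (t + h) = 0 /\ v t = 0.
      split; apply: vA; move: tB h1; rewrite in_itv/= ltr_norml negb_and -!ltNge
        lter_normr /B => /orP[?|?] /andP[? ?]; apply/orP; lra.
    by rewrite v1 v2 subrr normr0 !addr_ge0.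
  rewrite /k /c !indicE !mem_set ?mulr1//; [|exact: inE_0|exact: inE_h].
  have -> : v (t + h) - v t = (v (t + h) - g (t + h)) +
      ((g (t + h) - g t) + - (v t - g t)) by ring.
  rewrite (le_trans (ler_normD _ _))// lerD2l (le_trans (ler_normD _ _))//.
  rewrite normrN lerD2r ltW// gd1//; [exact: inE_h|exact: inE_0|].
  by rewrite addrAC subrr add0r.
have mvh : measurable_fun [set: R] (fun t : R => v (t + h)).
  exact: measurableT_comp mv (measurable_shift h).
have mkh : measurable_fun [set: R] (fun t : R => k (t + h)).
  exact: measurableT_comp mk (measurable_shift h).
have H1 : (\int[mu]_t (`|v (t + h)%R - v t|)%:E <=
    \int[mu]_t ((k (t + h)%R)%:E + ((c t)%:E + (k t)%:E)))%E.
  apply: ae_ge0_le_integral_nonmeasurable => //.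
    by move=> t; rewrite -!EFinD lee_fin !addr_ge0.
  by apply: nearW => t; rewrite -!EFinD lee_fin.
apply: (le_trans H1).
rewrite ge0_integralD//; last 4 first.
- by move=> t _; rewrite lee_fin.
- exact/measurable_EFinP.
- by move=> t _; rewrite -EFinD lee_fin addr_ge0.
- by apply/measurable_EFinP; exact: measurable_funD.
rewrite ge0_integralD//; last 4 first.
- by move=> t _; rewrite lee_fin.
- exact/measurable_EFinP.
- by move=> t _; rewrite lee_fin.
- exact/measurable_EFinP.
rewrite (@ge0_integral_shift R (fun t => (k t)%:E)); last 2 first.
- exact/measurable_EFinP.
- by move=> t; rewrite lee_fin.
rewrite Ic.
have -> : (e%:E = (e / 4)%:E + ((e / 2)%:E + (e / 4)%:E))%E.
  by rewrite -!EFinD; congr (_%:E); field.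
apply: leeD; first exact: kE.
by apply: leeD; [exact: lexx|exact: kE].
Qed.

(** Truncation reduces the statement to bounded functions, for which the
    [p]-th power of the increments is controlled by the increments. *)
Lemma Lnorm_translation_continuous u (A p e : R) : 1 <= p -> 0 <= A -> 0 < e ->
  measurable_fun setT u -> ('N[mu]_p%:E[EFin \o u] < +oo)%E ->
  (forall t, A < `|t| -> u t = 0) ->
  exists2 d : R, 0 < d & forall h, `|h| < d ->
    ('N[mu]_p%:E[EFin \o (fun t => (u (t + h) - u t)%R)] <= e%:E)%E.
Proof.
move=> p1 A0 e0 mu_ ufin uA.
have p0 : 0 < p by exact: lt_le_trans p1.
pose tr (M : nat) t := if `|u t| <= M%:R then u t else 0.
have mau : measurable_fun setT (fun t => `|u t|) by exact: measurableT_comp.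
have mtr M : measurable_fun setT (tr M).
  apply: measurable_fun_ifT => //; apply: measurable_fun_ler => //.
have iu : mu.-integrable setT (fun t => (`|u t| `^ p)%:E).
  apply/integrableP; split.
    by apply/measurable_EFinP; apply: measurableT_comp (measurable_powR p) mau.
  under eq_integral do rewrite gee0_abs ?lee_fin ?powR_ge0//.
  have := poweR_lty p ufin; rewrite powR_Lnorm ?gt_eqF//.
have e3 : 0 < e / 3 by rewrite divr_gt0.
have mutr M : measurable_fun [set: R] (u \- tr M) by exact: measurable_funB.
have mautr M : measurable_fun [set: R] (fun t => `|(u \- tr M) t|).
  exact: measurableT_comp.
have mptr M : measurable_fun [set: R] (fun t => `|(u \- tr M) t| `^ p).
  exact: measurableT_comp (measurable_powR p) (mautr M).
have [M uM] : exists M, (\int[mu]_t (`|u t - tr M t| `^ p)%:E <= ((e / 3) `^ p)%:E)%E.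
  have H0 : (\int[mu]_t (`|u t - tr n t| `^ p)%:E @[n --> \oo] -->
      \int[mu]_t cst 0 t)%E.
   apply: (@dominated_cvg _ _ _ mu setT measurableT _ (cst 0%E) _ _ _ _ iu) => //.
  - by move=> n; apply/measurable_EFinP; exact: mptr.
  - move=> t _; apply: cvg_near_cst; near=> n.
    rewrite /tr ifT ?subrr ?normr0 ?powR0 ?gt_eqF//.
    by near: n; exact: nbhs_infty_ger.
  - move=> n t _; rewrite gee0_abs ?lee_fin ?powR_ge0// ge0_ler_powR ?nnegrE ?(ltW p0)//.
    by rewrite /tr; case: ifP; rewrite ?subrr ?normr0 ?subr0.
  move: H0; rewrite integral0 => /fine_cvgP[fin /cvgrPdist_lt/(_ ((e / 3) `^ p))].
  rewrite powR_gt0// => /(_ isT) H.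
  have [n _ /(_ n (leqnn n))[]] := filterI fin H.
  move=> fn; rewrite sub0r normrN => Hn; exists n.
  by rewrite -[leLHS]fineK// lee_fin ltW// (le_lt_trans (ler_norm _)).
pose v := tr M; pose K := (2 * M%:R + 1 : R).
have K0 : 0 < K by rewrite /K ltr_wpDl// mulr_ge0.
have vM t : `|v t| <= M%:R by rewrite /v /tr; case: ifP => //; rewrite normr0.
have e'0 : 0 < (e / 3) `^ p / K `^ (p - 1).
  by rewrite divr_gt0// powR_gt0.
have [|d d0 dv] := @integral_translation_continuous v A M%:R _ A0 e'0 (mtr M) vM.
  by move=> t /uA ut; rewrite /v /tr ut normr0 ler0n.
exists d => // h /dv vh.
have mvh : measurable_fun [set: R] (fun t : R => v (t + h)).
  exact: measurableT_comp (mtr M) (measurable_shift h).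
have mvv : measurable_fun [set: R] (fun t : R => v (t + h) - v t).
  exact: (measurable_funB mvh (mtr M)).
have mavv : measurable_fun [set: R] (fun t : R => `|v (t + h) - v t|).
  exact: (measurableT_comp _ mvv).
have mw : measurable_fun [set: R] (u \- v) by exact: mutr.
have Nw : ('N[mu]_p%:E[EFin \o (u \- v)%R] <= (e / 3)%:E)%E.
  exact: (Lnorm_le_EFin p0 (ltW e3) uM).
have Nv : ('N[mu]_p%:E[EFin \o (fun t => (v (t + h) - v t)%R)] <= (e / 3)%:E)%E.
  apply: Lnorm_le_EFin => //; first exact: ltW.
  have H1 : (\int[mu]_t (`|v (t + h)%R - v t| `^ p)%:E <=
      \int[mu]_t ((K `^ (p - 1))%:E * `|v (t + h)%R - v t|%:E))%E.
    apply: ae_ge0_le_integral_nonmeasurable.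
    - by move=> t; rewrite lee_fin powR_ge0.
    - by move=> t; rewrite -EFinM lee_fin mulr_ge0 ?powR_ge0.
    apply: nearW => t; rewrite -EFinM lee_fin.
    have [->|dn] := eqVneq (`|v (t + h) - v t|) 0.
      by rewrite powR0 ?gt_eqF// mulr0.
    have -> : `|v (t + h) - v t| `^ p =
        `|v (t + h) - v t| `^ (p - 1) * `|v (t + h) - v t|.
      rewrite -[in RHS](@powRr1 _ `|v (t + h) - v t|)// powRr1//.
      rewrite -[X in _ * X]powRr1// -powRD ?subrK//.
      by rewrite dn implybT.
    rewrite ler_wpM2r//.
    rewrite ge0_ler_powR ?nnegrE ?subr_ge0 ?(ltW K0)//.
    rewrite (le_trans (ler_normB _ _))// /K.
    have := vM t; have := vM (t + h); lra.
  apply: (le_trans H1).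
  rewrite ge0_integralZl//; last 2 first.
  - by apply/measurable_EFinP; exact: mavv.
  - by rewrite lee_fin powR_ge0.
  have := lee_wpmul2l (x := (K `^ (p - 1))%:E) _ vh.
  rewrite lee_fin powR_ge0 => /(_ isT) /le_trans; apply.
  by rewrite -EFinM lee_fin mulrC divfK// gt_eqF// powR_gt0.
have -> : (fun t => u (t + h) - u t) =
    ((fun t => (u \- v) (t + h)) \+ ((fun t => v (t + h) - v t) \+ (-%R \o (u \- v)))).
  by apply/funext => t /=; ring.
have mwh : measurable_fun [set: R] (fun t : R => (u \- v) (t + h)).
  exact: measurableT_comp mw (measurable_shift h).
have mNw : measurable_fun setT (-%R \o (u \- v)).
  exact: measurableT_comp.
have -> : (e%:E = (e / 3)%:E + ((e / 3)%:E + (e / 3)%:E))%E.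
  by rewrite -!EFinD; congr (_%:E); field.
have mvw := measurable_funD mvv mNw.
apply: (le_trans (@minkowski_EFin _ _ _ mu _ _ _ mwh mvw p1)).
apply: leeD; first by rewrite Lnorm_shift.
apply: (le_trans (@minkowski_EFin _ _ _ mu _ _ _ mvv mNw p1)).
apply: leeD; first exact: Nv.
by rewrite -(@oppe_Lnorm _ _ _ mu (EFin \o (u \- v))) in Nw.
Unshelve. all: by end_near. Qed.

End TranslationContinuity.

(** * Lebesgue norms of vector-valued functions *)

Section LebesgueAlmostEverywhere.
Context {R : realType}.
Local Notation mu := (@lebesgue_measure R).
Implicit Types P Q S : R -> Prop.

Lemma ae_lebesgueW P : (forall s, P s) -> {ae mu, forall s, P s}.
Proof. by move=> Ps; exists set0; split=> // s /=; apply. Qed.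

Lemma ae_lebesgueS P Q : (forall s, P s -> Q s) ->
  {ae mu, forall s, P s} -> {ae mu, forall s, Q s}.
Proof.
move=> PQ [N [mN N0 PN]]; exists N; split=> // s /= nQ; apply: PN => /= Ps.
exact/nQ/PQ.
Qed.

Lemma ae_lebesgueI P Q : {ae mu, forall s, P s} -> {ae mu, forall s, Q s} ->
  {ae mu, forall s, P s /\ Q s}.
Proof.
move=> [N [mN N0 PN]] [N' [mN' N'0 QN']]; exists (N `|` N'); split.
- exact: measurableU.
- by apply: null_set_setU.
- move=> s /= /not_andP[nP|nQ]; [left; exact: PN|right; exact: QN'].
Qed.

Lemma ae_lebesgue_forall n (P : 'I_n -> R -> Prop) :
  (forall i, {ae mu, forall s, P i s}) -> {ae mu, forall s i, P i s}.
Proof.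
move=> aeP.
have H (l : seq 'I_n) : {ae mu, forall s, forall i, i \in l -> P i s}.
  elim: l => [|i l IH]; first by apply: ae_lebesgueW.
  apply: ae_lebesgueS (ae_lebesgueI (aeP i) IH) => s [Pi Pl] j.
  by rewrite inE => /predU1P[->//|]; exact: Pl.
by apply: ae_lebesgueS (H (enum 'I_n)) => s Ps i; apply: Ps; rewrite mem_enum.
Qed.

End LebesgueAlmostEverywhere.

Section VectorLp.
Context {R : realType} {n : nat}.
Local Notation mu := (@lebesgue_measure R).
Implicit Types (w v : R -> 'rV[R]_n) (u : R -> R).

Definition vLnorm (p : R) w : \bar R := 'N[mu]_p%:E[EFin \o (enorm \o w)].

Definition vLfun (p : R) w :=
  forall i, (fun s => w s ord0 i) \in Lfun mu p%:E.

Lemma LfunE (p : R) u : u \in Lfun mu p%:E <->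
  measurable_fun [set: R] u /\ ('N[mu]_p%:E[EFin \o u] < +oo)%E.
Proof.
split=> [/andP[]|[mu_ nu]]; first by rewrite !inE.
by apply/andP; split; rewrite inE.
Qed.

Variable p : R.
Hypothesis p1 : 1 <= p.
Let p0 : 0 < p := lt_le_trans ltr01 p1.

Lemma measurable_enorm w : (forall i, measurable_fun [set: R] (fun s => w s ord0 i)) ->
  measurable_fun [set: R] (enorm \o w).
Proof.
move=> mw.
have msq : measurable_fun [set: R] (@Num.sqrt R).
  by apply: continuous_measurable_fun; exact: sqrt_continuous.
have msum : measurable_fun [set: R] (fun s => \sum_(i < n) w s ord0 i ^+ 2).
  by apply: measurable_sum => i; exact: measurable_funX (mw i).
exact: (measurableT_comp msq msum).
Qed.

Lemma vLfun_measurable w : vLfun p w -> measurable_fun [set: R] (enorm \o w).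
Proof. by move=> fw; apply: measurable_enorm => i; have /LfunE[] := fw i. Qed.

Lemma ae_le_vLnorm w u : {ae mu, forall s, enorm (w s) <= `|u s|} ->
  (vLnorm p w <= 'N[mu]_p%:E[EFin \o u])%E.
Proof.
move=> wu; apply: ae_le_Lnorm => //; apply: ae_lebesgueS wu => s /=.
by rewrite [`|enorm _|]ger0_norm ?enorm_ge0.
Qed.

(** Reduces vector-valued estimates to scalar ones, coordinate by coordinate. *)
Lemma vLnorm_le_sum w :
  (forall i, measurable_fun [set: R] (fun s => w s ord0 i)) ->
  (vLnorm p w <= \sum_(i < n) 'N[mu]_p%:E[EFin \o (fun s => w s ord0 i)])%E.
Proof.
move=> mw.
have mw' i : measurable_fun [set: R] (fun s => `|w s ord0 i|) by exact: measurableT_comp.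
have sums (l : seq 'I_n) : measurable_fun [set: R] (fun s => \sum_(i <- l) `|w s ord0 i|)
    /\ ('N[mu]_p%:E[EFin \o (fun s => \sum_(i <- l) `|w s ord0 i|)%R]
        <= \sum_(i <- l) 'N[mu]_p%:E[EFin \o (fun s => w s ord0 i)])%E.
  elim: l => [|i l [IHm IHf]].
    rewrite (_ : (fun s => _) = cst 0); last by apply/funext => s; rewrite big_nil.
    split; first exact: measurable_cst.
    by rewrite big_nil (_ : EFin \o _ = cst 0%E)// Lnorm0// eqe gt_eqF.
  rewrite (_ : (fun s => _) = (fun s => `|w s ord0 i|) \+
      (fun s => \sum_(i <- l) `|w s ord0 i|)); last first.
    by apply/funext => s; rewrite big_cons.
  split; first exact: measurable_funD.
  apply: le_trans (@minkowski_EFin _ _ _ mu _ _ _ (mw' i) IHm p1) _.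
  rewrite big_cons leeD//.
  by apply: ae_le_Lnorm => //; apply: ae_lebesgueW => s; rewrite normr_id.
have [_] := sums (index_enum 'I_n); apply: le_trans.
apply: ae_le_vLnorm; apply: ae_lebesgueW => s.
by rewrite ger0_norm ?sumr_ge0//; exact: enorm_le_sum.
Qed.

Lemma vLfun_lty w : vLfun p w -> (vLnorm p w < +oo)%E.
Proof.
move=> fw; apply: le_lt_trans (vLnorm_le_sum _) _.
  by move=> i; have /LfunE[] := fw i.
by rewrite lte_sum_pinfty// => i _; have /LfunE[] := fw i.
Qed.

Lemma vLfunP w : vLfun p w <->
  (forall i, measurable_fun [set: R] (fun s => w s ord0 i)) /\ (vLnorm p w < +oo)%E.
Proof.
split=> [fw|[mw wfin] i].
  by split; [move=> i; have /LfunE[] := fw i|exact: vLfun_lty].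
apply/LfunE; split=> //; apply: le_lt_trans wfin.
apply: ae_le_Lnorm => //; apply: ae_lebesgueW => s /=.
by rewrite [`|enorm _|]ger0_norm ?enorm_ge0//; exact: coord_le_enorm.
Qed.

Lemma vLnorm_fin w : vLfun p w -> (vLnorm p w)%E = (fine (vLnorm p w))%:E.
Proof. by move=> /vLfun_lty wfin; rewrite fineK// ge0_fin_numE// Lnorm_ge0. Qed.

Lemma vLnormN w : vLnorm p (fun s => - w s) = vLnorm p w.
Proof. by apply: eq_Lnorm => s /=; rewrite enormN. Qed.

Lemma vLnormB w v :
  vLnorm p (fun s => w s - v s) = vLnorm p (fun s => v s - w s).
Proof. by apply: eq_Lnorm => s; rewrite /= enormB. Qed.

Lemma vLfunN w : vLfun p w -> vLfun p (fun s => - w s).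
Proof.
move=> /vLfunP[mw wfin]; apply/vLfunP; split; last by rewrite vLnormN.
move=> i; rewrite (_ : (fun s => _) = -%R \o (fun s => w s ord0 i)).
  exact: measurableT_comp.
by apply/funext => s; rewrite /= mxE.
Qed.

Lemma vLnormD w v : vLfun p w -> vLfun p v ->
  (vLnorm p (fun s => w s + v s)%R <= vLnorm p w + vLnorm p v)%E.
Proof.
move=> fw fv; have mw := vLfun_measurable fw; have mv := vLfun_measurable fv.
apply: le_trans (@minkowski_EFin _ _ _ mu _ _ _ mw mv p1).
apply: ae_le_vLnorm; apply: ae_lebesgueW => s /=.
by rewrite ger0_norm ?addr_ge0 ?enorm_ge0 ?enormD.
Qed.

Lemma vLfunD w v : vLfun p w -> vLfun p v -> vLfun p (fun s => w s + v s).
Proof.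
move=> fw fv; apply/vLfunP; split=> [i|]; last first.
  apply: le_lt_trans (vLnormD fw fv) _.
  by rewrite lte_add_pinfty// vLfun_lty.
rewrite (_ : (fun s => _) = (fun s => w s ord0 i) \+ (fun s => v s ord0 i)).
  by have /LfunE[mw _] := fw i; have /LfunE[mv _] := fv i; exact: measurable_funD.
by apply/funext => s; rewrite /= mxE.
Qed.

Lemma vLfunB w v : vLfun p w -> vLfun p v -> vLfun p (fun s => w s - v s).
Proof. by move=> fw fv; apply: vLfunD => //; exact: vLfunN. Qed.

Lemma Lnorm_indic_itv (c a b : R) : 0 <= c -> a <= b ->
  ('N[mu]_p%:E[EFin \o (fun s => c * \1_(`]a, b[%classic) s)%R] =
   (c * (b - a) `^ p^-1)%:E)%E.
Proof.
move=> c0 ab; rewrite unlock /=.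
have -> : (\int[mu]_x (`|c * \1_(`]a, b[%classic) x| `^ p)%:E)%E =
    (\int[mu]_(x in `]a, b[) cst ((c `^ p)%:E) x)%E.
  rewrite [RHS]integral_mkcond; apply: eq_integral => s _.
  rewrite patchE indicE; case: ifP => _; rewrite ?mulr1 ?mulr0.
    by rewrite ger0_norm.
  by rewrite normr0 powR0// gt_eqF.
have muab : mu `]a, b[%classic = (b - a)%:E.
  rewrite lebesgue_measure_itv/= lte_fin.
  by move: ab; rewrite le_eqVlt => /predU1P[->|->]; rewrite ?ltxx ?subrr.
rewrite integral_cst// [X in (_ * X)%E]muab.
rewrite -EFinM poweR_EFin powRM ?powR_ge0 ?subr_ge0//.
by rewrite -powRrM mulfV ?gt_eqF// powRr1.
Qed.

End VectorLp.

(** * Sobolev paths and their Hoelder continuity *)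

Section SobolevPaths.
Context {R : realType} {n : nat}.
Local Notation mu := (@lebesgue_measure R).
Implicit Types (x y : R -> 'rV[R]_n) (r p : R).

(** Extending the derivative by zero to the whole line makes its translates
    available, and [derive_norm] becomes a norm of functions on the line. *)
Definition wder r x : R -> 'rV[R]_n :=
  fun s => if s \in `]- r, 0[ then derive1 x s else 0.

Lemma wder_in r x s : s \in `]- r, 0[ -> wder r x s = derive1 x s.
Proof. by rewrite /wder => ->. Qed.

Lemma wder_out r x s : s \notin `]- r, 0[ -> wder r x s = 0.
Proof. by rewrite /wder => /negPf ->. Qed.

Lemma wderE r x i :
  (fun s => derive1 x s ord0 i) \_ `]- r, 0[ = (fun s => wder r x s ord0 i).
Proof.
apply/funext => s; rewrite patchE /wder mem_setE; case: ifP => //.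
by rewrite mxE.
Qed.

Lemma W1pE r p x : W1p r p x <-> absolutely_continuous r x /\ vLfun p (wder r x).
Proof.
by split=> -[acx wx]; split=> // i; have := wx i; rewrite wderE.
Qed.

Lemma derive_normE r p x : derive_norm r p x = fine (vLnorm p (wder r x)).
Proof.
congr (fine (Lnorm _ _ (EFin \o _))); apply/funext => s.
by rewrite patchE /wder mem_setE /=; case: ifP => //; rewrite enorm0.
Qed.

Lemma derive_norm_ge0 r p x : 0 <= derive_norm r p x.
Proof. by rewrite derive_normE fine_ge0// Lnorm_ge0. Qed.

Opaque derive_norm wder.

Lemma W1p_norm_ge0 r p x : 0 <= W1p_norm r p x.
Proof. by rewrite addr_ge0 ?sup_norm_ge0 ?derive_norm_ge0. Qed.

Lemma sup_le_W1p_norm r p x : sup_norm r x <= W1p_norm r p x.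
Proof. by rewrite lerDl derive_norm_ge0. Qed.

Lemma derive_le_W1p_norm r p x : derive_norm r p x <= W1p_norm r p x.
Proof. by rewrite lerDr sup_norm_ge0. Qed.

Lemma near_eq_derive1 x y (s : R) : (\forall u \near s, x u = y u) ->
  derive1 x s = derive1 y s.
Proof.
move=> xy; have xys := nbhs_singleton xy.
rewrite /derive1; congr (lim _).
have H : \forall h \near (0 : R)^', x (h + s) = y (h + s).
  move: xy => /nbhs_ballP[d /= d0 dxy]; apply/nbhs_ballP; exists d => //= h h0 _.
  apply: dxy; rewrite /ball/= in h0 *.
  by have -> : s - (h + s) = 0 - h by ring.
have E : {near (0 : R)^', (fun h => h^-1 *: (x (h + s) - x s)) =1
                         (fun h => h^-1 *: (y (h + s) - y s))}.
  by apply: filterS H => h ->; rewrite xys.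
by apply/seteqP; split; apply: near_eq_cvg => //; apply: filterS E.
Qed.

Lemma near_oo (a b s : R) : s \in `]a, b[ -> \forall u \near s, u \in `]a, b[.
Proof. exact: near_in_itvoo. Qed.

Lemma eq_wder r x y : {in `[- r, 0], x =1 y} -> wder r x = wder r y.
Proof.
move=> xy; apply/funext => s; have [sr|sr] := boolP (s \in `]- r, 0[);
  last by rewrite !wder_out.
rewrite !wder_in//; apply: near_eq_derive1; apply: filterS (near_oo sr) => u ur; apply: xy.
by apply: subset_itv_oo_cc ur.
Qed.

Lemma eq_W1p_norm r p x y : {in `[- r, 0], x =1 y} ->
  W1p_norm r p x = W1p_norm r p y.
Proof.
by move=> xy; rewrite /W1p_norm !derive_normE (eq_wder xy) (eq_sup_norm xy).
Qed.

Lemma ac_coord r x i : absolutely_continuous r x ->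
  ac_on (- r) 0 (fun s => x s ord0 i).
Proof.
move=> acx e /acx[d d0 dx]; exists d => // s sr sno sd.
pose I (k : 'I_(size s)) := nth (0, 0) s k.
have H := dx (size s) I.
have big (F : R * R -> R) : \sum_(J <- s) F J = \sum_(k < size s) F (I k).
  by rewrite (big_nth (0, 0)) big_mkord.
rewrite big; apply: le_lt_trans (H _ _ _).
- apply: ler_sum => k _; have := coord_le_enorm (x (I k).2 - x (I k).1) i.
  by rewrite !mxE.
- move=> k; have /(allP sr)/and3P[] // : I k \in s by rewrite mem_nth.
- move=> k l kl; have /pairwiseP pw := sno.
  have [lt_kl|lt_lk|/ord_inj/eqP] := ltngtP k l; last by rewrite (negPf kl).
    by have := pw (0, 0) k l (ltn_ord k) (ltn_ord l) lt_kl; move=> /orP.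
  by have := pw (0, 0) l k (ltn_ord l) (ltn_ord k) lt_lk; move=> /orP[|]; [right|left].
- by rewrite -(big (fun J => J.2 - J.1)).
Qed.

Section Positive.
Variables r p : R.
Hypotheses (r0 : 0 < r) (p1 : 1 < p).
Let le1p : 1 <= p := ltW p1.
Let p0 : 0 < p := lt_trans ltr01 p1.
Let ltNr0 : - r < 0. Proof. by rewrite oppr_lt0. Qed.

Lemma ac_C0 x : absolutely_continuous r x -> C0 r x.
Proof.
move=> acx; apply/within_continuousP => s sr e e0.
have [d d0 dx] := acx e e0; exists d => // u ur us.
pose I (k : 'I_1) := (Num.min s u, Num.max s u).
have := dx 1%N I; rewrite !big_ord1 /=.
have -> : enorm (x (Num.max s u) - x (Num.min s u)) = enorm (x u - x s).
  by case: (leP s u) => // _; rewrite enormB.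
apply.
- move: sr ur; rewrite /= !in_itv/= => /andP[? ?] /andP[? ?] k.
  by split; case: (leP s u) => // /ltW.
- by move=> k l; rewrite (ord1 k) (ord1 l) eqxx.
- by case: (leP s u) us => su; rewrite ltr_norml => /andP[? ?]; lra.
Qed.

Lemma W1p_C0 x : W1p r p x -> C0 r x.
Proof. by case=> acx _; exact: ac_C0. Qed.

(** Each coordinate is differentiable almost everywhere, by the fundamental
    theorem of calculus. *)
Lemma ac_ae_derivable x : absolutely_continuous r x ->
  {ae mu, forall s, s \in `]- r, 0[ -> is_derive s 1 x (derive1 x s)}.
Proof.
move=> acx.
have H i : {ae mu, forall s, s \in `]- r, 0[ ->
    derivable (fun u => x u ord0 i : R) s 1}.
  have [g [_ _ gd]] := ac_on_ftc ltNr0 (ac_coord i acx).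
  apply: ae_lebesgueS gd => s gs sr.
  by have [] := gs ltac:(by move: sr; rewrite in_itv).
apply: ae_lebesgueS (ae_lebesgue_forall H) => s xs sr.
pose d : 'rV[R]_n := \row_i derive1 (fun u => x u ord0 i : R) s.
have xd : is_derive s 1 x d.
  apply/is_derive_rowP => i; rewrite mxE; apply: derivable_derive1; exact: xs.
by rewrite (derive1_is_derive xd).
Qed.

(** The pointwise derivative is additive only where both paths are
    differentiable, which is almost everywhere. *)
Lemma wderB_ae x y : absolutely_continuous r x -> absolutely_continuous r y ->
  {ae mu, forall s, wder r (x - y) s = wder r x s - wder r y s}.
Proof.
move=> acx acy.
apply: ae_lebesgueS (ae_lebesgueI (ac_ae_derivable acx) (ac_ae_derivable acy)).
move=> s [xs ys]; have [sr|sr] := boolP (s \in `]- r, 0[);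
  last by rewrite !wder_out// subrr.
rewrite !wder_in//.
have dx := xs sr; have dy := ys sr.
apply: derive1_is_derive; exact: is_deriveB.
Qed.

Lemma W1p_vLnorm x : W1p r p x -> vLnorm p (wder r x) = (derive_norm r p x)%:E.
Proof. by case/W1pE => _ wx; rewrite derive_normE; exact: vLnorm_fin. Qed.

Lemma W1p_vLnormB x y : W1p r p x -> W1p r p y ->
  vLnorm p (fun s => wder r x s - wder r y s) = (derive_norm r p (x - y))%:E.
Proof.
move=> /W1pE[acx wx] /W1pE[acy wy].
have wxy := vLfunB le1p wx wy; have H := wderB_ae acx acy.
have E : vLnorm p (wder r (x - y)) = vLnorm p (fun s => wder r x s - wder r y s).
  apply/eqP; rewrite eq_le; apply/andP; split; apply: ae_le_vLnorm => //;
    by apply: ae_lebesgueS H => s /= ->; rewrite ger0_norm ?enorm_ge0.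
by rewrite derive_normE E; exact: vLnorm_fin.
Qed.

Lemma W1p_norm_dist x y : W1p r p x -> W1p r p y ->
  `|W1p_norm r p x - W1p_norm r p y| <= W1p_norm r p (x - y).
Proof.
have half (u v : R -> 'rV[R]_n) : W1p r p u -> W1p r p v ->
    W1p_norm r p u <= W1p_norm r p (u - v) + W1p_norm r p v.
  move=> Wu Wv; have [cu cv] := (W1p_C0 Wu, W1p_C0 Wv).
  rewrite /W1p_norm addrACA lerD//.
    by rewrite -{1}[u](subrK v) sup_normD//; exact: C0B.
  rewrite -lee_fin EFinD.
  have /W1pE[_ wu] := Wu; have /W1pE[_ wv] := Wv.
  apply: (@le_trans _ _ (vLnorm p (fun s => (wder r u s - wder r v s) + wder r v s))).
    rewrite -(W1p_vLnorm Wu).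
    apply: ae_le_vLnorm => //; apply: ae_lebesgueW => s /=.
    by rewrite subrK ger0_norm ?enorm_ge0.
  apply: (le_trans (vLnormD le1p (vLfunB le1p wu wv) wv)).
  by rewrite (W1p_vLnormB Wu Wv) (W1p_vLnorm Wv).
have sym (u v : R -> 'rV[R]_n) : W1p r p u -> W1p r p v ->
    W1p_norm r p (u - v) = W1p_norm r p (v - u).
  move=> Wu Wv; suff e : derive_norm r p (u - v) = derive_norm r p (v - u).
    exact: (f_equal2 +%R (sup_normB r u v) e).
  apply: EFin_inj.
  transitivity (vLnorm p (fun s => wder r u s - wder r v s)).
    exact/esym/(W1p_vLnormB Wu Wv).
  transitivity (vLnorm p (fun s => wder r v s - wder r u s)).
    exact: vLnormB.
  exact: (W1p_vLnormB Wv Wu).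
move=> Wx Wy; have hxy := half _ _ Wx Wy; have hyx := half _ _ Wy Wx.
rewrite (sym _ _ Wy Wx) in hyx.
exact: ler_dist_of_le.
Qed.

(** The increments of a coordinate are integrals of its derivative, to which
    Hoelder's inequality applies. *)
Lemma W1p_hoelder x (s t : R) : W1p r p x -> s \in `[- r, 0] -> t \in `[- r, 0] ->
  enorm (x t - x s) <= n%:R * derive_norm r p x * `|t - s| `^ (1 - p^-1).
Proof.
move=> Wx; have /W1pE[acx wx] := Wx.
wlog st : s t / s <= t.
  move=> H sr tr; have [/H|/ltW ts] := leP s t; first exact.
  by rewrite enormB distrC; exact: H.
rewrite !in_itv/= => /andP[rs s0] /andP[rt t0].
have q0 : 0 < 1 - p^-1 by rewrite subr_gt0 invf_lt1.
have coord i : `|(x t - x s) ord0 i| <=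
    derive_norm r p x * `|t - s| `^ (1 - p^-1).
  have [g [ig gE gd]] := ac_on_ftc ltNr0 (ac_coord i acx).
  rewrite !mxE (gE _ _ rs st t0); pose J := `]s, t]%classic : set R.
  have mJ0 : measurable J by exact: measurable_itv.
  have igJ : mu.-integrable J (EFin \o g) by apply: integrableS ig.
  have mwi : measurable_fun [set: R] (fun u => wder r x u ord0 i).
    by have /LfunE[] := wx i.
  have mJ : measurable_fun [set: R] (\1_J : R -> R) by exact: measurable_indic.
  have H1 : (`|(\int[mu]_(u in J) g u)%R|%:E <=
      'N[mu]_1[EFin \o ((fun u => wder r x u ord0 i) \* \1_J)%R])%E.
    have -> : (`|(\int[mu]_(u in J) g u)%R|%:E = `|\int[mu]_(u in J) (g u)%:E|)%E.
      by rewrite /Rintegral -fine_abse ?fineK ?abse_fin_num ?integrable_fin_num.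
    apply: (le_trans (le_abse_integral _ _ _)) => //.
      by have /integrableP[] := igJ.
    rewrite Lnorm1 integral_mkcond; apply: ae_ge0_le_integral_nonmeasurable.
    - by move=> u; rewrite erestrict_ge0.
    - by move=> u; rewrite abse_ge0.
    have H0 : {ae mu, forall u : R, u != 0} by
      exists [set 0]; split => [//||u /= /negP]; rewrite ?lebesgue_measure_set1// => /negPn/eqP.
    apply: ae_lebesgueS (ae_lebesgueI H0 (ae_lebesgueI gd (ac_ae_derivable acx))).
    move=> u [u0 [gu xu]]; rewrite patchE; case: ifPn => [|_]; last exact: abse_ge0.
    rewrite inE /J /= in_itv/= => /andP[su ut].
    have ur : u \in `]- r, 0[.
      by rewrite in_itv/= (le_lt_trans rs)//= lt_neqAle u0 (le_trans ut).
    have [dg gE'] := gu ltac:(by move: ur; rewrite in_itv).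
    have /is_derive_rowP/(_ i) dxu := xu ur.
    rewrite (wder_in _ ur) indicE mem_set /= ?mulr1; last by rewrite /J/= in_itv/= su.
    by rewrite -(derive1_is_derive dxu) derive1E gE'.
  rewrite -lee_fin; apply: (le_trans H1).
  have pq : p^-1 + ((1 - p^-1)^-1)^-1 = 1 by rewrite invrK addrC subrK.
  have q0' : 0 < (1 - p^-1)^-1 by rewrite invr_gt0.
  apply: (le_trans (@hoelder _ _ _ mu _ _ _ _ mwi mJ p0 q0' pq)).
  rewrite EFinM; apply: lee_pmul; rewrite ?Lnorm_ge0//.
    rewrite -(W1p_vLnorm Wx); apply: ae_le_Lnorm => //.
    apply: ae_lebesgueW => u /=; rewrite [leRHS]ger0_norm ?enorm_ge0//.
    exact: coord_le_enorm.
  have abs0 : 0 <= `|t - s| `^ (1 - p^-1) by exact: powR_ge0.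
  apply: (Lnorm_le_EFin q0' abs0).
  rewrite -powRrM mulfV ?gt_eqF// powRr1//.
  have -> : (\int[mu]_u (`|\1_J u| `^ (1 - p^-1)^-1)%:E = \int[mu]_u (\1_J u)%:E)%E.
    apply: eq_integral => u _; rewrite indicE; case: (_ \in _).
      by rewrite normr1 powR1.
    by rewrite normr0 powR0// gt_eqF.
  have muJ : mu J = (t - s)%:E.
    rewrite lebesgue_measure_itv/= lte_fin.
    by move: st; rewrite le_eqVlt => /predU1P[->|->]; rewrite ?ltxx ?subrr.
  by rewrite integral_indic// setIT [leLHS]muJ lee_fin ler_norm.
rewrite (le_trans (enorm_le_sum _))//.
rewrite (le_trans (ler_sum _ (fun i _ => coord i)))//.
by rewrite sumr_const card_ord -[leLHS]mulr_natl mulrA.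
Qed.

Lemma W1p_holder_space x : W1p r p x -> holder_space r (1 - p^-1) x.
Proof.
move=> Wx; split; first exact: W1p_C0.
exists (n%:R * derive_norm r p x) => _ [t [s [tr sr ts ->]]].
rewrite ler_pdivrMr ?powR_gt0 ?normr_gt0 ?subr_eq0//.
exact: W1p_hoelder.
Qed.

End Positive.
End SobolevPaths.

(** * Solutions of the delay equation *)

Section Solutions.
Context {R : realType} {n : nat}.
Variables (r : R) (f : (R -> 'rV[R]_n) -> 'rV[R]_n).
Hypotheses (r0 : 0 < r) (f0 : f (cst 0) = 0).
Hypothesis f_lip : lipschitz_on_bounded_C0 r f.
Implicit Types (x y z : R -> 'rV[R]_n) (s t u T K : R).

(** A positive constant can be used as a divisor later on. *)
Lemma lip_const K : 0 <= K -> exists2 M : R, 0 < M &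
  forall x y, C0 r x -> C0 r y -> sup_norm r x <= K -> sup_norm r y <= K ->
    enorm (f x - f y) <= M * sup_norm r (x - y).
Proof.
move=> K0; have [L [L0 _ Lf]] := f_lip; exists (L K + 1).
  by rewrite ltr_wpDl// L0.
move=> x y cx cy xK yK; rewrite (le_trans (Lf _ K0 _ _ cx cy xK yK))//.
by rewrite ler_wpM2r ?sup_norm_ge0// lerDl.
Qed.

Lemma eq_is_solution x0 y0 z : {in `[- r, 0], x0 =1 y0} ->
  is_solution r f x0 z -> is_solution r f y0 z.
Proof.
move=> xy [zx cz dz]; split=> // s sr; by rewrite zx// xy.
Qed.

Lemma eq_solution_set x0 y0 : {in `[- r, 0], x0 =1 y0} ->
  [set z | is_solution r f x0 z] = [set z | is_solution r f y0 z].
Proof.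
move=> xy; apply/seteqP; split => z /=; apply: eq_is_solution => //.
by move=> s sr; rewrite xy.
Qed.

Section OneSolution.
Variables (x0 z : R -> 'rV[R]_n).
Hypothesis sz : is_solution r f x0 z.

Lemma sol_within T : {within `[- r, T], continuous z}.
Proof.
case: sz => _ + _; apply: continuous_subspaceW => s /=.
by rewrite !in_itv/= andbT => /andP[].
Qed.

Lemma C0_sol t : 0 <= t -> C0 r (segment_at z t).
Proof.
move=> t0; have tt : 0 <= t <= t by rewrite t0 lexx.
exact: (C0_segment tt (@sol_within t)).
Qed.

Lemma sol_derive t : 0 < t -> is_derive t 1 z (f (segment_at z t)).
Proof. by case: sz => _ _; exact. Qed.

Lemma sol_init s : s \in `[- r, 0] -> z s = x0 s.
Proof. by case: sz => + _ _; exact. Qed.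

Lemma sol_C0_init : C0 r x0.
Proof.
apply: (@eq_C0 _ _ r z); first by move=> s /sol_init.
by apply: continuous_subspaceW (@sol_within 0).
Qed.

Lemma is_solution_shift t : 0 <= t ->
  is_solution r f (segment_at z t) (fun s => z (t + s)).
Proof.
move=> t0; split=> //.
  case: sz => _ cz _.
  apply: (continuous_subspaceW _ (within_continuous_shift (t := t) cz)).
  move=> s /=; rewrite !in_itv/= !andbT => rs.
  by rewrite (le_trans rs)// lerDr.
move=> u u0; have /is_derive1P zu := sol_derive (ltr_wpDl t0 u0).
apply/is_derive1P.
rewrite (_ : segment_at _ u = segment_at z (t + u)); last first.
  by apply/funext => s; rewrite /segment_at addrA.
apply: cvg_trans zu; apply: near_eq_cvg; apply: nearW => h.
by rewrite addrCA.
Qed.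

Lemma sup_norm_segment t M : 0 <= M -> (forall s, - r <= s -> s <= t -> enorm (z s) <= M) ->
  0 <= t -> sup_norm r (segment_at z t) <= M.
Proof.
move=> M0 zM t0; apply: sup_norm_le => // s; rewrite in_itv/= => /andP[rs s0].
apply: zM; first by rewrite (le_trans rs)// lerDr.
by rewrite gerDl.
Qed.

Lemma enorm_le_segment t : 0 <= t -> enorm (z t) <= sup_norm r (segment_at z t).
Proof.
move=> t0; have := le_sup_norm (s := 0) (C0_sol t0); rewrite /segment_at addr0.
by apply; rewrite in_itv/= lexx oppr_le0 ltW.
Qed.

End OneSolution.

Arguments sol_within {x0 z} sz T.

Lemma sol_increment x0 z s t (B : R) : is_solution r f x0 z ->
  0 <= s -> s <= t ->
  (forall u, s < u -> u < t -> enorm (f (segment_at z u)) <= B) ->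
  enorm (z t - z s) <= B * (t - s).
Proof.
move=> sz s0 st fB.
apply: (mean_value_inequality (dx := fun u => f (segment_at z u))) => //.
- apply: (continuous_subspaceW _ (sol_within sz t)) => u /=.
  rewrite !in_itv/= => /andP[su ->]; rewrite andbT.
  by rewrite (le_trans _ su)// (le_trans _ s0)// oppr_le0 ltW.
- move=> u; rewrite in_itv/= => /andP[su ut]; apply: (sol_derive sz).
  exact: le_lt_trans su.
- by move=> u; rewrite in_itv/= => /andP[su ut]; exact: fB.
Qed.

Lemma sol_diff_increment x0 y0 y z s t (B : R) :
  is_solution r f x0 z -> is_solution r f y0 y -> 0 <= s -> s <= t ->
  (forall u, s < u -> u < t ->
     enorm (f (segment_at z u) - f (segment_at y u)) <= B) ->
  enorm ((z t - y t) - (z s - y s)) <= B * (t - s).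
Proof.
move=> sz sy s0 st fB.
apply: (mean_value_inequality (x := fun u => z u - y u)
  (dx := fun u => f (segment_at z u) - f (segment_at y u))) => //.
- have sub : `[s, t] `<=` `[- r, t].
    move=> u /=; rewrite !in_itv/= => /andP[su ->]; rewrite andbT.
    by rewrite (le_trans _ su)// (le_trans _ s0)// oppr_le0 ltW.
  have cz := continuous_subspaceW sub (sol_within sz t).
  have cy := continuous_subspaceW sub (sol_within sy t).
  by move=> u; exact: cvgB (cz u) (cy u).
- move=> u; rewrite in_itv/= => /andP[su ut].
  have u0 : 0 < u by exact: le_lt_trans su.
  apply: is_deriveB; [exact: (sol_derive sz)|exact: (sol_derive sy)].
- by move=> u; rewrite in_itv/= => /andP[su ut]; exact: fB.
Qed.

(** A Gronwall estimate by doubling: over a time step [h] with [M * h <= 1 / 2]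
    the distance at most doubles, since it grows by at most half of its own
    maximum. *)
Lemma sol_growth T K : 0 <= K -> exists2 C : R, 0 <= C &
  forall x0 y0 y z d, is_solution r f x0 z -> is_solution r f y0 y ->
    forall T', T' <= T ->
    (forall s, - r <= s -> s <= T' -> enorm (z s) <= K) ->
    (forall s, - r <= s -> s <= T' -> enorm (y s) <= K) ->
    (forall s, - r <= s -> s <= 0 -> enorm (z s - y s) <= d) ->
    forall s, - r <= s -> s <= T' -> enorm (z s - y s) <= C * d.
Proof.
move=> K0; have [M M0 fM] := lip_const K0.
(* With this step the distance can grow by at most half of its maximum. *)
pose h := (2 * M)^-1; have h0 : 0 < h by rewrite invr_gt0 mulr_gt0.
pose N := (Num.truncn (T / h)).+1.
have TN : T <= N%:R * h by rewrite -ler_pdivrMr// ltW// truncnS_gt.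
exists (2 ^+ N); first by rewrite exprn_ge0.
move=> x0 y0 y z d sz sy T' T'T zK yK zyd.
have d0 : 0 <= d.
  by rewrite (le_trans (enorm_ge0 _) (zyd 0 _ _))// oppr_le0 ltW.
suff H (k : nat) s : - r <= s -> s <= T' -> s <= k%:R * h ->
    enorm (z s - y s) <= 2 ^+ k * d.
  by move=> s rs sT'; apply: H => //; rewrite (le_trans sT')// (le_trans T'T).
elim: k s => [|k IH] s rs sT'.
  by rewrite mul0r expr0 mul1r; exact: zyd.
move=> sk; pose tk := k%:R * h; have tk0 : 0 <= tk by rewrite mulr_ge0// ltW.
pose b := Num.min T' (k.+1%:R * h).
have sb : s <= b by rewrite le_min sT'.
have rb : - r <= b by exact: le_trans sb.
have cw : {within `[- r, b], continuous (fun u => z u - y u)}.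
  by move=> u; exact: cvgB (sol_within sz b u) (sol_within sy b u).
have [|c cb cmax] := @EVT_max R (fun u => enorm (z u - y u)) (- r) b rb.
  move=> u; apply: (@continuous_comp (subspace `[- r, b]) _ _
    (fun u => z u - y u) enorm u (cw u)).
  exact: enorm_continuous.
pose S := enorm (z c - y c).
have [rc cb'] : - r <= c /\ c <= b by move: cb; rewrite in_itv/= => /andP.
have cT' : c <= T' by move: cb'; rewrite le_min => /andP[].
have Sd : S <= 2 ^+ k * d + S / 2.
  have [ck|ck] := leP c tk.
    by rewrite (le_trans (IH c rc cT' ck))// lerDl divr_ge0// enorm_ge0.
  have tkT : tk <= T' by rewrite (le_trans (ltW ck)).
  have rtk : - r <= tk by rewrite (le_trans _ tk0)// oppr_le0 ltW.
  have IHk := IH tk rtk tkT (lexx _).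
  have inc : enorm ((z c - y c) - (z tk - y tk)) <= (M * S) * (c - tk).
    apply: (sol_diff_increment sz sy tk0 (ltW ck)) => u tku uc.
    have u0 : 0 <= u by exact: le_trans (ltW tku).
    have uT s' : s' <= u -> s' <= T'.
      by move=> s'u; rewrite (le_trans s'u)// (le_trans (ltW uc)).
    apply: (le_trans (fM _ _ (C0_sol sz u0) (C0_sol sy u0) _ _)).
    - by apply: sup_norm_segment => // s' rs' /uT; exact: zK.
    - by apply: sup_norm_segment => // s' rs' /uT; exact: yK.
    apply: ler_wpM2l; first exact: ltW.
    apply: sup_norm_le => [|s']; first exact: enorm_ge0.
    rewrite in_itv/= => /andP[rs' s'0]; apply: (cmax (u + s')).
    rewrite in_itv/= (le_trans rs') ?lerDr//= (le_trans _ cb')//.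
    by rewrite (le_trans _ (ltW uc))// gerDl.
  rewrite -/S.
  have -> : S = enorm (((z c - y c) - (z tk - y tk)) + (z tk - y tk)).
    by rewrite subrK.
  rewrite (le_trans (enormD _ _))// addrC lerD// (le_trans inc)//.
  have -> : enorm (((z c - y c) - (z tk - y tk)) + (z tk - y tk)) = S.
    by rewrite subrK.
  have cth : c - tk <= h.
    rewrite lerBlDr (le_trans cb')// ge_min /tk -natr1 mulrDl mul1r addrC lexx.
    by rewrite orbT.
  have -> : S / 2 = (M * S) * h.
    by rewrite /h invfM; field; rewrite gt_eqF.
  by rewrite ler_wpM2l// mulr_ge0 ?enorm_ge0// ltW.
have SD : S <= 2 * (2 ^+ k * d) by lra.
rewrite exprS -mulrA (le_trans _ SD)//; apply: (cmax s).
by rewrite in_itv/= rs.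
Qed.

Lemma sol_bounded x0 z T : is_solution r f x0 z -> exists2 M : R, 0 <= M &
  forall s, - r <= s -> s <= T -> enorm (z s) <= M.
Proof.
move=> sz; have [M M0 zM] := within_bounded (sol_within sz T).
by exists M => // s rs sT; apply: zM; rewrite in_itv/= rs.
Qed.

(** Two solutions with the same initial path have the distance [0] on the initial
    interval, and growth by a factor keeps it so. *)
Lemma sol_unique x0 y z s : is_solution r f x0 z -> is_solution r f x0 y ->
  - r <= s -> z s = y s.
Proof.
move=> sz sy rs.
have [M M0 zM] := sol_bounded s sz; have [M' M'0 yM] := sol_bounded s sy.
have [C C0' H] := sol_growth s (K := Num.max M M') ltac:(by rewrite le_max M0).
have := H _ _ _ _ 0 sz sy s (lexx s) _ _ _ s rs (lexx s).
rewrite mulr0 => zy.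
suff : enorm (z s - y s) <= 0.
  move=> e; apply/eqP; rewrite -subr_eq0; apply/eqP/enorm_eq0/eqP.
  by rewrite eq_le e enorm_ge0.
apply: zy => u ru us.
- by rewrite le_max zM.
- by rewrite le_max yM ?orbT.
- by rewrite (sol_init sz) ?(sol_init sy) ?in_itv/= ?ru// subrr enorm0.
Qed.

(** The trajectory itself, of which the values of [phi] are the segments. *)
Definition sol x0 : R -> 'rV[R]_n := get [set z | is_solution r f x0 z].

Lemma phiE t x0 : phi r f t x0 = segment_at (sol x0) t.
Proof. by []. Qed.

Lemma is_solution_sol x0 : (exists z, is_solution r f x0 z) -> is_solution r f x0 (sol x0).
Proof. by move=> ex; exact: (getPex ex). Qed.

Lemma eq_phi t x0 y0 : {in `[- r, 0], x0 =1 y0} -> phi r f t x0 = phi r f t y0.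
Proof. by move=> xy; rewrite /phi (eq_solution_set xy). Qed.

Lemma phi0 x0 : (exists z, is_solution r f x0 z) ->
  {in `[- r, 0], phi r f 0 x0 =1 x0}.
Proof.
by move=> /is_solution_sol sz s sr; rewrite phiE /segment_at add0r (sol_init sz).
Qed.

Lemma phi_is_solution x0 t : 0 <= t -> (exists z, is_solution r f x0 z) ->
  exists z, is_solution r f (phi r f t x0) z.
Proof. by move=> t0 /is_solution_sol sz; exists (fun s => sol x0 (t + s)); exact: (is_solution_shift sz t0). Qed.

Lemma phiD x0 t s : 0 <= t -> 0 <= s -> (exists z, is_solution r f x0 z) ->
  {in `[- r, 0], phi r f s (phi r f t x0) =1 phi r f (t + s) x0}.
Proof.
move=> t0 s0 ex u; rewrite in_itv/= => /andP[ru u0].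
have sz := is_solution_sol ex; have sw := is_solution_shift sz t0.
have sy := is_solution_sol (phi_is_solution t0 ex).
rewrite !phiE /segment_at -addrA (sol_unique sy sw)//.
by rewrite (le_trans ru)// lerDr.
Qed.

End Solutions.

Arguments sol_within {R n r f x0 z} sz T.

(** * Segments of solutions in the Sobolev space *)

Section SegmentDerivatives.
Context {R : realType} {n : nat}.
Local Notation mu := (@lebesgue_measure R).
Implicit Types (w a g : R -> 'rV[R]_n) (u v : R -> R).

Lemma ae_neq (c : R) : {ae mu, forall s : R, s != c}.
Proof.
exists [set c]; split; [exact: measurable_set1|exact: lebesgue_measure_set1|].
by move=> s /= /negP/negPn/eqP.
Qed.

Lemma measurable_modify_point u v (c : R) : measurable_fun [set: R] u ->
  (forall s, s != c -> v s = u s) -> measurable_fun [set: R] v.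
Proof.
move=> mu_ uv.
have -> : v = u \+ (fun s => (v c - u c) * \1_[set c] s).
  apply/funext => s /=; rewrite indicE; have [->|sc] := eqVneq s c.
    by rewrite mem_set// mulr1 addrC subrK.
  by rewrite memNset ?mulr0 ?addr0 ?uv//=; exact/eqP.
apply: measurable_funD => //; apply: measurable_funM; first exact: measurable_cst.
by apply: measurable_indic; exact: measurable_set1.
Qed.

Variables r p : R.
Hypotheses (r0 : 0 < r) (p1 : 1 <= p).
Let p0 : 0 < p := lt_le_trans ltr01 p1.

Lemma vLfun0 : vLfun p (cst 0 : R -> 'rV[R]_n).
Proof.
apply/vLfunP => //; split=> [i|].
  rewrite (_ : (fun s => _) = cst 0); first exact: measurable_cst.
  by apply/funext => s; rewrite mxE.
rewrite /vLnorm (_ : EFin \o _ = cst 0%E) ?Lnorm0 ?eqe ?gt_eqF//.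
by apply/funext => s /=; rewrite enorm0.
Qed.

Lemma vLnorm0 : vLnorm p (cst 0 : R -> 'rV[R]_n) = 0%E.
Proof.
rewrite /vLnorm (_ : EFin \o _ = cst 0%E) ?Lnorm0 ?eqe ?gt_eqF//.
by apply/funext => s /=; rewrite enorm0.
Qed.

Lemma vLnorm_shift a (t : R) : vLfun p a ->
  vLnorm p (fun s => a (t + s)) = vLnorm p a.
Proof.
move=> fa; rewrite /vLnorm -(Lnorm_shift p t (vLfun_measurable fa)).
by apply: eq_Lnorm => s /=; rewrite addrC.
Qed.

Lemma measurable_coord_shift a (t : R) i :
  measurable_fun [set: R] (fun s => a s ord0 i) ->
  measurable_fun [set: R] (fun s => a (t + s) ord0 i).
Proof.
move=> ma; rewrite (_ : (fun s => _) = (fun s => a s ord0 i) \o (fun s => s + t)).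
  exact: measurableT_comp ma (measurable_shift t).
by apply/funext => s /=; rewrite addrC.
Qed.

(** The excluded point [- t] is where the initial path and the solution meet, and
    where the derivative of a segment may fail to exist. *)
Lemma vLnorm_shift_add w a (t c : R) : vLfun p a -> 0 <= c ->
  (forall s, s \in `]- r, 0[ -> s != - t ->
     enorm (w s) <= enorm (a (t + s)) + c) ->
  (forall s, s \notin `]- r, 0[ -> w s = 0) ->
  (vLnorm p w <= vLnorm p a + (c * r `^ p^-1)%:E)%E.
Proof.
move=> fa c0 wa w0.
have ma : measurable_fun [set: R] (fun s => enorm (a (t + s))).
  by apply: measurable_enorm => i; apply: measurable_coord_shift; have /LfunE[] := fa i.
pose ci s : R := c * \1_(`]- r, 0[%classic) s.
have mc : measurable_fun [set: R] ci.
  apply: measurable_funM; first exact: measurable_cst.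
  by apply: measurable_indic; exact: measurable_itv.
have -> : ((c * r `^ p^-1)%:E = 'N[mu]_p%:E[EFin \o ci])%E.
  by rewrite Lnorm_indic_itv// ?sub0r ?opprK// oppr_le0 ltW.
rewrite -(vLnorm_shift t fa).
apply: le_trans (@minkowski_EFin _ _ _ mu _ _ _ ma mc p1).
apply: ae_le_vLnorm => //; apply: ae_lebesgueS (ae_neq (- t)) => s st /=.
rewrite [leRHS]ger0_norm; last by rewrite addr_ge0 ?enorm_ge0// mulr_ge0.
have [sr|sr] := boolP (s \in `]- r, 0[).
  by rewrite /ci indicE mem_set// mulr1; exact: wa.
by rewrite w0// enorm0 addr_ge0 ?enorm_ge0// mulr_ge0.
Qed.

(** Along a trajectory the derivative of a segment is that of the initial path,
    shifted, followed by the velocity. *)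
Lemma vLfun_segment w a g (t c : R) : vLfun p a ->
  (forall i, measurable_fun [set: R] (fun s => g s ord0 i)) ->
  0 <= c -> (forall s, s <= t -> enorm (g s) <= c) ->
  (forall s, s \in `]- r, 0[ -> s != - t -> w s = a (t + s) + g (t + s)) ->
  (forall s, s \notin `]- r, 0[ -> w s = 0) ->
  vLfun p w.
Proof.
move=> fa mg c0 gc wag w0; apply/vLfunP => //; split=> [i|]; last first.
  apply: le_lt_trans (vLnorm_shift_add (t := t) fa c0 _ w0) _.
    move=> s sr st; rewrite (wag _ sr st) (le_trans (enormD _ _))// lerD2l gc//.
    by rewrite gerDl; move: sr; rewrite in_itv/= => /andP[_ /ltW].
  by rewrite lte_add_pinfty ?ltry ?vLfun_lty.
pose h s := (a (t + s) ord0 i + g (t + s) ord0 i) * \1_(`]- r, 0[%classic) s.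
have mh : measurable_fun [set: R] h.
  apply: measurable_funM; last by apply: measurable_indic; exact: measurable_itv.
  apply: measurable_funD; apply: measurable_coord_shift; last exact: mg.
  by have /LfunE[] := fa i.
apply: (measurable_modify_point mh (c := - t)) => s st; rewrite /h indicE.
have [sr|sr] := boolP (s \in `]- r, 0[).
  by rewrite mem_set// mulr1 wag// mxE.
by rewrite memNset ?mulr0 ?w0 ?mxE//=; exact/negP.
Qed.

End SegmentDerivatives.

Section SegmentsInSobolev.
Context {R : realType} {n : nat}.
Variables (r : R) (f : (R -> 'rV[R]_n) -> 'rV[R]_n) (p : R).
Hypotheses (r0 : 0 < r) (f0 : f (cst 0) = 0) (p1 : 1 < p).
Hypothesis f_lip : lipschitz_on_bounded_C0 r f.
Let le1p : 1 <= p := ltW p1.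
Implicit Types (x y z : R -> 'rV[R]_n) (s t u T K : R).

Lemma f_bound K : 0 <= K -> exists2 M : R, 0 < M &
  forall x, C0 r x -> sup_norm r x <= K -> enorm (f x) <= M * sup_norm r x.
Proof.
move=> K0; have [M M0 fM] := lip_const f_lip K0; exists M => // x cx xK.
have := fM _ _ cx (@C0_cst _ _ r 0) xK; rewrite f0 subr0 sup_norm0 => /(_ K0).
by rewrite (_ : x - cst 0 = x)//; apply/funext => s; exact: subr0.
Qed.

(** Set to zero on the initial interval, where the derivative is that of the
    initial path: the derivative of the trajectory is the sum of both. *)
Definition speed z u : 'rV[R]_n := if 0 < u then f (segment_at z u) else 0.

(** On the positive half-line the velocity is continuous, since segments of a
    continuous path depend continuously on time. *)
Lemma speed_measurable x0 z i : is_solution r f x0 z ->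
  measurable_fun [set: R] (fun u => speed z u ord0 i).
Proof.
move=> sz; pose g u := f (segment_at z u) ord0 i.
rewrite (_ : (fun u => _) = g \_ `]0, +oo[%classic); last first.
  apply/funext => u; rewrite patchE /speed mem_setE in_itv/= andbT.
  by case: ifP => // _; rewrite mxE.
apply/(measurable_restrictT _ _).1; first exact: measurable_itv.
apply: open_continuous_measurable_fun; first exact: interval_open.
move=> u; rewrite inE /= in_itv/= andbT => u0.
have [K K0 zK] := sol_bounded (u + 1) sz.
have [M M0 fM] := lip_const f_lip K0.
apply/cvgrPdist_lt => e e0.
have eM : 0 < e / (2 * M) by rewrite divr_gt0// mulr_gt0.
have [d d0 zd] := within_uniform_continuous (sol_within sz (u + 1)) eM.
have dm : 0 < Num.min (Num.min d 1) u by rewrite !lt_min d0 ltr01 u0.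
apply/nbhs_ballP; exists (Num.min (Num.min d 1) u) => //= v.
rewrite /ball/= !lt_min => /andP[/andP[uvd uv1] uvu].
have [v0 vu1] : 0 < v /\ v <= u + 1.
  by move: uv1 uvu; rewrite !ltr_norml => /andP[? ?] /andP[? ?]; split; lra.
have bd t : 0 < t -> t <= u + 1 -> C0 r (segment_at z t) /\
    sup_norm r (segment_at z t) <= K.
  move=> t0 tu; split; first exact: (C0_sol sz (ltW t0)).
  apply: sup_norm_segment (ltW t0) => // s rs st.
  by apply: zK => //; exact: le_trans tu.
have uu1 : u <= u + 1 by rewrite lerDl.
have [cu Ku] := bd u u0 uu1; have [cv Kv] := bd v v0 vu1.
have duv : sup_norm r (segment_at z u - segment_at z v) <= e / (2 * M).
  apply: sup_norm_le => [|s]; first exact: ltW.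
  rewrite in_itv/= => /andP[rs s0]; apply: ltW.
  have mem t : 0 < t -> t <= u + 1 -> t + s \in `[- r, u + 1].
    move=> t0 tu; rewrite in_itv/= (le_trans rs) ?lerDr ?(ltW t0)//=.
    by rewrite (le_trans _ tu)// gerDl.
  apply: zd; [exact: mem|exact: mem|].
  by rewrite opprD addrACA subrr addr0.
have H : enorm (f (segment_at z u) - f (segment_at z v)) <= e / 2.
  apply: (le_trans (fM _ _ cu cv Ku Kv)); apply: (le_trans (ler_wpM2l (ltW M0) duv)).
  by rewrite le_eqVlt; apply/orP; left; apply/eqP; field; rewrite gt_eqF.
have := le_trans (coord_le_enorm _ i) H; rewrite !mxE => /le_lt_trans; apply.
by rewrite ltr_pdivrMr// ltr_pMr// ltr1n.
Qed.

Lemma derive1_shift z t s : derive1 (segment_at z t) s = derive1 z (t + s).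
Proof.
rewrite /derive1 /segment_at; set F := (X in lim (X @ _)); set G := (X in _ = lim (X @ _)).
suff -> : F = G by [].
by apply/funext => h; rewrite /F /G addrCA.
Qed.

Lemma wder_segment x0 z t s : is_solution r f x0 z -> 0 <= t ->
  s \in `]- r, 0[ -> s != - t ->
  wder r (segment_at z t) s = wder r x0 (t + s) + speed z (t + s).
Proof.
move=> sz t0 sr; rewrite wder_in// derive1_shift -subr_eq0 opprK addrC.
rewrite neq_lt => /orP[ts|ts].
  have tsr : t + s \in `]- r, 0[.
    move: sr; rewrite !in_itv/= ts andbT => /andP[rs _].
    by rewrite (lt_le_trans rs)// lerDr.
  rewrite wder_in// /speed ltNge (ltW ts)/= addr0.
  apply: near_eq_derive1; apply: filterS (near_oo tsr) => u ur.
  by apply: (sol_init sz); exact: subset_itv_oo_cc ur.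
rewrite wder_out; last by rewrite in_itv/= (ltNge (t + s)) (ltW ts) andbF.
rewrite add0r /speed ts; apply: derive1_is_derive; exact: (sol_derive sz).
Qed.

Lemma wder_segment_late x0 z t s : is_solution r f x0 z -> r <= t ->
  s \in `]- r, 0[ -> wder r (segment_at z t) s = speed z (t + s).
Proof.
move=> sz rt sr; have t0 : 0 <= t by rewrite (le_trans _ rt)// ltW.
have ts : 0 < t + s.
  by move: sr; rewrite in_itv/= => /andP[rs _]; lra.
rewrite (wder_segment sz t0 sr) ?wder_out ?add0r//.
  by rewrite in_itv/= (ltNge (t + s)) (ltW ts) andbF.
by rewrite -subr_eq0 opprK addrC gt_eqF.
Qed.

Lemma speed_bounded x0 z T : is_solution r f x0 z ->
  exists2 B : R, 0 <= B & forall u, u <= T -> enorm (speed z u) <= B.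
Proof.
move=> sz; have [K K0 zK] := sol_bounded T sz; have [M M0 fM] := f_bound K0.
exists (M * K) => [|u uT]; first by rewrite mulr_ge0// ltW.
rewrite /speed; case: ifPn => [u0|_]; last by rewrite enorm0 mulr_ge0// ltW.
have zu : sup_norm r (segment_at z u) <= K.
  apply: sup_norm_segment (ltW u0) => // s rs su.
  by apply: zK => //; exact: le_trans uT.
rewrite (le_trans (fM _ (C0_sol sz (ltW u0)) zu))//.
by rewrite ler_wpM2l// ltW.
Qed.

(** An interval may straddle time [0]: its part before [0] is controlled by the
    initial path and its part after [0] by the velocity. *)
Lemma segment_increment x0 z t (B : R) : is_solution r f x0 z -> 0 <= t ->
  0 <= B -> (forall u, u <= t -> enorm (speed z u) <= B) ->
  forall a b, - r <= a -> a <= b -> b <= t ->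
  enorm (z b - z a) <=
    enorm (x0 (Num.min b 0) - x0 (Num.min a 0)) + B * (b - a).
Proof.
move=> sz t0 B0 zB a b ra ab bt.
have inc c d : 0 <= c -> c <= d -> d <= t -> enorm (z d - z c) <= B * (d - c).
  move=> c0 cd dt; apply: (sol_increment r0 sz c0 cd) => u cu ud.
  have u0 : 0 < u by exact: le_lt_trans cu.
  have := zB u (le_trans (ltW ud) dt); by rewrite /speed u0.
have ini c : - r <= c -> c <= 0 -> z c = x0 c.
  by move=> rc c0; apply: (sol_init sz); rewrite in_itv/= rc.
have r00 : - r <= 0 by rewrite oppr_le0 ltW.
have [a0|a0] := leP a 0; have [b0|b0] := leP b 0.
- by rewrite !ini ?lerDl ?mulr_ge0 ?subr_ge0// (le_trans ra).
- rewrite -(ini a)// -(ini 0)//; apply: le_trans (enorm_distD (z 0) _ _) _.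
  rewrite addrC lerD2l (le_trans (inc 0 b _ _ _))//; first exact: ltW.
  by rewrite ler_wpM2l// lerD2l lerN2.
- by have := le_lt_trans ab (le_lt_trans b0 a0); rewrite ltxx.
- by rewrite subrr enorm0 add0r inc// ltW.
Qed.

Lemma ac_min_shift x0 t : 0 <= t -> absolutely_continuous r x0 ->
  absolutely_continuous r (fun s => x0 (Num.min (t + s) 0)).
Proof.
move=> t0 acx e /acx[d d0 dx]; exists d => // m I Ir Ino Id.
pose J k := (Num.min (t + (I k).1) 0, Num.min (t + (I k).2) 0).
have mono (a b : R) : a <= b -> Num.min (t + a) 0 <= Num.min (t + b) 0.
  by move=> ab; rewrite le_min !ge_min lerD2l ab lexx/= orbT.
have lenJ k : (J k).2 - (J k).1 <= (I k).2 - (I k).1.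
  have [_ I12 _] := Ir k.
  by rewrite /J /= !minEle; do !case: ifPn; rewrite -?ltNge => *; lra.
apply: (dx m J).
- move=> k; have [rI I12 I0] := Ir k; split; rewrite /J/=.
  + by rewrite le_min oppr_le0 (ltW r0) andbT (le_trans rI)// lerDr.
  + exact: mono.
  + by rewrite ge_min lexx orbT.
- move=> k l kl; have [h|h] := Ino k l kl; [left|right]; exact: mono.
- by apply: le_lt_trans Id; apply: ler_sum => k _.
Qed.

(** Up to a Lipschitz path, a segment is the initial path followed by a constant. *)
Lemma ac_segment x0 z t : is_solution r f x0 z -> 0 <= t ->
  absolutely_continuous r (fun s => x0 (Num.min (t + s) 0)) ->
  absolutely_continuous r (segment_at z t).
Proof.
move=> sz t0 acx e e0; have [B B0 zB] := speed_bounded t sz.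
have e20 : 0 < e / 2 by rewrite divr_gt0.
have [d d0 dx] := acx _ e20.
have B1 : 0 < 2 * (B + 1) by rewrite mulr_gt0// ltr_wpDl.
exists (Num.min d (e / (2 * (B + 1)))) => [|m I Ir Ino].
  by rewrite lt_min d0 divr_gt0.
rewrite lt_min => /andP[Id IB].
have H1 := dx m I Ir Ino Id.
set s1 := \sum_(k < m) _ in H1.
set s2 := \sum_(k < m) ((I k).2 - (I k).1) in Id IB.
have s20 : 0 <= s2.
  by apply: sumr_ge0 => k _; have [_ I12 _] := Ir k; rewrite subr_ge0.
have H2 : B * s2 <= e / 2.
  move: IB; rewrite ltr_pdivlMr// => IB.
  have : B * s2 <= (B + 1) * s2 by rewrite ler_wpM2r// lerDl.
  lra.
apply: (@le_lt_trans _ _ (s1 + B * s2)); last by rewrite [e]splitr ltr_leD.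
rewrite /s1 /s2 mulr_sumr -big_split/=; apply: ler_sum => k _.
have [rI I12 I0] := Ir k; rewrite /segment_at.
have := segment_increment sz t0 B0 zB (a := t + (I k).1) (b := t + (I k).2).
have -> : t + (I k).2 - (t + (I k).1) = (I k).2 - (I k).1 by ring.
apply; last by rewrite gerDl.
- by rewrite (le_trans rI)// lerDr.
- by rewrite lerD2l.
Qed.

Lemma W1p_segment x0 z t : is_solution r f x0 z -> 0 <= t -> W1p r p x0 ->
  W1p r p (segment_at z t).
Proof.
move=> sz t0 /W1pE[acx wx]; apply/W1pE; split.
  by apply: (ac_segment sz t0); exact: ac_min_shift.
have [B B0 zB] := speed_bounded t sz.
apply: (vLfun_segment r0 le1p (t := t) wx (fun i => speed_measurable i sz) B0 zB).
  by move=> s sr st; rewrite (wder_segment sz).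
by move=> s sr; rewrite wder_out.
Qed.

(** After time [r] the segment contains no part of the initial path, so its
    regularity comes from the equation alone; [x0] need only be continuous. *)
Lemma W1p_segment_late x0 z t : is_solution r f x0 z -> r <= t ->
  W1p r p (segment_at z t).
Proof.
move=> sz rt; have t0 : 0 <= t by rewrite (le_trans _ rt)// ltW.
apply/W1pE; split.
  apply: (ac_segment sz t0) => e e0; exists 1 => // m I Ir _ _.
  rewrite big1// => k _; have [rI I12 I0] := Ir k.
  have h a : - r <= a -> Num.min (t + a) 0 = 0 by move=> ra; apply/min_idPr; lra.
  by rewrite !h ?subrr ?enorm0// (le_trans rI).
have [B B0 zB] := speed_bounded t sz.
apply: (vLfun_segment r0 le1p (t := t) (vLfun0 le1p) (fun i => speed_measurable i sz) B0 zB) => //.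
  by move=> s sr st; rewrite add0r (wder_segment_late sz).
by move=> s sr; rewrite wder_out.
Qed.

Lemma derive_norm_segment x0 z t (B : R) : is_solution r f x0 z -> 0 <= t ->
  W1p r p x0 -> 0 <= B -> (forall u, u <= t -> enorm (speed z u) <= B) ->
  derive_norm r p (segment_at z t) <= derive_norm r p x0 + B * r `^ p^-1.
Proof.
move=> sz t0 Wx B0 zB; have /W1pE[_ wx] := Wx.
have := vLnorm_shift_add r0 le1p (t := t) (w := wder r (segment_at z t)) wx B0.
rewrite (W1p_vLnorm p1 Wx) (W1p_vLnorm p1 (W1p_segment sz t0 Wx)) -EFinD lee_fin.
apply=> s sr; last by rewrite wder_out.
move=> st; rewrite (wder_segment sz)// (le_trans (enormD _ _))// lerD2l zB//.
by rewrite gerDl; move: sr; rewrite in_itv/= => /andP[_ /ltW].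
Qed.

Lemma derive_norm_segmentB x0 y0 z y t (B : R) :
  is_solution r f x0 z -> is_solution r f y0 y -> 0 <= t ->
  W1p r p x0 -> W1p r p y0 -> 0 <= B ->
  (forall u, u <= t -> enorm (speed z u - speed y u) <= B) ->
  derive_norm r p (segment_at z t - segment_at y t) <=
  derive_norm r p (x0 - y0) + B * r `^ p^-1.
Proof.
move=> sz sy t0 Wx Wy B0 zyB; have /W1pE[_ wx] := Wx; have /W1pE[_ wy] := Wy.
have := vLnorm_shift_add r0 le1p (t := t)
  (w := fun s => wder r (segment_at z t) s - wder r (segment_at y t) s)
  (vLfunB le1p wx wy) B0.
rewrite (W1p_vLnormB r0 p1 Wx Wy).
rewrite (W1p_vLnormB r0 p1 (W1p_segment sz t0 Wx) (W1p_segment sy t0 Wy)).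
rewrite -EFinD lee_fin; apply=> s sr; last by rewrite !wder_out// subrr.
move=> st; rewrite (wder_segment sz)// (wder_segment sy)// opprD addrACA.
rewrite (le_trans (enormD _ _))// lerD2l zyB//.
by rewrite gerDl; move: sr; rewrite in_itv/= => /andP[_ /ltW].
Qed.

Lemma derive_norm_segmentB_late x0 y0 z y t (B : R) :
  is_solution r f x0 z -> is_solution r f y0 y -> r <= t -> 0 <= B ->
  (forall u, u <= t -> enorm (speed z u - speed y u) <= B) ->
  derive_norm r p (segment_at z t - segment_at y t) <= B * r `^ p^-1.
Proof.
move=> sz sy rt B0 zyB.
have := vLnorm_shift_add r0 le1p (t := t)
  (w := fun s => wder r (segment_at z t) s - wder r (segment_at y t) s)
  (vLfun0 le1p) B0.
rewrite (vLnorm0 le1p) add0e.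
rewrite (W1p_vLnormB r0 p1 (W1p_segment_late sz rt) (W1p_segment_late sy rt)).
rewrite lee_fin; apply=> s sr; last by rewrite !wder_out// subrr.
move=> st; rewrite (wder_segment_late sz)// (wder_segment_late sy)//.
rewrite enorm0 add0r zyB//.
by rewrite gerDl; move: sr; rewrite in_itv/= => /andP[_ /ltW].
Qed.

End SegmentsInSobolev.

(** * Dependence of the segments on the initial state *)

Section Flow.
Context {R : realType} {n : nat}.
Variables (r : R) (f : (R -> 'rV[R]_n) -> 'rV[R]_n) (p : R).
Hypotheses (r0 : 0 < r) (f0 : f (cst 0) = 0) (p1 : 1 < p).
Hypothesis f_lip : lipschitz_on_bounded_C0 r f.
Let le1p : 1 <= p := ltW p1.
Implicit Types (x y z : R -> 'rV[R]_n) (s t u T K d : R).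
Local Notation sol := (sol r f).
Local Notation vel := (speed f).
Local Notation has_sol x0 := (exists z, is_solution r f x0 z).

Let rr0 : - r <= 0. Proof. by rewrite oppr_le0 ltW. Qed.

Lemma sol_zero : is_solution r f (cst 0) (cst 0).
Proof.
split=> // [|t t0]; first by apply: continuous_subspaceT => t; exact: cvg_cst.
by rewrite (_ : segment_at _ t = cst 0)// f0; exact: is_derive_cst.
Qed.

Lemma sol_dist T K : 0 <= K -> exists2 C : R, 0 <= C &
  forall x0 y0 z y, is_solution r f x0 z -> is_solution r f y0 y ->
    (forall s, - r <= s -> s <= T -> enorm (z s) <= K) ->
    (forall s, - r <= s -> s <= T -> enorm (y s) <= K) ->
    (forall s, - r <= s -> s <= T -> enorm (z s - y s) <= C * sup_norm r (x0 - y0)) /\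
    (forall u, u <= T -> enorm (vel z u - vel y u) <= C * sup_norm r (x0 - y0)).
Proof.
move=> K0; have [C C0' HC] := sol_growth r0 f_lip T K0.
have [M M0 fM] := lip_const f_lip K0.
have MC0 : 0 <= M * C by rewrite mulr_ge0// ltW.
exists (C + M * C) => [|x0 y0 z y sz sy zK yK]; first by rewrite addr_ge0.
have CC d : 0 <= d -> C * d <= (C + M * C) * d /\ M * C * d <= (C + M * C) * d.
  by move=> d0; split; rewrite ler_wpM2r ?lerDl ?lerDr.
have [CC1 CC2] := CC _ (sup_norm_ge0 r (x0 - y0)).
have init s : - r <= s -> s <= 0 -> enorm (z s - y s) <= sup_norm r (x0 - y0).
  move=> rs s0; have sr : s \in `[- r, 0] by rewrite in_itv/= rs.
  rewrite (sol_init sz sr) (sol_init sy sr).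
  exact: (le_sup_norm (C0B (sol_C0_init sz) (sol_C0_init sy)) sr).
have zy := HC _ _ _ _ _ sz sy T (lexx T) zK yK init.
split=> [s rs sT|u uT]; first exact: le_trans (zy s rs sT) CC1.
apply: le_trans CC2; rewrite /speed; case: ifPn => [u0|_]; last first.
  by rewrite subrr enorm0 mulr_ge0// sup_norm_ge0.
have [cz cy] := (C0_sol sz (ltW u0), C0_sol sy (ltW u0)).
apply: (le_trans (fM _ _ cz cy _ _)).
- apply: sup_norm_segment (ltW u0) => // s rs su; apply: zK => //.
  exact: le_trans uT.
- apply: sup_norm_segment (ltW u0) => // s rs su; apply: yK => //.
  exact: le_trans uT.
rewrite -mulrA ler_pM2l//; apply: sup_norm_le.
  by rewrite mulr_ge0// sup_norm_ge0.
move=> s; rewrite in_itv/= => /andP[rs s0]; apply: zy.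
  by rewrite (le_trans rs)// lerDr ltW.
by rewrite (le_trans _ uT)// gerDl.
Qed.

(** Solutions starting close to a given one stay bounded on compact time
    intervals: until they leave the tube of radius [1] around it the growth
    estimate applies, and it keeps them strictly inside. *)
Lemma sol_stay_close x0 z T : is_solution r f x0 z -> 0 <= T ->
  exists K eta : R, [/\ 0 <= K, 0 < eta,
    forall s, - r <= s -> s <= T -> enorm (z s) <= K &
    forall y0 y, is_solution r f y0 y ->
      (forall s, - r <= s -> s <= 0 -> enorm (z s - y s) <= eta) ->
      forall s, - r <= s -> s <= T -> enorm (y s) <= K].
Proof.
move=> sz T0; have [M M0 zM] := sol_bounded T sz.
have M10 : 0 <= M + 1 by rewrite addr_ge0.
have [C C0' HC] := sol_growth r0 f_lip T M10.
pose eta := (2 * (C + 1))^-1.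
have C1 : 0 < 2 * (C + 1) by rewrite mulr_gt0// ltr_wpDl.
have eta0 : 0 < eta by rewrite invr_gt0.
have Ceta : C * eta <= 1 / 2.
  rewrite /eta ler_pdivrMr// mulrC; lra.
have eta1 : eta < 1.
  by rewrite /eta invf_lt1//; lra.
exists (M + 1), eta; split=> //.
  by move=> s rs sT; rewrite (le_trans (zM s rs sT))// lerDl.
move=> y0 y sy zy; pose w s := z s - y s.
have yK s : - r <= s -> s <= T -> enorm (w s) <= 1 -> enorm (y s) <= M + 1.
  move=> rs sT w1; rewrite -[y s](subKr (z s)).
  by rewrite (le_trans (enormD _ _))// enormN lerD// zM.
suff wlt1 s : 0 <= s -> s <= T -> enorm (w s) < 1.
  move=> s rs sT; apply: yK => //; have [s0|s0] := leP s 0.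
    by rewrite (le_trans (zy s rs s0))// ltW.
  by rewrite ltW// wlt1// ltW.
move=> s0 sT; rewrite ltNge; apply/negP => ws.
pose S := [set t | [/\ 0 <= t, t <= T & 1 <= enorm (w t)]].
have Ss : S s by [].
have lbS : lbound S 0 by move=> t [].
have hinf : has_inf S by split; [exists s|exists 0].
(* The first exit time from the tube of radius 1. *)
pose t0 := inf S.
have t00 : 0 <= t0 by apply: lb_le_inf => //; exists s.
have t0s : t0 <= s by apply: ge_inf => //; exists 0.
have t0T : t0 <= T by exact: le_trans sT.
have before u : 0 <= u -> u < t0 -> enorm (w u) < 1.
  move=> u0 ut; rewrite ltNge; apply/negP => wu.
  have : t0 <= u.
    apply: ge_inf; first by exists 0.
    by split=> //; rewrite (le_trans (ltW ut)).
  by rewrite leNgt ut.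
have w0 : enorm (w 0) < 1 by rewrite (le_lt_trans (zy 0 _ _)).
have cw : {within `[- r, T], continuous w}.
  by move=> u; exact: cvgB (sol_within sz T u) (sol_within sy T u).
have /within_continuousP cw' := cw.
have t0r : `[- r, T]%classic t0 by rewrite /= in_itv/= t0T (le_trans rr0).
have wt0 : enorm (w t0) <= 1.
  rewrite leNgt; apply/negP => wt0.
  have t0p : 0 < t0.
    rewrite lt_neqAle t00 andbT; apply/eqP => t0E.
    by move: wt0; rewrite -t0E ltNge (ltW w0).
  have e0 : 0 < enorm (w t0) - 1 by rewrite subr_gt0.
  have [d d0 wd] := cw' t0 t0r _ e0.
  pose u := Num.max 0 (t0 - d / 2).
  have d20 : 0 < d / 2 by rewrite divr_gt0.
  have [u0 ut] : 0 <= u /\ u < t0.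
    by rewrite /u le_max lexx gt_max t0p/= ltrBlDr ltrDl.
  have ud : `|u - t0| < d.
    rewrite distrC gtr0_norm ?subr_gt0//.
    have : t0 - d / 2 <= u by rewrite /u le_max lexx orbT.
    lra.
  have ur : `[- r, T]%classic u.
    by rewrite /= in_itv/= (le_trans rr0)//= (le_trans (ltW ut)).
  have := wd u ur ud; have := before u u0 ut.
  have := ler_enormB (w t0) (w u); rewrite enormB.
  have := ler_norm (enorm (w t0) - enorm (w u)); lra.
have small : enorm (w t0) <= 1 / 2.
  apply: (le_trans _ Ceta); apply: (HC _ _ _ _ _ sz sy t0 t0T) => //.
  - move=> u ru ut; rewrite (le_trans (zM u ru _)) ?lerDl//.
    exact: le_trans t0T.
  - move=> u ru ut; apply: yK => //; first exact: le_trans t0T.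
    have [u0|u0] := leP u 0; first by rewrite (le_trans (zy u ru u0))// ltW.
    move: ut; rewrite le_eqVlt => /predU1P[->//|ut].
    by rewrite ltW// before// ltW.
  - exact: le_trans t00.
have e4 : 0 < 1 / 4 :> R by rewrite divr_gt0.
have [d d0 wd] := cw' t0 t0r _ e4.
have [t [t_0 tT wt] tt0] := inf_adherent d0 hinf.
have t0t : t0 <= t by apply: ge_inf => //; exists 0.
have td : `|t - t0| < d by rewrite ger0_norm ?subr_ge0//; rewrite ltrBlDl.
have tr : `[- r, T]%classic t by rewrite /= in_itv/= tT (le_trans rr0).
have := wd t tr td; have := ler_enormB (w t) (w t0).
have := ler_norm (enorm (w t) - enorm (w t0)); lra.
Qed.

(** After time [r] the uniform distance of the initial paths suffices to control
    the Sobolev distance.  This is what makes compactness in the uniform topology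
    usable. *)
Lemma norm_segment_dist_late T K : 0 <= K -> exists2 C : R, 0 <= C &
  forall x0 y0 z y, is_solution r f x0 z -> is_solution r f y0 y ->
    (forall s, - r <= s -> s <= T -> enorm (z s) <= K) ->
    (forall s, - r <= s -> s <= T -> enorm (y s) <= K) ->
    r <= T ->
    W1p_norm r p (segment_at z T - segment_at y T) <= C * sup_norm r (x0 - y0).
Proof.
move=> K0; have [C C0' HC] := sol_dist T K0.
have rp0 : 0 <= r `^ p^-1 by exact: powR_ge0.
exists (C + C * r `^ p^-1) => [|x0 y0 z y sz sy zK yK rT].
  by rewrite addr_ge0// mulr_ge0.
have [H1 H2] := HC _ _ _ _ sz sy zK yK.
have T0 : 0 <= T by rewrite (le_trans _ rT)// ltW.
have Cd : 0 <= C * sup_norm r (x0 - y0) by rewrite mulr_ge0// sup_norm_ge0.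
rewrite mulrDl; apply: lerD.
  apply: sup_norm_le => // s; rewrite in_itv/= => /andP[rs s0].
  by apply: H1; [rewrite (le_trans rs)// lerDr|rewrite gerDl].
apply: (le_trans (derive_norm_segmentB_late r0 f0 p1 f_lip sz sy rT Cd H2)).
by rewrite mulrAC.
Qed.

(** The initial derivatives are carried along by translation; the rest of the
    segments consists of velocities, which are uniformly close by [sol_dist]. *)
Lemma norm_segment_dist T K : 0 <= K -> exists2 C : R, 0 <= C &
  forall x0 y0 z y, is_solution r f x0 z -> is_solution r f y0 y ->
    W1p r p x0 -> W1p r p y0 ->
    (forall s, - r <= s -> s <= T -> enorm (z s) <= K) ->
    (forall s, - r <= s -> s <= T -> enorm (y s) <= K) ->
    forall t, 0 <= t -> t <= T ->
    W1p_norm r p (segment_at z t - segment_at y t) <= C * W1p_norm r p (x0 - y0).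
Proof.
move=> K0; have [C C0' HC] := sol_dist T K0.
have rp0 : 0 <= r `^ p^-1 by exact: powR_ge0.
exists (C + (1 + C * r `^ p^-1)) => [|x0 y0 z y sz sy Wx Wy zK yK t t0 tT].
  by rewrite !addr_ge0// mulr_ge0.
have [H1 H2] := HC _ _ _ _ sz sy zK yK.
have Cd : 0 <= C * sup_norm r (x0 - y0) by rewrite mulr_ge0// sup_norm_ge0.
have supW := sup_le_W1p_norm r p (x0 - y0).
rewrite mulrDl; apply: lerD.
  apply: (@le_trans _ _ (C * sup_norm r (x0 - y0))); last exact: ler_wpM2l.
  apply: sup_norm_le => // s; rewrite in_itv/= => /andP[rs s0].
  apply: H1; first by rewrite (le_trans rs)// lerDr.
  by rewrite (le_trans _ tT)// gerDl.
have H2' u : u <= t -> enorm (vel z u - vel y u) <= C * sup_norm r (x0 - y0).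
  by move=> ut; apply: H2; exact: le_trans tT.
apply: (le_trans (derive_norm_segmentB r0 f0 p1 f_lip sz sy t0 Wx Wy Cd H2')).
rewrite mulrDl mul1r; apply: lerD; first exact: derive_le_W1p_norm.
by rewrite mulrAC; apply: ler_wpM2l => //; exact: mulr_ge0.
Qed.

(** The bound is linear in [k] because [f] vanishes at [0] and is Lipschitz:
    uniformly small solutions have small velocities. *)
Lemma norm_segment_le K : 0 <= K -> exists2 M : R, 0 <= M &
  forall x0 z k t, is_solution r f x0 z -> W1p r p x0 -> 0 <= k -> k <= K ->
    0 <= t -> (forall s, - r <= s -> s <= t -> enorm (z s) <= k) ->
    W1p_norm r p (segment_at z t) <= derive_norm r p x0 + M * k.
Proof.
move=> K0; have [M M0 fM] := f_bound f0 f_lip K0.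
have rp0 : 0 <= r `^ p^-1 by exact: powR_ge0.
exists (1 + M * r `^ p^-1) => [|x0 z k t sz Wx k0 kK t0 zk].
  by rewrite addr_ge0// mulr_ge0// ltW.
have Mk : 0 <= M * k by rewrite mulr_ge0// ltW.
have sp u : u <= t -> enorm (vel z u) <= M * k.
  move=> ut; rewrite /speed; case: ifPn => [u0|_]; last by rewrite enorm0.
  have zu : sup_norm r (segment_at z u) <= k.
    apply: sup_norm_segment (ltW u0) => // s rs su; apply: zk => //.
    exact: le_trans ut.
  rewrite (le_trans (fM _ (C0_sol sz (ltW u0)) (le_trans zu kK)))//.
  by rewrite ler_pM2l.
rewrite mulrDl mul1r addrCA; apply: lerD; first exact: sup_norm_segment.
by rewrite mulrAC; exact: (derive_norm_segment r0 f0 p1 f_lip sz t0 Wx Mk sp).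
Qed.

Lemma norm_segment_le_late K : 0 <= K -> exists2 M : R, 0 <= M &
  forall x0 z k t, is_solution r f x0 z -> 0 <= k -> k <= K ->
    r <= t -> (forall s, - r <= s -> s <= t -> enorm (z s) <= k) ->
    W1p_norm r p (segment_at z t) <= M * k.
Proof.
move=> K0; have [M M0 fM] := f_bound f0 f_lip K0.
have rp0 : 0 <= r `^ p^-1 by exact: powR_ge0.
exists (1 + M * r `^ p^-1) => [|x0 z k t sz k0 kK rt zk].
  by rewrite addr_ge0// mulr_ge0// ltW.
have t0 : 0 <= t by rewrite (le_trans _ rt)// ltW.
have Mk : 0 <= M * k by rewrite mulr_ge0// ltW.
have sp u : u <= t -> enorm (vel z u - vel (cst 0) u) <= M * k.
  move=> ut; rewrite /speed; case: ifPn => [u0|_]; last by rewrite subrr enorm0.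
  rewrite (_ : segment_at (cst 0) u = cst 0)// f0 subr0.
  have zu : sup_norm r (segment_at z u) <= k.
    apply: sup_norm_segment (ltW u0) => // s rs su; apply: zk => //.
    exact: le_trans ut.
  rewrite (le_trans (fM _ (C0_sol sz (ltW u0)) (le_trans zu kK)))//.
  by rewrite ler_pM2l.
rewrite mulrDl mul1r; apply: lerD; first exact: sup_norm_segment.
have := derive_norm_segmentB_late r0 f0 p1 f_lip sz sol_zero rt Mk sp.
rewrite (_ : segment_at z t - segment_at (cst 0) t = segment_at z t).
  by rewrite mulrAC.
by apply/funext => s; exact: subr0.
Qed.

Section Complete.
Hypothesis f_complete : forall x0, holder_space r (1 - p^-1) x0 -> has_sol x0.

(** Completeness is assumed on a Hoelder space, into which [W1p] embeds. *)
Lemma W1p_has_sol x0 : W1p r p x0 -> has_sol x0.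
Proof. by move=> Wx; apply: f_complete; exact: W1p_holder_space. Qed.

Lemma W1p_solP x0 : W1p r p x0 -> is_solution r f x0 (sol x0).
Proof. by move=> /W1p_has_sol/is_solution_sol. Qed.

Lemma phi_W1p x0 t : W1p r p x0 -> 0 <= t -> W1p r p (phi r f t x0).
Proof. by move=> Wx t0; exact: (W1p_segment r0 f0 p1 f_lip (W1p_solP Wx) t0 Wx). Qed.

Lemma W1p_cst0 : W1p r p (cst 0 : R -> 'rV[R]_n).
Proof.
have rr : r <= r by [].
by have := W1p_segment_late r0 f0 p1 f_lip sol_zero rr.
Qed.

Lemma W1p_norm0 : W1p_norm r p (cst 0 : R -> 'rV[R]_n) = 0.
Proof.
have Mge0 : 0 <= (0 : R) by [].
have [M M0 HM] := norm_segment_le_late Mge0.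
have := HM _ _ 0 r sol_zero (lexx 0) (lexx 0) (lexx r).
rewrite mulr0 => H; apply/eqP; rewrite eq_le W1p_norm_ge0 andbT.
by apply: H => s _ _; rewrite enorm0.
Qed.

Lemma W1p_norm_phiD x0 t s : W1p r p x0 -> 0 <= t -> 0 <= s ->
  W1p_norm r p (phi r f s (phi r f t x0)) = W1p_norm r p (phi r f (t + s) x0).
Proof.
by move=> Wx t0 s0; apply: eq_W1p_norm; exact: phiD (W1p_has_sol Wx).
Qed.

Lemma W1p_norm_phi0 x0 : W1p r p x0 ->
  W1p_norm r p (phi r f 0 x0) = W1p_norm r p x0.
Proof. by move=> Wx; apply: eq_W1p_norm; exact: phi0 (W1p_has_sol Wx). Qed.

Lemma enorm_sol_le x0 t : W1p r p x0 -> 0 <= t ->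
  enorm (sol x0 t) <= W1p_norm r p (phi r f t x0).
Proof.
move=> Wx t0; rewrite (le_trans (enorm_le_segment r0 (W1p_solP Wx) t0))//.
exact: sup_le_W1p_norm.
Qed.

Lemma enorm_init_le x0 s : W1p r p x0 -> - r <= s -> s <= 0 ->
  enorm (sol x0 s) <= W1p_norm r p x0.
Proof.
move=> Wx rs s0; have sr : s \in `[- r, 0] by rewrite in_itv/= rs.
rewrite (sol_init (W1p_solP Wx) sr) (le_trans _ (sup_le_W1p_norm r p x0))//.
exact: (le_sup_norm (W1p_C0 Wx) sr).
Qed.

End Complete.
End Flow.

(** * Compactness of Hoelder balls *)

Section Compactness.
Context {R : realType} {n : nat}.
Implicit Types (x y : R -> 'rV[R]_n) (r B C a s t : R).

(** Equi-Hoelder paths with a common bound; the value off [[- r, 0]] is fixed so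
    that these paths form a compact set of total functions. *)
Definition holder_ball r a B C : set (R -> 'rV[R]_n) :=
  [set x | [/\ forall s, enorm (x s) <= B,
     forall s t, s \in `[- r, 0] -> t \in `[- r, 0] ->
       enorm (x t - x s) <= C * `|t - s| `^ a &
     forall s, s \notin `[- r, 0] -> x s = 0]].

Lemma near_ptws (x : {ptws R -> 'rV[R]_n}) s (e : R) : 0 < e ->
  \forall y \near x, enorm (y s - x s) < e.
Proof.
move=> e0; have d0 : 0 < e / (n%:R + 1) by rewrite divr_gt0// ltr_wpDl.
have H : nbhs x [set y : {ptws R -> 'rV[R]_n} | ball (x s) (e / (n%:R + 1)) (y s)].
  by apply: (@proj_continuous R (fun=> 'rV[R]_n) s x); exact: nbhsx_ballx.
apply: filterS H => y /=; rewrite -ball_normE /=.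
rewrite ltr_pdivlMr ?ltr_wpDl// => vw.
rewrite enormB (le_lt_trans (enorm_le_mxnorm _))//.
by apply: le_lt_trans vw; rewrite mulrC ler_wpM2l// lerDl.
Qed.

(** On equi-Hoelder paths pointwise closeness on a fine grid gives uniform
    closeness, so the uniform neighbourhoods of the hypothesis are neighbourhoods
    in the compact topology of pointwise convergence. *)
Lemma holder_ball_uniform r a B C (P : nat -> (R -> 'rV[R]_n) -> Prop) :
  0 < r -> 0 < a -> 0 <= C ->
  (forall k l y, (k <= l)%N -> P k y -> P l y) ->
  (forall x, holder_ball r a B C x -> exists eta (k : nat), [/\ 0 < eta &
     forall y, holder_ball r a B C y ->
       (forall s, s \in `[- r, 0] -> enorm (y s - x s) <= eta) -> P k y]) ->
  exists k, forall y, holder_ball r a B C y -> P k y.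
Proof.
move=> r0 a0 C0 Pmono Ploc.
pose K : set {ptws R -> 'rV[R]_n} := [set x | forall s, enorm (x s) <= B].
have cK : compact K.
  apply: (@tychonoff R (fun=> 'rV[R]_n) (fun=> [set v | enorm v <= B])) => _.
  apply: bounded_closed_compact.
    exists B; split; first exact: num_real.
    move=> M BM v /= vB; rewrite (le_trans (mxnorm_le_enorm v))//.
    by rewrite (le_trans vB)// ltW.
  apply: (@closed_comp _ _ (enorm : 'rV[R]_n -> R) [set u | u <= B]).
    by move=> v _; exact: enorm_continuous.
  exact: closed_le.
have /compact_near_coveringP cov := cK.
have := cov nat \oo (fun k y => holder_ball r a B C y -> P k y) _.
case; last first.
  move=> N _ NP; exists N => y By; apply: (NP N) => //=.
  by case: By.
move=> x Kx; have [Bx|nBx] := pselect (holder_ball r a B C x).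
  have [eta [k [eta0 Pk]]] := Ploc x Bx.
  have e3 : 0 < eta / 3 by rewrite divr_gt0.
  pose d : R := (eta / (3 * (C + 1))) `^ a^-1.
  have q0 : 0 < eta / (3 * (C + 1)) by rewrite divr_gt0// mulr_gt0// ltr_wpDl.
  have d0 : 0 < d by rewrite powR_gt0.
  have Cd s t : `|t - s| <= d -> C * `|t - s| `^ a <= eta / 3.
    move=> ts; have : `|t - s| `^ a <= eta / (3 * (C + 1)).
      have -> : eta / (3 * (C + 1)) = d `^ a.
        by rewrite /d -powRrM mulVf ?gt_eqF// powRr1// ltW.
      by rewrite ge0_ler_powR ?nnegrE ?(ltW a0)// ltW.
    move=> /(ler_wpM2l C0) /le_trans; apply.
    rewrite [leLHS](_ : _ = (eta / 3) * (C / (C + 1))); last first.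
      by field; rewrite gt_eqF// ltr_wpDl.
    rewrite ler_piMr ?(ltW e3)// ler_pdivrMr ?ltr_wpDl// mul1r lerDl//.
  pose N := (Num.truncn (r / d)).+1.
  pose g (j : 'I_N) : R := - r + j%:R * d.
  have near_g : nbhs x [set y : {ptws R -> 'rV[R]_n} |
      forall j, enorm (y (g j) - x (g j)) < eta / 3].
    apply: (@filter_forall _ _ (fun j => [set y : {ptws R -> 'rV[R]_n} |
      enorm (y (g j) - x (g j)) < eta / 3]) (nbhs x)).
    by move=> j; exact: near_ptws.
  exists ([set y | forall j, enorm (y (g j) - x (g j)) < eta / 3], [set l | (k <= l)%N]).
    by split=> //; exists k.
  case=> y l /= [yx kl] By; apply: (Pmono k l y kl); apply: Pk => // s sr.
  have [rs s0] : - r <= s /\ s <= 0 by move: sr; rewrite in_itv/= => /andP.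
  have q1 : 0 <= (s + r) / d by rewrite divr_ge0 ?(ltW d0)//; lra.
  have /andP[lo hi] := truncn_itv q1.
  set m := Num.truncn _ in lo hi.
  have mN : (m < N)%N.
    rewrite ltnS truncn_ge_nat; last by rewrite divr_ge0// ltW.
    apply: (le_trans lo); rewrite ler_pM2r ?invr_gt0//; lra.
  pose j := Ordinal mN; have gj : g j = - r + m%:R * d by [].
  have gs : g j <= s.
    move: lo; rewrite ler_pdivlMr// gj => lo; lra.
  have sg : s - g j <= d.
    move: hi; rewrite ltr_pdivrMr// gj -natr1 mulrDl mul1r => hi; lra.
  have gr : g j \in `[- r, 0].
    rewrite in_itv/= (le_trans gs s0) andbT gj lerDl mulr_ge0// ltW//.
  have sgd : `|s - g j| <= d by rewrite ger0_norm// subr_ge0.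
  have gsd : `|g j - s| <= d by rewrite distrC.
  have [_ Hy _] := By; have [_ Hx _] := Bx.
  have h1 := le_trans (Hy _ _ gr sr) (Cd _ _ sgd).
  have h2 := le_trans (Hx _ _ sr gr) (Cd _ _ gsd).
  have h3 := yx j.
  rewrite (le_trans (enorm_distD (y (g j)) _ _))//.
  have := enorm_distD (x (g j)) (y (g j)) (x s); lra.
suff [U xU nU] : exists2 U : set {ptws R -> 'rV[R]_n}, nbhs (x : {ptws R -> 'rV[R]_n}) U &
    forall y, U y -> ~ holder_ball r a B C y.
  exists (U, setT); first by split=> //; exact: filterT.
  by case=> y k /= [/nU].
have [off|noff] := pselect (forall s, s \notin `[- r, 0] -> x s = 0); last first.
  have /existsNP[s /not_implyP[sr xs0]] := noff.
  have e0 : 0 < enorm (x s).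
    by rewrite lt_def enorm_ge0 andbT; apply/eqP => /enorm_eq0.
  exists [set y | enorm (y s - x s) < enorm (x s)]; first exact: near_ptws.
  by move=> y /= + [_ _ /(_ s sr) ys]; rewrite ys sub0r enormN ltxx.
have /existsNP[s /existsNP[t /not_implyP[sr /not_implyP[tr /negP]]]] :
    ~ (forall s t, s \in `[- r, 0] -> t \in `[- r, 0] ->
       enorm (x t - x s) <= C * `|t - s| `^ a).
  by move=> H; apply: nBx.
rewrite -ltNge => xst.
set e := enorm (x t - x s) - C * `|t - s| `^ a.
have e2 : 0 < e / 2 by rewrite divr_gt0// subr_gt0.
exists ([set y : {ptws R -> 'rV[R]_n} | enorm (y s - x s) < e / 2] `&`
        [set y : {ptws R -> 'rV[R]_n} | enorm (y t - x t) < e / 2]).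
  by apply: filterI; exact: near_ptws.
move=> y /= [ys yt] [_ /(_ s t sr tr) yst _].
have h1 := enorm_distD (y t) (x t) (x s).
have h2 := enorm_distD (y s) (y t) (x s).
have h3 := enormB (x t) (y t).
rewrite /e in ys yt; lra.
Qed.

End Compactness.

Lemma le_of_dist_half (R : realType) (a b d : R) :
  `|a - b| <= d / 2 -> b < d / 2 -> a <= d.
Proof. by move=> ab bd; have := le_trans (ler_norm _) ab; lra. Qed.

(** * Attractivity is uniform on bounded sets *)

Section UniformAttractivity.
Context {R : realType} {n : nat}.
Variables (r : R) (f : (R -> 'rV[R]_n) -> 'rV[R]_n) (p : R).
Hypotheses (r0 : 0 < r) (f0 : f (cst 0) = 0) (p1 : 1 < p).
Hypothesis f_lip : lipschitz_on_bounded_C0 r f.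
Hypothesis f_complete : forall x0, holder_space r (1 - p^-1) x0 ->
  exists x, is_solution r f x0 x.
Implicit Types (x y z : R -> 'rV[R]_n) (s t u T K d : R).
Local Notation sol := (sol r f).
Local Notation phi := (phi r f).
Local Notation Wnorm := (W1p_norm r p).

Lemma LS_XP : LS_X r f p -> forall e : R, 0 < e -> exists2 d : R, 0 < d &
  forall t x, 0 <= t -> W1p r p x -> Wnorm x <= d -> Wnorm (phi t x) <= e.
Proof.
move=> LS e /LS[d d0 de]; exists d => // t x t0 Wx xd.
rewrite -lee_fin; apply: le_trans de; apply: ereal_sup_ubound.
by exists t, x.
Qed.

Lemma phi_late_W1p x0 t : (exists z, is_solution r f x0 z) -> r <= t ->
  W1p r p (phi t x0).
Proof.
move=> /is_solution_sol sx rt; exact: (W1p_segment_late r0 f0 p1 f_lip sx rt).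
Qed.

Lemma Wnorm_phiD x0 t s : (exists z, is_solution r f x0 z) -> 0 <= t -> 0 <= s ->
  Wnorm (phi s (phi t x0)) = Wnorm (phi (t + s) x0).
Proof.
by move=> ex t0 s0; apply: eq_W1p_norm => u; exact: (phiD r0 f_lip t0 s0 ex).
Qed.

Lemma holder_ball_sol B C x : holder_ball r (1 - p^-1) B C x ->
  holder_space r (1 - p^-1) x.
Proof.
move=> [xB xC x0]; have a0 : 0 < 1 - p^-1 by rewrite subr_gt0 invf_lt1// (lt_trans ltr01).
split.
  apply/within_continuousP => s sr e e0.
  pose C' := `|C| + 1.
  have C'0 : 0 < C' by rewrite ltr_wpDl.
  have q0 : 0 < e / C' by rewrite divr_gt0.
  exists ((e / C') `^ (1 - p^-1)^-1); first by rewrite powR_gt0.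
  move=> u ur us; apply: le_lt_trans (xC _ _ sr ur) _.
  apply: (@le_lt_trans _ _ (C' * `|u - s| `^ (1 - p^-1))).
    apply: ler_wpM2r; first exact: powR_ge0.
    by rewrite (le_trans (ler_norm _))// lerDl.
  rewrite mulrC -ltr_pdivlMr//.
  have -> : e / C' = ((e / C') `^ (1 - p^-1)^-1) `^ (1 - p^-1).
    by rewrite -powRrM mulVf ?gt_eqF// powRr1// ltW.
  by rewrite gt0_ltr_powR// nnegrE// powR_ge0.
exists C => _ [t [s [tr sr ts ->]]].
by rewrite ler_pdivrMr ?powR_gt0 ?normr_gt0 ?subr_eq0//; exact: xC.
Qed.

(** A compactness argument: near each point of a compact set of initial paths
    the trajectories enter, at a common time, the ball from which local
    stability takes over. *)
Lemma holder_ball_attractivity B C (e : R) : 0 <= C -> 0 < e -> GAS_X r f p ->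
  exists k : nat, forall y, holder_ball r (1 - p^-1) B C y ->
    (forall t, k%:R <= t -> Wnorm (phi t y) <= e) /\
    (forall t, 0 <= t -> enorm (sol y t) <= k%:R).
Proof.
move=> C0 e0 [LS GA].
have a0 : 0 < 1 - p^-1 by rewrite subr_gt0 invf_lt1// (lt_trans ltr01).
have [d d0 LSd] := LS_XP LS e0.
apply: (holder_ball_uniform r0 a0 C0) => [k l y kl [H1 H2]|x Bx].
  split=> [t lt|t t0]; first by apply: H1; rewrite (le_trans _ lt)// ler_nat.
  by rewrite (le_trans (H2 t t0))// ler_nat.
have ex := f_complete (holder_ball_sol Bx); have sx := is_solution_sol ex.
have rr : r <= r by []; have ler0 := ltW r0.
have W1 := phi_late_W1p ex rr.
have d20 : 0 < d / 2 by rewrite divr_gt0.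
(* Attractivity is applied to the segment at time r, the first one that is
   guaranteed to be a Sobolev path. *)
have [T1 xT1] : exists T1, forall t, T1 <= t -> Wnorm (phi t (phi r x)) < d / 2.
  have /cvgrPdist_lt/(_ _ d20) := GA _ W1.
  case=> M [_ HM]; exists (M + 1) => t tM.
  have := HM t; rewrite sub0r normrN ger0_norm ?W1p_norm_ge0//; apply.
  by rewrite (lt_le_trans _ tM)// ltrDl.
pose T := r + Num.max T1 0.
have T10 : 0 <= Num.max T1 0 by rewrite le_max lexx orbT.
have rT : r <= T by rewrite lerDl.
have T0 : 0 <= T by exact: le_trans rT.
have xT : Wnorm (phi T x) < d / 2.
  by rewrite -(Wnorm_phiD ex ler0 T10); apply: xT1; rewrite le_max lexx.
have [K [eta [K0 eta0 zK close]]] := sol_stay_close r0 f_lip sx T0.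
have [L L0 HL] := norm_segment_dist_late r0 f0 p1 f_lip T K0.
have L1 : 0 < 2 * (L + 1) by rewrite mulr_gt0// ltr_wpDl.
(* Below eta the solutions stay bounded, below the second term their segments at
   time T are d / 2 apart. *)
pose eta' := Num.min eta (d / (2 * (L + 1))).
pose k := (Num.truncn (Num.max T (Num.max K e))).+1.
have kmax : Num.max T (Num.max K e) < k%:R by rewrite truncnS_gt.
have [kT kK ke] : [/\ T <= k%:R, K <= k%:R & e <= k%:R].
  by move: kmax; rewrite !gt_max => /andP[/ltW ? /andP[/ltW ? /ltW ?]].
exists eta', k; split; first by rewrite lt_min eta0 divr_gt0.
move=> y By yx; have ey := f_complete (holder_ball_sol By).
have sy := is_solution_sol ey.
have r00 : - r <= 0 by rewrite oppr_le0.
have yK s : - r <= s -> s <= T -> enorm (sol y s) <= K.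
  apply: (close _ _ sy) => {}s rs s0.
  have sr : s \in `[- r, 0] by rewrite in_itv/= rs.
  rewrite (sol_init sx sr) (sol_init sy sr) enormB (le_trans (yx s sr))//.
  by rewrite ge_min lexx.
have supyx : sup_norm r (y - x) <= eta'.
  apply: sup_norm_le => // ; by rewrite le_min (ltW eta0) divr_ge0// ltW.
have dist : Wnorm (phi T y - phi T x) <= d / 2.
  apply: (le_trans (HL _ _ _ _ sy sx yK zK rT)).
  apply: (le_trans (ler_wpM2l L0 supyx)).
  apply: (@le_trans _ _ (L * (d / (2 * (L + 1))))).
    by apply: ler_wpM2l => //; rewrite ge_min lexx orbT.
  have -> : L * (d / (2 * (L + 1))) = d / 2 * (L / (L + 1)).
    by field; rewrite gt_eqF// ltr_wpDl.
  by rewrite ler_piMr ?(ltW d20)// ler_pdivrMr ?ltr_wpDl// mul1r lerDl.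
have Wy := phi_late_W1p ey rT; have WX := phi_late_W1p ex rT.
have yT : Wnorm (phi T y) <= d.
  exact: le_of_dist_half (le_trans (W1p_norm_dist r0 p1 Wy WX) dist) xT.
have late t : T <= t -> Wnorm (phi t y) <= e.
  move=> Tt; have tT0 : 0 <= t - T by rewrite subr_ge0.
  have -> : phi t y = phi (T + (t - T)) y by rewrite addrC subrK.
  by rewrite -(Wnorm_phiD ey T0 tT0); exact: LSd.
split=> [t kt|t t0]; first by apply: late; exact: le_trans kt.
have [tT|Tt] := leP t T.
  by rewrite (le_trans (yK t _ tT))// (le_trans r00).
rewrite (le_trans _ ke)// (le_trans _ (late t (ltW Tt)))//.
rewrite (le_trans (enorm_le_segment r0 sy t0))//; exact: sup_le_W1p_norm.
Qed.

Lemma W1p_cut_holder_ball x (D : R) : W1p r p x -> Wnorm x <= D ->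
  exists y, {in `[- r, 0], x =1 y} /\
    holder_ball r (1 - p^-1) D (n%:R * D) y.
Proof.
move=> Wx xD; exists (fun s => if s \in `[- r, 0] then x s else 0).
have D0 : 0 <= D by rewrite (le_trans _ xD)// W1p_norm_ge0.
split; first by move=> s ->.
split=> [s|s t sr tr|s /negPf ->//].
  case: ifPn => [sr|_]; last by rewrite enorm0.
  rewrite (le_trans (le_sup_norm (W1p_C0 Wx) sr))//.
  exact: le_trans (sup_le_W1p_norm _ _ _) xD.
rewrite sr tr (le_trans (W1p_hoelder r0 p1 Wx sr tr))//.
apply: ler_wpM2r; first exact: powR_ge0.
by apply: ler_wpM2l => //; exact: le_trans (derive_le_W1p_norm _ _ _) xD.
Qed.

(** A ball of the Sobolev space is contained, up to values off [[- r, 0]], in a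
    compact Hoelder ball. *)
Lemma uniform_attractivity (D e : R) : 0 <= D -> 0 < e -> GAS_X r f p ->
  exists (T B : R), forall x, W1p r p x -> Wnorm x <= D ->
    (forall t, T <= t -> Wnorm (phi t x) <= e) /\
    (forall t, 0 <= t -> Wnorm (phi t x) <= B).
Proof.
move=> D0 e0 GAS.
have nD : 0 <= n%:R * D by rewrite mulr_ge0.
have [k Hk] := holder_ball_attractivity D nD e0 GAS.
pose K := Num.max D k%:R; have K0 : 0 <= K by rewrite le_max D0.
have [M M0 HM] := norm_segment_le r0 f0 p1 f_lip K0.
exists k%:R, (D + M * K) => x Wx xD.
have [y [xy By]] := W1p_cut_holder_ball Wx xD.
have [H1 H2] := Hk y By.
have E t : phi t x = phi t y by exact: eq_phi.
have Es : sol x = sol y by rewrite /sol (eq_solution_set _ xy).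
split=> [t kt|t t0]; first by rewrite E; exact: H1.
have sx := W1p_solP r0 p1 f_complete Wx.
apply: le_trans (HM _ _ _ _ sx Wx K0 (lexx K) t0 _) _.
  move=> s rs st; have [s0|s0] := leP s 0.
    rewrite (le_trans (enorm_init_le r0 p1 f_complete Wx rs s0))//.
    by rewrite le_max xD.
  by rewrite Es le_max H2 ?orbT// ltW.
rewrite lerD2r; exact: le_trans (derive_le_W1p_norm _ _ _) xD.
Qed.

End UniformAttractivity.

(** * Majorants by comparison functions *)

Section ComparisonFunctions.
Context {R : realType}.
Implicit Types (b B rho : R -> R) (s t u v : R).

Lemma within_continuous_realP (A : set R) rho :
  (forall s, A s -> forall e : R, 0 < e -> exists2 d : R, 0 < d &
    forall u, A u -> `|u - s| < d -> `|rho u - rho s| < e) ->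
  {within A, continuous rho}.
Proof.
move=> H; apply/subspace_continuousP => s As; apply/cvgrPdist_lt => e e0.
have [d d0 dA] := H s As e e0.
apply/nbhs_ballP; exists d => //= u; rewrite /ball/= distrC => us Au.
by rewrite distrC dA.
Qed.

Definition cutoff v := Num.max 0 (Num.min 1 (2 - v)).

Lemma cutoff_ge0 v : 0 <= cutoff v.
Proof. by rewrite le_max lexx. Qed.

Lemma cutoff_le1 v : cutoff v <= 1.
Proof. by rewrite ge_max ler01 ge_min lexx. Qed.

Lemma cutoff1 : cutoff 1 = 1.
Proof.
rewrite /cutoff (_ : 2 - 1 = 1 :> R); last by ring.
by rewrite minxx; apply/max_idPr.
Qed.

Lemma cutoff_out v : 2 <= v -> cutoff v = 0.
Proof. by move=> v2; apply/max_idPl; rewrite ge_min subr_le0 v2 orbT. Qed.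

Lemma cutoff_nonincr u v : u <= v -> cutoff v <= cutoff u.
Proof.
move=> uv; rewrite /cutoff !maxEle !minEle.
by do !case: ifPn; rewrite -?ltNge => *; lra.
Qed.

Lemma cutoff_lip u v : u <= v -> cutoff u <= cutoff v + (v - u).
Proof.
move=> uv; rewrite /cutoff !maxEle !minEle.
by do !case: ifPn; rewrite -?ltNge => *; lra.
Qed.

(** A nondecreasing function may jump, while comparison functions are continuous.
    Weighting the supremum of [b] by a Lipschitz cut-off that is [1] on [[0, s]]
    and [0] from [2 s] on yields a continuous function between [b s] and
    [b (2 s)]. *)
Definition majorant b s : R :=
  if s <= 0 then 0 else sup [set b u * cutoff (u / s) | u in [set u | 0 <= u]].

Definition nondecr_ge0 b :=
  (forall s, 0 <= s -> 0 <= b s) /\ (forall s t, 0 <= s -> s <= t -> b s <= b t).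

Section Majorant.
Variable b : R -> R.
Hypothesis bnd : nondecr_ge0 b.
Let b0 : forall s, 0 <= s -> 0 <= b s. Proof. by case: bnd. Qed.
Let b_nd : forall s t, 0 <= s -> s <= t -> b s <= b t.
Proof. by case: bnd. Qed.

Lemma majorant_term_le s u : 0 < s -> 0 <= u -> b u * cutoff (u / s) <= b (2 * s).
Proof.
move=> s0 u0; have s2 : 0 <= 2 * s by rewrite mulr_ge0// ltW.
have [us|us] := leP u (2 * s).
  apply: (@le_trans _ _ (b u)); last exact: b_nd.
  by rewrite ler_piMr ?b0// cutoff_le1.
by rewrite cutoff_out ?mulr0 ?b0// ler_pdivlMr// ltW.
Qed.

Lemma majorant_has_sup s : 0 < s ->
  has_sup [set b u * cutoff (u / s) | u in [set u | 0 <= u]].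
Proof.
move=> s0; split; first by exists (b 0 * cutoff (0 / s)); exists 0; rewrite /= ?lexx.
by exists (b (2 * s)) => _ [u u0 <-]; exact: majorant_term_le.
Qed.

Lemma le_majorant_term s u : 0 < s -> 0 <= u ->
  b u * cutoff (u / s) <= majorant b s.
Proof.
move=> s0 u0; rewrite /majorant (lt_geF s0); apply: ub_le_sup; last by exists u.
by case: (majorant_has_sup s0).
Qed.

Lemma majorant_le s M : 0 < s ->
  (forall u, 0 <= u -> b u * cutoff (u / s) <= M) -> majorant b s <= M.
Proof.
move=> s0 H; rewrite /majorant (lt_geF s0); apply: ge_sup.
  by case: (majorant_has_sup s0).
by move=> _ [u u0 <-]; exact: H.
Qed.

Lemma le_majorant s : 0 < s -> b s <= majorant b s.
Proof.
move=> s0; have := le_majorant_term s0 (ltW s0).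
by rewrite divff ?gt_eqF// cutoff1 mulr1.
Qed.

Lemma majorant_le2 s : 0 < s -> majorant b s <= b (2 * s).
Proof. by move=> s0; apply: majorant_le => // u; exact: majorant_term_le. Qed.

Lemma majorant_nondecr s t : s <= t -> majorant b s <= majorant b t.
Proof.
move=> st; have [s0|s0] := leP s 0.
  rewrite {1}/majorant s0; have [t0|t0] := leP t 0; first by rewrite /majorant t0.
  by rewrite (le_trans _ (le_majorant t0))// b0// ltW.
have t0 := lt_le_trans s0 st.
apply: majorant_le => // u u0; apply: le_trans (le_majorant_term t0 u0).
by rewrite ler_wpM2l ?b0// cutoff_nonincr// ler_wpM2l// lef_pV2 ?posrE.
Qed.

(** Only the terms with [u <= 2 t] count, and for these the cut-off changes by at
    most [u / s - u / t]. *)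
Lemma majorant_incr s t : 0 < s -> s <= t ->
  majorant b t <= majorant b s + b (2 * t) * (2 * (t - s) / s).
Proof.
move=> s0 st; have t0 := lt_le_trans s0 st.
have t2 : 0 <= 2 * t by rewrite mulr_ge0// ltW.
have m0 : 0 <= majorant b s by rewrite (le_trans _ (le_majorant s0))// b0// ltW.
have bt0 : 0 <= b (2 * t) * (2 * (t - s) / s).
  by rewrite mulr_ge0 ?b0// mulr_ge0 ?mulr_ge0 ?subr_ge0// invr_ge0 ltW.
apply: majorant_le => // u u0.
have [ut|ut] := leP u (2 * t); last first.
  by rewrite cutoff_out ?mulr0 ?addr_ge0// ler_pdivlMr// ltW.
have uts : u / t <= u / s by rewrite ler_wpM2l// lef_pV2 ?posrE.
apply: (@le_trans _ _ (b u * cutoff (u / s) + b u * (u / s - u / t))).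
  by rewrite -mulrDr ler_wpM2l ?b0// cutoff_lip.
apply: lerD; first exact: le_majorant_term.
have uE : u / s - u / t = u * (t - s) / (s * t).
  by field; rewrite !gt_eqF.
apply: ler_pM; rewrite ?b0 ?subr_ge0 ?b_nd//.
rewrite uE; rewrite ler_pdivrMr ?mulr_gt0//.
have -> : 2 * (t - s) / s * (s * t) = 2 * t * (t - s) by field; rewrite gt_eqF.
by rewrite ler_wpM2r// subr_ge0.
Qed.

Hypothesis b_small : forall e : R, 0 < e -> exists2 d : R, 0 < d & b d <= e.

Lemma majorant_continuous : {within `[0, +oo[, continuous (majorant b)}.
Proof.
apply: within_continuous_realP => s; rewrite /= in_itv/= andbT => s0 e e0.
have m0 u : 0 <= majorant b u.
  have := @majorant_nondecr (Num.min u 0) u; rewrite ge_min lexx => /(_ isT).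
  by rewrite {1}/majorant ge_min lexx orbT.
move: s0; rewrite le_eqVlt => /predU1P[<-|s0].
  have e20 : 0 < e / 2 by rewrite divr_gt0.
  have [d d0 bd] := b_small e20.
  have d20 : 0 < d / 2 by rewrite divr_gt0.
  exists (d / 2) => // u; rewrite /= in_itv/= andbT subr0 => u0.
  rewrite ger0_norm// => ud.
  have -> : majorant b 0 = 0 by rewrite /majorant lexx.
  rewrite subr0 ger0_norm//; apply: (@le_lt_trans _ _ (e / 2)); last by lra.
  apply: le_trans bd; move: u0; rewrite le_eqVlt => /predU1P[<-|u0].
    by rewrite /majorant lexx b0// ltW.
  apply: (le_trans (majorant_le2 u0)); apply: b_nd; last by lra.
  by rewrite mulr_ge0// ltW.
pose L := b (4 * s) + 1.
have L0 : 0 < L by rewrite ltr_wpDl// b0// mulr_ge0// ltW.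
have eL : 0 < e * s / (4 * L) by rewrite divr_gt0 ?mulr_gt0.
have s20 : 0 < s / 2 by rewrite divr_gt0.
exists (Num.min (s / 2) (e * s / (4 * L))) => [|u _].
  by rewrite lt_min s20.
rewrite lt_min => /andP[us1 us2].
have [u0 u2] : 0 < u /\ u <= 2 * s.
  by move: us1; rewrite ltr_norml => /andP[? ?]; split; lra.
have u_half : s / 2 <= u by move: us1; rewrite ltr_norml => /andP[? ?]; lra.
have bound v w : 0 < v -> s / 2 <= v -> v <= w -> w <= 2 * s ->
    w - v < e * s / (4 * L) -> majorant b w - majorant b v < e.
  move=> v0 sv vw ws wv; rewrite ltrBlDl.
  apply: (le_lt_trans (majorant_incr v0 vw)); rewrite ltrD2l.
  apply: (@le_lt_trans _ _ (L * (2 * (w - v) / v))).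
    rewrite ler_wpM2r//; first by rewrite mulr_ge0 ?mulr_ge0 ?subr_ge0// invr_ge0 ltW.
    rewrite (_ : L = b (4 * s) + 1)// (le_trans (b_nd _ _ : b (2 * w) <= b (4 * s))) ?lerDl//.
      by rewrite mulr_ge0// (le_trans (ltW v0)).
    by lra.
  move: wv; rewrite ltr_pdivlMr ?mulr_gt0// => wv.
  rewrite mulrA ltr_pdivrMr//.
  have : e * s / 2 <= e * v by rewrite -mulrA ler_pM2l.
  lra.
have [vu|uv] := leP s u.
  rewrite ger0_norm ?subr_ge0 ?majorant_nondecr//; apply: bound => //; first by lra.
  by rewrite (le_lt_trans (ler_norm _)).
rewrite distrC ger0_norm ?subr_ge0 ?majorant_nondecr ?(ltW uv)//.
apply: bound => //; [exact: ltW|lra|].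
by rewrite (le_lt_trans (ler_norm _))// distrC.
Qed.

Lemma majorant_class_K (c : R) : 0 < c -> class_K (fun s => majorant b s + c * s).
Proof.
move=> c0; split.
- move=> t; apply: (cvgD (@majorant_continuous t)).
  have : {within `[0, +oo[, continuous (fun s : R => c * s)}.
    by apply: continuous_subspaceT => s; exact: mulrl_continuous.
  by move=> /(_ t).
- move=> s t s0 st; apply: ler_ltD; first exact/majorant_nondecr/ltW.
  by rewrite ltr_pM2l.
- by rewrite /majorant lexx mulr0 addr0.
Qed.

Lemma majorant_class_Kinfty (c : R) : 0 < c ->
  class_Kinfty (fun s => majorant b s + c * s).
Proof.
move=> c0; split; first exact: majorant_class_K.
apply/cvgryPge => A; near=> s.
have s0 : 0 < s by near: s; exact: nbhs_pinfty_gt.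
have m0 : 0 <= majorant b s.
  by apply: le_trans (le_majorant s0); rewrite b0// ltW.
rewrite (@le_trans _ _ (c * s))// ?lerDr//.
rewrite mulrC -ler_pdivrMr//; near: s.
Unshelve. all: by end_near. Qed.

End Majorant.

Lemma le_majorant_fun b B s : nondecr_ge0 b -> nondecr_ge0 B ->
  (forall u, 0 <= u -> b u <= B u) -> majorant b s <= majorant B s.
Proof.
move=> bn Bn bB; have [s0|s0] := leP s 0; first by rewrite /majorant s0.
apply: (majorant_le bn s0) => u u0; apply: le_trans (le_majorant_term Bn s0 u0).
by rewrite ler_wpM2r ?cutoff_ge0// bB.
Qed.

(** Replacing each [beta _ t] by its majorant, plus a vanishing strictly
    increasing term, turns an attractivity modulus into a comparison function. *)
Lemma class_KL_majorant (beta : R -> R -> R) :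
  (forall t, 0 <= t -> nondecr_ge0 (beta ^~ t)) ->
  (forall s t u, 0 <= s -> 0 <= t -> t <= u -> beta s u <= beta s t) ->
  (forall s e : R, 0 <= s -> 0 < e -> exists T, 0 <= T /\ beta s T <= e) ->
  (forall e : R, 0 < e -> exists2 d : R, 0 < d & beta d 0 <= e) ->
  exists2 sigma, class_KL sigma &
    forall s t, 0 < s -> 0 <= t -> beta s t <= sigma s t.
Proof.
move=> bnd banti bT bsmall.
pose sigma s t := majorant (beta ^~ t) s + (1 + t)^-1 * s.
have t1 t : 0 <= t -> 0 < 1 + t by move=> t0; rewrite ltr_wpDr.
exists sigma; last first.
  move=> s t s0 t0; apply: (le_trans (le_majorant (bnd _ t0) s0)).
  by rewrite lerDl mulr_ge0 ?invr_ge0 ?(ltW (t1 _ t0)) ?(ltW s0).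
split=> [t t0|s s0].
  apply: (majorant_class_K (bnd _ t0)); last by rewrite invr_gt0 t1.
  move=> e /bsmall[d d0 bd]; exists d => //; apply: le_trans bd.
  by apply: banti => //; exact: ltW.
have anti t u : 0 <= t -> t <= u -> sigma s u <= sigma s t.
  move=> t0 tu; have u0 := le_trans t0 tu; apply: lerD.
    by apply: (le_majorant_fun _ (bnd _ u0) (bnd _ t0)) => v v0; exact: banti.
  by rewrite ler_wpM2r// lef_pV2 ?posrE ?t1// lerD2l.
split=> //.
have sig0 t : 0 <= t -> 0 <= sigma s t.
  move=> t0; apply: addr_ge0; last by rewrite mulr_ge0// invr_ge0 ltW ?t1.
  have := majorant_nondecr (bnd _ t0) s0.
  by rewrite {1}/majorant lexx.
apply/cvgrPdist_le => e e0.
have e20 : 0 < e / 2 by rewrite divr_gt0.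
have s20 : 0 <= 2 * s by rewrite mulr_ge0.
have [T [T0 sT]] := bT _ _ s20 e20.
pose T' := Num.max T (s / (e / 2)).
have T'0 : 0 <= T' by rewrite le_max T0.
exists T'; split; first exact: num_real.
move=> t Tt; have t0 : 0 <= t by rewrite (le_trans T'0)// ltW.
rewrite sub0r normrN ger0_norm ?sig0//.
rewrite (le_trans (anti _ _ T'0 (ltW Tt)))//.
rewrite [e](_ : _ = e / 2 + e / 2); last by field.
apply: lerD.
  move: (s0); rewrite le_eqVlt => /predU1P[<-|s_gt0].
    by rewrite /majorant lexx ltW.
  apply: (le_trans (majorant_le2 (bnd _ T'0) s_gt0)); apply: le_trans sT.
  by apply: banti => //; rewrite le_max lexx.
rewrite mulrC ler_pdivrMr ?t1// mulrDr mulr1.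
have : s / (e / 2) <= T' by rewrite le_max lexx orbT.
by rewrite ler_pdivrMr// mulrC => /le_trans; apply; rewrite lerDr ltW.
Qed.

End ComparisonFunctions.

(** * From asymptotic stability to a uniform decay rate *)

Section UniformStability.
Context {R : realType} {n : nat}.
Variables (r : R) (f : (R -> 'rV[R]_n) -> 'rV[R]_n) (p : R).
Hypotheses (r0 : 0 < r) (f0 : f (cst 0) = 0) (p1 : 1 < p).
Hypothesis f_lip : lipschitz_on_bounded_C0 r f.
Hypothesis f_complete : forall x0, holder_space r (1 - p^-1) x0 ->
  exists x, is_solution r f x0 x.
Implicit Types (x y z : R -> 'rV[R]_n) (s t u T K d e : R).
Local Notation phi := (phi r f).
Local Notation Wnorm := (W1p_norm r p).

Definition late_norms s t : set R := [set u | exists x t',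
  [/\ W1p r p x, Wnorm x <= s, t <= t' & u = Wnorm (phi t' x)]].

Section Attractive.
Hypothesis gas : GAS_X r f p.

Lemma late_norms_has_sup s t : 0 <= s -> 0 <= t -> has_sup (late_norms s t).
Proof.
move=> s0 t0; split.
  exists (Wnorm (phi t (cst 0))), (cst 0), t; split=> //.
    exact: (W1p_cst0 r0 f0 p1 f_lip).
  by rewrite (W1p_norm0 r0 f0 p1 f_lip).
have [T [B TB]] := uniform_attractivity r0 f0 p1 f_lip f_complete s0 ltr01 gas.
exists B => _ [x [t' [Wx xs tt' ->]]]; have [_] := TB x Wx xs; apply.
exact: le_trans tt'.
Qed.

Lemma sup_late_norms_le s t e : 0 <= s -> 0 <= t ->
  (forall x t', W1p r p x -> Wnorm x <= s -> t <= t' -> Wnorm (phi t' x) <= e) ->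
  sup (late_norms s t) <= e.
Proof.
move=> s0 t0 H; apply: ge_sup; first by case: (late_norms_has_sup s0 t0).
by move=> _ [x [t' [Wx xs tt' ->]]]; exact: H.
Qed.

Lemma le_sup_late_norms s t x : 0 <= s -> 0 <= t -> W1p r p x -> Wnorm x <= s ->
  Wnorm (phi t x) <= sup (late_norms s t).
Proof.
move=> s0 t0 Wx xs; apply: ub_le_sup; first by case: (late_norms_has_sup s0 t0).
by exists x, t.
Qed.

Lemma sup_late_norms_mono s s' t t' : 0 <= s -> s <= s' -> 0 <= t -> t <= t' ->
  sup (late_norms s t') <= sup (late_norms s' t).
Proof.
move=> s0 ss' t0 tt'; have s'0 := le_trans s0 ss'.
apply: sup_late_norms_le => // [|x u Wx xs t'u]; first exact: le_trans tt'.
apply: ub_le_sup; first by case: (late_norms_has_sup s'0 t0).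
by exists x, u; split=> //; [exact: le_trans ss'|exact: le_trans t'u].
Qed.

(** Global attractivity is uniform on bounded sets of initial states, so the
    largest norm reached after time [t] from the ball of radius [s] tends to [0]
    as [t] grows; a comparison function above it is the required bound. *)
Lemma GAS_UGAS : UGAS_X r f p.
Proof.
have ge0 s t : 0 <= s -> 0 <= t -> 0 <= sup (late_norms s t).
  move=> s0 t0; apply: le_trans (le_sup_late_norms s0 t0 (W1p_cst0 r0 f0 p1 f_lip) _).
    exact: W1p_norm_ge0.
  by rewrite (W1p_norm0 r0 f0 p1 f_lip).
have [sigma KL sig] : exists2 sigma, class_KL sigma & forall s t, 0 < s -> 0 <= t ->
    sup (late_norms s t) <= sigma s t.
  apply: (@class_KL_majorant R (fun s t => sup (late_norms s t))).
  - move=> t t0; split=> [s s0|s s' s0 ss']; first exact: ge0.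
    exact: sup_late_norms_mono.
  - by move=> s t u s0 t0 tu; exact: sup_late_norms_mono.
  - move=> s e s0 e0.
    have [T [B TB]] := uniform_attractivity r0 f0 p1 f_lip f_complete s0 e0 gas.
    have T0 : 0 <= Num.max T 0 by rewrite le_max lexx orbT.
    exists (Num.max T 0); split=> //.
    apply: sup_late_norms_le => // x t' Wx xs Tt'; have [H _] := TB x Wx xs.
    by apply: H; rewrite (le_trans _ Tt')// le_max lexx.
  - move=> e e0; have [d d0 LSd] := LS_XP gas.1 e0.
    exists d => //; apply: (sup_late_norms_le (ltW d0)) => // x t Wx xd t0.
    exact: LSd.
exists sigma => // t x t0 Wx.
have := W1p_norm_ge0 r p x; rewrite le_eqVlt => /predU1P[x0|x0]; last first.
  apply: le_trans (sig _ _ x0 t0); exact: le_sup_late_norms (ltW x0) _ _ _.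
have [_ _ K0] := KL.1 t t0; rewrite -x0 K0.
apply/ler_addgt0Pr => e e0; rewrite add0r.
by have [d d0 LSd] := LS_XP gas.1 e0; rewrite LSd// -x0 ltW.
Qed.

End Attractive.
End UniformStability.

(** * The converse Lyapunov functional *)

Section RightUpperLimit.
Context {R : realType}.
Implicit Types (g : R -> R) (M d : R).

Lemma limf_esup_right_le g M d : 0 < d -> (forall t, 0 < t -> t < d -> g t <= M) ->
  (limf_esup (fun t => (g t)%:E) 0^'+ <= M%:E)%E.
Proof.
move=> d0 H; rewrite limf_esupE; apply: ge_ereal_inf.
exists (ereal_sup [set (g t)%:E | t in [set t | 0 < t /\ t < d]]); last first.
  by apply: ge_ereal_sup => _ [t [t0 td] <-]; rewrite lee_fin H.
exists [set t | 0 < t /\ t < d] => //.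
by apply: filterI; [exact: nbhs_right_gt|exact: nbhs_right_lt].
Qed.

Lemma limf_esup_right_lt g M : (limf_esup (fun t => (g t)%:E) 0^'+ < M%:E)%E ->
  exists2 d : R, 0 < d & forall t, 0 < t -> t < d -> g t < M.
Proof.
rewrite limf_esupE => /ereal_inf_lt[_ [V /nbhs_ballP[d/= d0 dV] <-] VM].
exists d => // t t0 td; rewrite -lte_fin; apply: le_lt_trans VM.
apply: ereal_sup_ubound; exists t => //; apply: dV => //.
by rewrite /ball/= sub0r normrN gtr0_norm.
Qed.

End RightUpperLimit.

Section Excess.
Context {R : realType}.
Implicit Types (a b e : R).

(** The part of a norm above a threshold.  It vanishes in finite time along
    attracted trajectories and is still Lipschitz in the norm. *)
Definition excess e a := Num.max 0 (a - e).

Lemma excess_ge0 e a : 0 <= excess e a.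
Proof. by rewrite le_max lexx. Qed.

Lemma excess_out e a : a <= e -> excess e a = 0.
Proof. by move=> ae; apply/max_idPl; rewrite subr_le0. Qed.

Lemma excess_le e a : 0 <= e -> 0 <= a -> excess e a <= a.
Proof. by move=> e0 a0; rewrite ge_max a0 gerBl. Qed.

Lemma excess_ge e a : a - e <= excess e a.
Proof. by rewrite le_max lexx orbT. Qed.

Lemma excess_dist e a b : `|excess e a - excess e b| <= `|a - b|.
Proof.
rewrite /excess !maxEle; have := ler_norm (a - b); have := ler_norm (b - a).
by rewrite [`|b - a|]distrC ler_norml; do !case: ifPn; rewrite -?ltNge => *; lra.
Qed.

Lemma excess_scale e a l : 0 <= e -> 0 <= l -> l <= 1 ->
  excess e (l * a) <= l * excess e a.
Proof.
move=> e0 l0 l1; rewrite ge_max mulr_ge0 ?excess_ge0//=.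
apply: (@le_trans _ _ (l * (a - e))); last by rewrite ler_wpM2l ?excess_ge.
by rewrite mulrBr lerD2l lerN2 ler_piMl.
Qed.

End Excess.

Section WeightedExcess.
Context {R : realType}.
Variable c : nat -> R.
Hypotheses (c0 : forall k, 0 < c k) (c1 : forall k, c k <= 1).
Implicit Types (s t : R) (k : nat).

(** The lower bound of the converse functional.  It is a supremum of convex
    functions vanishing at [0], hence convex, so being positive on the positive
    half-line it is strictly increasing there. *)
Definition weighted_excess s := sup [set c k * excess k.+1%:R^-1 s | k in [set: nat]].

Let term_le k s : 0 <= s -> c k * excess k.+1%:R^-1 s <= s.
Proof.
move=> s0; rewrite (le_trans (ler_piMl (excess_ge0 _ _) (c1 k)))//.
exact: excess_le.
Qed.

Lemma weighted_excess_has_sup s : 0 <= s ->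
  has_sup [set c k * excess k.+1%:R^-1 s | k in [set: nat]].
Proof.
move=> s0; split; first by exists (c 0 * excess 0.+1%:R^-1 s); exists 0%N.
by exists s => _ [k _ <-]; exact: term_le.
Qed.

Lemma le_weighted_excess k s : 0 <= s ->
  c k * excess k.+1%:R^-1 s <= weighted_excess s.
Proof.
move=> s0; apply: ub_le_sup; last by exists k.
by case: (weighted_excess_has_sup s0).
Qed.

Lemma weighted_excess_le s M : 0 <= s ->
  (forall k, c k * excess k.+1%:R^-1 s <= M) -> weighted_excess s <= M.
Proof.
move=> s0 H; apply: ge_sup; first by case: (weighted_excess_has_sup s0).
by move=> _ [k _ <-]; exact: H.
Qed.

Lemma weighted_excess_gt0 s : 0 < s -> 0 < weighted_excess s.
Proof.
move=> s0; pose k := Num.truncn s^-1.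
have ks : k.+1%:R^-1 < s.
  by rewrite -[s]invrK ltf_pV2 ?posrE ?invr_gt0// truncnS_gt.
apply: lt_le_trans (le_weighted_excess k (ltW s0)).
by rewrite mulr_gt0// (lt_le_trans _ (excess_ge _ _))// subr_gt0.
Qed.

Lemma weighted_excess_dist s t : 0 <= s -> 0 <= t ->
  weighted_excess s <= weighted_excess t + `|s - t|.
Proof.
move=> s0 t0; apply: weighted_excess_le => // k.
apply: (@le_trans _ _ (c k * excess k.+1%:R^-1 t + c k * `|s - t|)).
  rewrite -mulrDr ler_pM2l// -lerBlDl (le_trans (ler_norm _))//.
  exact: excess_dist.
by rewrite lerD ?le_weighted_excess// ler_piMl.
Qed.

Lemma weighted_excess_class_Kinfty : class_Kinfty weighted_excess.
Proof.
split; first split.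
- apply: within_continuous_realP => s; rewrite /= in_itv/= andbT => s0 e e0.
  exists e => // u; rewrite /= in_itv/= andbT => u0; apply: le_lt_trans.
  have H1 := weighted_excess_dist s0 u0; have H2 := weighted_excess_dist u0 s0.
  move: H1; rewrite distrC => H1; rewrite ler_norml; apply/andP; split; lra.
- move=> s t s0 st; have t0 : 0 < t by exact: le_lt_trans st.
  have l0 : 0 <= s / t by rewrite mulr_ge0// invr_ge0 ltW.
  have l1 : s / t < 1 by rewrite ltr_pdivrMr// mul1r.
  apply: (@le_lt_trans _ _ (s / t * weighted_excess t)); last first.
    by rewrite gtr_pMl ?weighted_excess_gt0.
  apply: weighted_excess_le => // k.
  apply: (@le_trans _ _ (s / t * (c k * excess k.+1%:R^-1 t))); last first.
    by rewrite ler_wpM2l// le_weighted_excess// ltW.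
  rewrite mulrCA ler_pM2l//; have := @excess_scale R k.+1%:R^-1 t (s / t).
  by rewrite mulfVK ?gt_eqF//; apply => //; exact: ltW.
- apply/eqP; rewrite eq_le; apply/andP; split.
    by apply: weighted_excess_le => // k; exact: term_le.
  have := @le_weighted_excess 0 0 (lexx 0); apply: le_trans.
  by rewrite mulr_ge0 ?excess_ge0// ltW.
apply/cvgryPge => A; near=> s.
have s0 : 0 < s by near: s; exact: nbhs_pinfty_gt.
apply: le_trans (le_weighted_excess 0 (ltW s0)).
apply: (@le_trans _ _ (c 0 * (s - 1))); last first.
  by rewrite ler_pM2l//; have := excess_ge 1%:R^-1 s; rewrite invr1.
rewrite mulrC -ler_pdivrMr// lerBrDr; near: s; apply: nbhs_pinfty_ge; apply: num_real.
Unshelve. all: by end_near. Qed.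

End WeightedExcess.

Section ConverseFunctional.
Context {R : realType} {n : nat}.
Variables (r : R) (f : (R -> 'rV[R]_n) -> 'rV[R]_n) (p : R).
Hypotheses (r0 : 0 < r) (f0 : f (cst 0) = 0) (p1 : 1 < p).
Hypothesis f_lip : lipschitz_on_bounded_C0 r f.
Hypothesis f_complete : forall x0, holder_space r (1 - p^-1) x0 ->
  exists x, is_solution r f x0 x.
Implicit Types (x y z : R -> 'rV[R]_n) (s t u T K d e : R) (k j : nat).
Local Notation phi := (phi r f).
Local Notation Wnorm := (W1p_norm r p).

Section Uniform.
Variable sigma : R -> R -> R.
Hypothesis sigma_KL : class_KL sigma.
Hypothesis ugas : forall t x, 0 <= t -> W1p r p x ->
  Wnorm (phi t x) <= sigma (Wnorm x) t.

Lemma class_KL_le s s' t t' : 0 <= s -> s <= s' -> 0 <= t -> t <= t' ->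
  sigma s t' <= sigma s' t.
Proof.
move=> s0 ss' t0 tt'; have s'0 := le_trans s0 ss'.
have [/(_ t t' t0 tt') H _] := sigma_KL.2 _ s'0.
apply: le_trans H; move: ss'; rewrite le_eqVlt => /predU1P[->//|ss'].
have [_ H _] := sigma_KL.1 _ (le_trans t0 tt').
exact/ltW/H.
Qed.

Definition excess_term k t x := expR t * excess k.+1%:R^-1 (Wnorm (phi t x)).

(** On a ball all the excesses over [k.+1%:R^-1] vanish after a common time [T], and
    up to [T] the flow is Lipschitz and [expR] bounded. *)
Lemma excess_term_lipschitz K k : 0 <= K -> exists2 C : R, 0 <= C &
  forall t x y, 0 <= t -> W1p r p x -> W1p r p y -> Wnorm x <= K -> Wnorm y <= K ->
    `|excess_term k t x - excess_term k t y| <= C * Wnorm (x - y).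
Proof.
move=> K0.
have [T [T0 HT]] : exists T, 0 <= T /\ sigma K T <= k.+1%:R^-1.
  have k0 : 0 < k.+1%:R^-1 :> R by rewrite invr_gt0.
  have [_ /cvgrPdist_le/(_ _ k0)[M [_ HM]]] := sigma_KL.2 K K0.
  exists (Num.max 0 (M + 1)); rewrite le_max lexx; split=> //.
  have := HM (Num.max 0 (M + 1)); rewrite sub0r normrN => H.
  by rewrite (le_trans (ler_norm _))// H// lt_max ltrDl ltr01 orbT.
(* Bound on the trajectories starting in the ball of radius K. *)
pose B := Num.max K (sigma K 0).
have B0 : 0 <= B by rewrite le_max K0.
have [C C0' HC] := norm_segment_dist r0 f0 p1 f_lip T B0.
have bound x : W1p r p x -> Wnorm x <= K ->
    forall s, - r <= s -> s <= T -> enorm (sol r f x s) <= B.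
  move=> Wx xK s rs _; rewrite le_max; have [s0|/ltW s0] := leP s 0.
    by rewrite (le_trans (enorm_init_le r0 p1 f_complete Wx rs s0) xK).
  have sK := class_KL_le (W1p_norm_ge0 r p x) xK (lexx 0) s0.
  apply/orP; right; apply: (le_trans (enorm_sol_le r0 p1 f_complete Wx s0)).
  exact: le_trans (ugas s0 Wx) sK.
exists (expR T * C) => [|t x y t0 Wx Wy xK yK]; first by rewrite mulr_ge0 ?expR_ge0.
have N0 : 0 <= Wnorm (x - y) by exact: W1p_norm_ge0.
rewrite /excess_term -mulrBr normrM (ger0_norm (expR_ge0 _)).
have [tT|Tt] := leP t T; last first.
  have small w : W1p r p w -> Wnorm w <= K -> excess k.+1%:R^-1 (Wnorm (phi t w)) = 0.
    move=> Ww wK; apply: excess_out; apply: (le_trans (ugas t0 Ww)); apply: le_trans HT.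
    exact: class_KL_le (W1p_norm_ge0 r p w) wK T0 (ltW Tt).
  have ge0 : 0 <= expR T * C * Wnorm (x - y).
    by apply: mulr_ge0 N0; apply: mulr_ge0 C0'; exact: expR_ge0.
  have dist0 (a b : R) : a = 0 -> b = 0 -> expR t * `|a - b| = 0.
    by move=> -> ->; rewrite subrr normr0 mulr0.
  have eq_le0 (a : R) : a = 0 -> a <= 0 by move=> ->.
  apply: (le_trans _ ge0); apply: eq_le0; apply: dist0.
    exact: small Wx xK.
  exact: small Wy yK.
rewrite -mulrA; apply: ler_pM; rewrite ?expR_ge0 ?ler_expR//.
apply: le_trans (excess_dist _ _ _) _.
apply: le_trans (W1p_norm_dist r0 p1 (phi_W1p r0 f0 p1 f_lip f_complete Wx t0)
  (phi_W1p r0 f0 p1 f_lip f_complete Wy t0)) _.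
have sx := W1p_solP r0 p1 f_complete Wx; have sy := W1p_solP r0 p1 f_complete Wy.
exact: HC sx sy Wx Wy (bound _ Wx xK) (bound _ Wy yK) t t0 tT.
Qed.

(** Diagonal choice of weights: on the ball of radius [K] only the finitely many
    terms of index below [K] can have a Lipschitz constant above [1]. *)
Lemma excess_weights : exists c : nat -> R,
  [/\ forall k, 0 < c k, forall k, c k <= 1 &
    forall K, exists2 M : R, 0 <= M &
      forall k t x y, 0 <= t -> W1p r p x -> W1p r p y ->
        Wnorm x <= K -> Wnorm y <= K ->
        `|c k * excess_term k t x - c k * excess_term k t y| <= M * Wnorm (x - y)].
Proof.
pose P j k (C : R) := 0 <= C /\ forall t x y, 0 <= t -> W1p r p x -> W1p r p y ->
  Wnorm x <= j%:R -> Wnorm y <= j%:R ->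
  `|excess_term k t x - excess_term k t y| <= C * Wnorm (x - y).
have [C HC] : {C : nat * nat -> R & forall jk, P jk.1 jk.2 (C jk)}.
  apply: (@choice _ _ (fun jk C => P jk.1 jk.2 C)) => -[j k].
  by have [C C0' HC] := @excess_term_lipschitz j%:R k (ler0n _ _); exists C.
have Cge0 j k : 0 <= C (j, k) by case: (HC (j, k)).
have C1 k : 0 < 1 + C (k, k) by rewrite ltr_wpDr.
have c0 k : 0 < (1 + C (k, k))^-1 by rewrite invr_gt0.
have c1 k : (1 + C (k, k))^-1 <= 1 by rewrite invf_le1// lerDl.
(* For k above the radius, C (k, k) is a valid constant on the ball, and the
   weight makes it at most 1. *)
exists (fun k => (1 + C (k, k))^-1); split=> // K.
pose j := Num.truncn K; pose M := 1 + \sum_(k < j.+1) C (j.+1, k : nat).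
have S0 : 0 <= \sum_(k < j.+1) C (j.+1, k : nat) by apply: sumr_ge0.
exists M => [|k t x y t0 Wx Wy xK yK]; first by rewrite addr_ge0.
have N0 : 0 <= Wnorm (x - y) by exact: W1p_norm_ge0.
rewrite -mulrBr normrM (gtr0_norm (c0 k)).
have Kj : K <= j.+1%:R by apply/ltW/truncnS_gt.
have [kj|jk] := ltnP k j.+1.
  have [_ /(_ t x y t0 Wx Wy (le_trans xK Kj) (le_trans yK Kj)) H] := HC (j.+1, k).
  apply: (le_trans (ler_piMl (normr_ge0 _) (c1 k))); apply: (le_trans H).
  apply: ler_wpM2r => //; rewrite /M (bigD1 (Ordinal kj))//= addrCA lerDl.
  by rewrite addr_ge0// sumr_ge0.
have Kk : K <= k%:R by rewrite (le_trans Kj)// ler_nat.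
have [_ /(_ t x y t0 Wx Wy (le_trans xK Kk) (le_trans yK Kk)) H] := HC (k, k).
apply: (le_trans (ler_wpM2l (ltW (c0 k)) H)); rewrite mulrA ler_wpM2r//.
rewrite (@le_trans _ _ 1)// ?lerDl//.
by rewrite mulrC ler_pdivrMr// mul1r lerDr.
Qed.

(** Exponential weighting in time of the excess over a threshold makes the
    supremum decay at unit rate along trajectories. *)
Lemma UGAS_converse_functional :
  exists (V : (R -> 'rV[R]_n) -> R) (a1 a2 : R -> R),
    [/\ forall x, W1p r p x -> 0 <= V x,
        lipschitz_on_bounded_W1p r p V,
        class_Kinfty a1, class_Kinfty a2 &
        forall x, W1p r p x ->
          [/\ a1 (Wnorm x) <= V x, V x <= a2 (Wnorm x) &
              (upper_dini r f V x <= (- V x)%:E)%E]].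
Proof.
have [c [c0 c1 cM]] := excess_weights.
have W0 := W1p_cst0 r0 f0 p1 f_lip.
have N0 := W1p_norm0 r0 f0 p1 f_lip.
have term_ge0 k t x : 0 <= c k * excess_term k t x.
  by rewrite mulr_ge0 ?(ltW (c0 k))// mulr_ge0 ?expR_ge0 ?excess_ge0.
pose S x := [set v | exists k t, 0 <= t /\ v = c k * excess_term k t x].
pose V x := sup (S x).
have bnd K : exists2 M : R, 0 <= M & forall x k t, W1p r p x -> Wnorm x <= K ->
    0 <= t -> c k * excess_term k t x <= M * Wnorm x.
  have [M M0 HM] := cM K; exists M => // x k t Wx xK t0.
  have K0 : 0 <= K by rewrite (le_trans _ xK)// W1p_norm_ge0.
  have := HM k t x (cst 0) t0 Wx W0 xK; rewrite N0 => /(_ K0).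
  rewrite (_ : x - cst 0 = x); last by apply/funext => s; exact: subr0.
  suff -> : excess_term k t (cst 0) = 0.
    by rewrite mulr0 subr0; apply: le_trans; exact: ler_norm.
  rewrite /excess_term excess_out ?mulr0//.
  have [_ _ s0] := sigma_KL.1 t t0.
  by have := ugas t0 W0; rewrite N0 s0 => /le_trans; apply; rewrite invr_ge0.
have hs x : W1p r p x -> has_sup (S x).
  move=> Wx; split; first by exists (c 0 * excess_term 0 0 x), 0%N, 0.
  have [M M0 HM] := bnd (Wnorm x).
  by exists (M * Wnorm x) => _ [k [t [t0 ->]]]; exact: HM.
have leV x k t : W1p r p x -> 0 <= t -> c k * excess_term k t x <= V x.
  by move=> Wx t0; apply: ub_le_sup; [case: (hs x Wx)|exists k, t].
have Vle x M : W1p r p x ->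
    (forall k t, 0 <= t -> c k * excess_term k t x <= M) -> V x <= M.
  move=> Wx H; apply: ge_sup; first by case: (hs x Wx).
  by move=> _ [k [t [t0 ->]]]; exact: H.
have V0 x : W1p r p x -> 0 <= V x.
  by move=> Wx; apply: le_trans (leV x 0%N 0 Wx (lexx 0)).
pose b u := sup [set V x | x in [set x | W1p r p x /\ Wnorm x <= u]].
have bhs u : 0 <= u -> has_sup [set V x | x in [set x | W1p r p x /\ Wnorm x <= u]].
  move=> u0; split; first by exists (V (cst 0)), (cst 0) => //; split=> //; rewrite N0.
  have [M M0 HM] := bnd u; exists (M * u) => _ [x [Wx xu] <-].
  apply: Vle => // k t t0; apply: (le_trans (HM _ _ _ Wx xu t0)).
  exact: ler_wpM2l.
have leb u x : W1p r p x -> Wnorm x <= u -> V x <= b u.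
  move=> Wx xu; have u0 : 0 <= u by rewrite (le_trans _ xu)// W1p_norm_ge0.
  by apply: ub_le_sup; [case: (bhs u u0)|exists x].
have bnd_b : nondecr_ge0 b.
  split=> [s s0|s t s0 st].
    by apply: le_trans (leb s (cst 0) W0 _); rewrite ?V0// N0.
  apply: ge_sup; first by case: (bhs s s0).
  by move=> _ [x [Wx xs] <-]; apply: leb => //; exact: le_trans st.
have b_small e : 0 < e -> exists2 d : R, 0 < d & b d <= e.
  move=> e0; have [M M0 HM] := bnd 1.
  have M1 : 0 < M + 1 by rewrite ltr_wpDl.
  have d0 : 0 < Num.min 1 (e / (M + 1)) by rewrite lt_min ltr01 divr_gt0.
  exists (Num.min 1 (e / (M + 1))) => //; apply: ge_sup.
    by case: (bhs _ (ltW d0)).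
  move=> _ [x [Wx xm] <-]; move: xm; rewrite le_min => /andP[x1 xe].
  apply: Vle => // k t t0; apply: (le_trans (HM _ _ _ Wx x1 t0)).
  move: xe; rewrite ler_pdivlMr// mulrC; apply: le_trans.
  by rewrite ler_wpM2r ?W1p_norm_ge0// lerDl.
exists V, (weighted_excess c), (fun s => majorant b s + 1 * s); split=> //.
- move=> K K0; have [M M0 HM] := cM K; exists M; first exact: M0.
  move=> x y Wx Wy xK yK.
  have step y1 y2 : W1p r p y1 -> W1p r p y2 ->
      (forall k t, 0 <= t -> `|c k * excess_term k t y1 - c k * excess_term k t y2|
         <= M * Wnorm (x - y)) -> V y1 <= V y2 + M * Wnorm (x - y).
    move=> Wy1 Wy2 H; apply: Vle => // k t t0.
    apply: (@le_trans _ _ (c k * excess_term k t y2 + M * Wnorm (x - y))).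
      by rewrite -lerBlDl (le_trans (ler_norm _))// H.
    by rewrite lerD2r leV.
  have V1 : V x <= V y + M * Wnorm (x - y).
    by apply: (step x y Wx Wy) => k t t0; exact: HM k t x y t0 Wx Wy xK yK.
  have V2 : V y <= V x + M * Wnorm (x - y).
    apply: (step y x Wy Wx) => k t t0; rewrite distrC.
    exact: HM k t x y t0 Wx Wy xK yK.
  by apply: ler_dist_of_le; rewrite addrC; [exact: V1|exact: V2].
- exact: weighted_excess_class_Kinfty.
- exact: majorant_class_Kinfty.
move=> x Wx; split.
- apply: weighted_excess_le => // [|k]; first exact: W1p_norm_ge0.
  have := leV x k 0 Wx (lexx 0).
  by rewrite /excess_term expR0 mul1r (W1p_norm_phi0 r0 p1 f_complete Wx).
- have := W1p_norm_ge0 r p x; rewrite le_eqVlt => /predU1P[x0|x0].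
    have [M M0 HM] := bnd (Wnorm x).
    rewrite -x0 mulr0 addr0 /majorant lexx; apply: Vle => // k t t0.
    by rewrite (le_trans (HM x k t Wx (lexx _) t0))// -x0 mulr0.
  rewrite (le_trans (leb _ x Wx (lexx _)))// (le_trans (le_majorant bnd_b x0))//.
  by rewrite lerDl mul1r ltW.
have decay h : 0 <= h -> V (phi h x) <= expR (- h) * V x.
  move=> h0; have Wh := phi_W1p r0 f0 p1 f_lip f_complete Wx h0.
  apply: Vle => // k t t0; have ht0 : 0 <= h + t by rewrite addr_ge0.
  have shift (a E : R) :
      a * (expR t * E) = expR (- h) * (a * (expR (h + t) * E)).
    have -> : expR t = expR (- h) * expR (h + t) by rewrite -expRD addKr.
    by ring.
  rewrite /excess_term (W1p_norm_phiD r0 p1 f_lip f_complete Wx h0 t0) shift.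
  by apply: ler_wpM2l; [exact: expR_ge0|exact: (leV x k _ Wx ht0)].
apply/lee_addgt0Pr => e e0; rewrite -EFinD.
have V1 : 0 < V x + 1 by rewrite ltr_wpDl// V0.
apply: (@limf_esup_right_le _ _ _ (e / (V x + 1))); first by rewrite divr_gt0.
move=> h h0 he; have h1 : 0 < 1 + h by rewrite addr_gt0.
apply: (@le_trans _ _ (- (V x / (1 + h)))).
  rewrite mulrC ler_pdivrMr//; have Eh : expR (- h) <= (1 + h)^-1.
    by rewrite expRN lef_pV2 ?posrE ?expR_gt0// expR_ge1Dx.
  have : V (phi h x) <= (1 + h)^-1 * V x.
    by rewrite (le_trans (decay h (ltW h0)))// ler_wpM2r// V0.
  move=> H.
  have -> : - (V x / (1 + h)) * h = (1 + h)^-1 * V x - V x by field; rewrite gt_eqF.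
  by rewrite lerD2r.
have Vx0 := V0 x Wx; move: he; rewrite ltr_pdivlMr// => he.
have -> : V x / (1 + h) = V x - h * V x / (1 + h) by field; rewrite gt_eqF.
rewrite opprB addrC lerD2l.
rewrite ler_pdivrMr//; have : 0 <= e * h by rewrite mulr_ge0 ?ltW.
lra.
Qed.

End Uniform.
End ConverseFunctional.

(** * Continuity of trajectories in the Sobolev norm *)

Section ContinuityOfFlow.
Context {R : realType} {n : nat}.
Variables (r : R) (f : (R -> 'rV[R]_n) -> 'rV[R]_n) (p : R).
Hypotheses (r0 : 0 < r) (f0 : f (cst 0) = 0) (p1 : 1 < p).
Hypothesis f_lip : lipschitz_on_bounded_C0 r f.
Let le1p : 1 <= p := ltW p1.
Implicit Types (x y z w : R -> 'rV[R]_n) (s t u h T d e : R).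

Lemma vLnorm_translation_continuous w A e : 0 <= A -> 0 < e -> vLfun p w ->
  (forall t, A < `|t| -> w t = 0) ->
  exists2 d : R, 0 < d & forall h, `|h| < d ->
    (vLnorm p (fun t => w (t + h)%R - w t)%R <= e%:E)%E.
Proof.
move=> A0 e0 fw w0.
have n1 : 0 < n.+1%:R :> R by [].
have en : 0 < e / n.+1%:R by rewrite divr_gt0.
have wi i : exists d, 0 < d /\ forall h, `|h| < d ->
    ('N[@lebesgue_measure R]_p%:E[EFin \o (fun t => w (t + h)%R ord0 i - w t ord0 i)%R]
      <= (e / n.+1%:R)%:E)%E.
  have /LfunE[mwi wi] := fw i.
  have [|d d0 H] := Lnorm_translation_continuous le1p A0 en mwi wi.
    by move=> t /w0 ->; rewrite mxE.
  by exists d.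
have [D HD] := choice wi.
exists (\big[Num.min/1]_(i < n) D i).
  by apply: (big_ind (fun d => 0 < d)) => // [a b a0 b0|i _]; [rewrite lt_min a0|case: (HD i)].
move=> h hD; have mdiff i : measurable_fun [set: R] (fun t => (w (t + h) - w t) ord0 i).
  rewrite (_ : (fun t => _) = (fun t => w (t + h) ord0 i - w t ord0 i)); last first.
    by apply/funext => t; rewrite !mxE.
  apply: measurable_funB; last by have /LfunE[] := fw i.
  have /LfunE[mwi _] := fw i.
  have := measurable_coord_shift h mwi.
  rewrite (_ : (fun s => _) = fun s => w (s + h) ord0 i)//.
  by apply/funext => s; rewrite addrC.
apply: le_trans (vLnorm_le_sum le1p mdiff) _.
apply: (@le_trans _ _ (\sum_(i < n) (e / n.+1%:R)%:E)%E).
  apply: lee_sum => i _.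
  rewrite (_ : (fun t => _) = (fun t => w (t + h) ord0 i - w t ord0 i)); last first.
    by apply/funext => t; rewrite !mxE.
  case: (HD i) => _; apply.
  by apply: lt_le_trans hD _; exact: bigmin_le.
rewrite sumEFin lee_fin sumr_const card_ord -[_ *+ n]mulr_natr -mulrA ler_piMr ?(ltW e0)//.
by rewrite mulrC ler_pdivrMr// mul1r ler_nat.
Qed.

(** The derivatives of the segments are restrictions of translates of a single
    [L^p] function: the initial derivative, continued by the velocity. *)
Lemma segment_continuous x0 z T e : is_solution r f x0 z -> W1p r p x0 ->
  0 <= T -> 0 < e -> exists2 d : R, 0 < d &
    forall s t, 0 <= s -> s <= T -> 0 <= t -> t <= T -> `|s - t| < d ->
      W1p_norm r p (segment_at z s - segment_at z t) <= e.
Proof.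
move=> sz Wx T0 e0; have /W1pE[_ wx] := Wx.
have e20 : 0 < e / 2 by rewrite divr_gt0.
have [d1 d10 zd] := within_uniform_continuous (sol_within sz T) e20.
pose A := T + r; have A0 : 0 < A by rewrite ltr_wpDl.
have [B B0 zB] := speed_bounded f0 f_lip T sz.
(* The derivative of the trajectory on ]- r, T[, moved to the left by T. *)
pose w s := if s \in `]- A, 0[ then wder r x0 (T + s) + speed f z (T + s) else 0.
have wE s : s \in `]- A, 0[ -> s != - T ->
    w s = wder r x0 (T + s) + speed f z (T + s).
  by move=> sA _; rewrite /w sA.
have w0 s : s \notin `]- A, 0[ -> w s = 0 by move=> /negPf sA; rewrite /w sA.
have fw : vLfun p w := vLfun_segment A0 le1p wx
  (fun i => speed_measurable f_lip i sz) B0 zB wE w0.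
have wA t : A < `|t| -> w t = 0.
  rewrite /w in_itv/= => tA; case: ifPn => // /andP[At t0].
  by move: tA At; rewrite ltr0_norm// ltrNl => tA /(lt_trans tA); rewrite ltxx.
have [d2 d20 wd] := vLnorm_translation_continuous (ltW A0) e20 fw wA.
exists (Num.min d1 d2) => [|s t s0 sT t0 tT]; first by rewrite lt_min d10.
rewrite lt_min => /andP[st1 st2].
rewrite /W1p_norm [e](_ : _ = e / 2 + e / 2); last by field.
apply: lerD.
  apply: sup_norm_le => [|u]; first exact: ltW.
  rewrite in_itv/= => /andP[ru u0]; apply/ltW/zd.
  - by rewrite in_itv/=; apply/andP; split; lra.
  - by rewrite in_itv/=; apply/andP; split; lra.
  - by rewrite (_ : s + u - (t + u) = s - t)//; ring.
rewrite -lee_fin.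
have Ws := W1p_segment r0 f0 p1 f_lip sz s0 Wx.
have Wt := W1p_segment r0 f0 p1 f_lip sz t0 Wx.
rewrite -(W1p_vLnormB r0 p1 Ws Wt); apply: le_trans (wd _ st2).
have fws : vLfun p (fun u => w (u + (s - t))).
  move=> i; have /LfunE[mwi wi] := fw i; apply/LfunE; split.
    have -> : (fun u => w (u + (s - t)) ord0 i) = (fun u => w (s - t + u) ord0 i).
      by apply/funext => u; rewrite addrC.
    exact: measurable_coord_shift.
  by rewrite (Lnorm_shift p (s - t) mwi).
have fv : vLfun p (fun u => w (u + (s - t)) - w u) := vLfunB le1p fws fw.
rewrite -(vLnorm_shift (t - T) fv).
apply: ae_le_vLnorm => //.
apply: ae_lebesgueS (ae_lebesgueI (ae_neq (- s)) (ae_neq (- t))) => u [us ut] /=.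
rewrite [leRHS]ger0_norm ?enorm_ge0//.
have [ur|ur] := boolP (u \in `]- r, 0[); last by rewrite !wder_out// subrr enorm0 enorm_ge0.
rewrite (wder_segment sz s0 ur us) (wder_segment sz t0 ur ut).
move: ur; rewrite in_itv/= => /andP[ru u0].
have sE : t - T + u + (s - t) = s - T + u by ring.
have inA v : 0 <= v -> v <= T -> v - T + u \in `]- A, 0[.
  by move=> v0 vT; rewrite in_itv/= /A; apply/andP; split; lra.
rewrite /w sE inA// inA//.
by rewrite (_ : T + (s - T + u) = s + u) 1?(_ : T + (t - T + u) = t + u)//; ring.
Qed.

End ContinuityOfFlow.

(** * Asymptotic stability from a Lyapunov functional *)

Section IncrementsFromDiniDerivative.
Context {R : realType}.
Implicit Types (g : R -> R) (a b c m s t h e d : R).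

(** The set of times at which the bound with slope [m + e] holds contains its
    supremum by left semicontinuity, and can be prolonged to the right of any of
    its points by the one-sided differential inequality. *)
Lemma increment_le_of_right_slope g a b m : a <= b ->
  (forall t, a < t -> t <= b -> forall e, 0 < e -> exists2 d : R, 0 < d &
     forall s, a <= s -> s < t -> t - s < d -> g t <= g s + e) ->
  (forall t, a <= t -> t < b -> forall e, 0 < e -> exists2 d : R, 0 < d &
     forall h, 0 < h -> h < d -> g (t + h) <= g t + (m + e) * h) ->
  g b <= g a + m * (b - a).
Proof.
move=> ab left right.
suff main e : 0 < e -> g b <= g a + (m + e) * (b - a).
  apply/ler_addgt0Pr => e e0; have ba : 0 < b - a + 1 by rewrite ltr_wpDl ?subr_ge0.
  apply: le_trans (main _ (divr_gt0 e0 ba)) _.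
  rewrite mulrDl addrA lerD2l mulrAC ler_pdivrMr// ler_pM2l//; lra.
move=> e0; pose S := [set t | [/\ a <= t, t <= b & g t <= g a + (m + e) * (t - a)]].
have Sa : S a by split; rewrite ?lexx// subrr mulr0 addr0.
have ubS : ubound S b by move=> t [].
have hS : has_sup S by split; [exists a|exists b].
pose c := sup S.
have ac : a <= c by apply: ub_le_sup => //; exists b.
have cb : c <= b by apply: ge_sup => //; exists a.
have Sc : S c.
  split=> //; move: ac; rewrite le_eqVlt => /predU1P[<-|ac].
    by rewrite subrr mulr0 addr0.
  apply/ler_addgt0Pr => eta eta0; have eta20 : 0 < eta / 2 by rewrite divr_gt0.
  have [d d0 gd] := left c ac cb _ eta20.
  pose L := `|m + e| + 1; have L0 : 0 < L by rewrite ltr_wpDl.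
  have d'0 : 0 < Num.min d (eta / 2 / L) by rewrite lt_min d0 divr_gt0.
  have [s [sa sb sg] cs] := sup_adherent d'0 hS.
  have sc : s <= c by apply: ub_le_sup; [exists b|split].
  move: cs; rewrite ltrBlDr -ltrBlDl lt_min => /andP[cs1 cs2].
  move: sc; rewrite le_eqVlt => /predU1P[sc|sc].
    by rewrite -sc (le_trans sg)// lerDl ltW.
  have H1 := gd s sa sc cs1; rewrite ltr_pdivlMr// in cs2.
  have H2 : (m + e) * (s - a) <= (m + e) * (c - a) + L * (c - s).
    have -> : s - a = c - a - (c - s) by ring.
    rewrite mulrBr lerD2l -mulNr ler_wpM2r ?subr_ge0 ?(ltW sc)//.
    by rewrite (le_trans (ler_norm _))// normrN lerDl.
  rewrite mulrC in cs2.
  have sum (gc gs ga u v w : R) : gc <= gs + eta / 2 -> gs <= ga + u ->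
    u <= v + w -> w < eta / 2 -> gc <= ga + v + eta by lra.
  exact: sum H1 sg H2 cs2.
have [_ _ gc] := Sc.
move: cb; rewrite le_eqVlt => /predU1P[<-//|cb].
have [d d0 gd] := right c ac cb e e0.
pose h := Num.min (d / 2) (b - c).
have h0 : 0 < h by rewrite lt_min divr_gt0// subr_gt0.
have hd : h < d by rewrite gt_min; apply/orP; left; lra.
have hb : h <= b - c by rewrite ge_min lexx orbT.
have Sch : S (c + h).
  split; [by rewrite (le_trans ac)// lerDl ltW|by rewrite -lerBrDl|].
  apply: (le_trans (gd h h0 hd)).
  have -> : c + h - a = c - a + h by ring.
  by rewrite mulrDr addrA lerD2r.
have : c + h <= c by apply: ub_le_sup => //; exists b.
by rewrite gerDl leNgt h0.
Qed.

End IncrementsFromDiniDerivative.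

Section ClassK.
Context {R : realType}.
Implicit Types (rho : R -> R) (s t e : R).

Lemma class_K_le rho s t : class_K rho -> 0 <= s -> s <= t -> rho s <= rho t.
Proof.
move=> [_ H _] s0; rewrite le_eqVlt => /predU1P[->//|st]; exact/ltW/H.
Qed.

Lemma class_K_ge0 rho s : class_K rho -> 0 <= s -> 0 <= rho s.
Proof.
by move=> Kr s0; have [_ _ E] := Kr; rewrite -E; exact: class_K_le.
Qed.

Lemma class_K_gt0 rho s : class_K rho -> 0 < s -> 0 < rho s.
Proof. by move=> [_ H E] s0; rewrite -E; exact: H. Qed.

Lemma class_K_lt_inv rho s t : class_K rho -> 0 <= t -> rho s < rho t -> s < t.
Proof.
move=> Kr t0; rewrite !ltNge; apply: contra => ts; exact: class_K_le.
Qed.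

Lemma class_K_small rho e : class_K rho -> 0 < e ->
  exists2 d : R, 0 < d & rho d < e.
Proof.
move=> [cr _ r0] e0; have z0 : `[0, +oo[%classic (0 : R) by rewrite /= in_itv/= lexx.
move/subspace_continuousP : cr => /(_ 0 z0)/cvgrPdist_lt/(_ _ e0).
move=> /nbhs_ballP[d /= d0 H]; have d2 : 0 < d / 2 by rewrite divr_gt0.
exists (d / 2) => //; have : `|rho 0 - rho (d / 2)| < e.
  apply: H; first by rewrite /ball/= sub0r normrN gtr0_norm//; lra.
  by rewrite /= in_itv/= andbT ltW.
by rewrite r0 sub0r normrN; apply: le_lt_trans; exact: ler_norm.
Qed.

Lemma class_K_enorm_continuous n rho : class_K rho ->
  continuous (fun v : 'rV[R]_n => rho (enorm v)).
Proof.
move=> [cr _ _] v; apply/(@cvgrPdist_lt _ _ _ (nbhs v)) => e e0.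
have v0 : `[0, +oo[%classic (enorm v) by rewrite /= in_itv/= enorm_ge0.
move/subspace_continuousP : cr => /(_ _ v0)/cvgrPdist_lt/(_ _ e0).
move=> /nbhs_ballP[d /= d0 H].
have /(@cvgrPdist_lt _ _ _ (nbhs v))/(_ _ d0) := @enorm_continuous R n v.
apply: filterS => w vw; apply: H => //.
by rewrite /= in_itv/= enorm_ge0.
Qed.

End ClassK.

Section PositiveDefinite.
Context {R : realType} {n : nat}.

Lemma positive_on_annulus (Q : 'rV[R]_n -> R) (e K : R) : continuous Q ->
  (forall v, v != 0 -> 0 < Q v) -> 0 < e ->
  exists2 q : R, 0 < q & forall v, e <= enorm v -> enorm v <= K -> q <= Q v.
Proof.
move=> cQ Q0 e0.
pose A := [set v : 'rV[R]_n | forall i, `[- K, K]%classic (v ord0 i)] `&`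
  (@enorm R n) @^-1` [set u | e <= u].
have Ain v : e <= enorm v -> enorm v <= K -> A v.
  move=> ev vK; split; last exact: ev.
  by move=> i; rewrite /= in_itv/= -ler_norml (le_trans (coord_le_enorm v i)).
have [A0|A0] := pselect (A !=set0); last first.
  by exists 1 => // v ev vK; exfalso; apply: A0; exists v; exact: Ain.
have cA : compact A.
  apply: compact_closedI.
    apply: (@rV_compact R n (fun=> `[- K, K]%classic)) => i.
    exact: segment_compact.
  apply: (@preimage_closed _ _ (@enorm R n) [set u | e <= u]); last exact: closed_ge.
  by move=> v _; exact: enorm_continuous.
have [c cA' cmin] := EVT_min_rV A0 cA (continuous_subspaceT cQ).
exists (Q c) => [|v ev vK]; last by apply: cmin; rewrite inE; exact: Ain.
apply: Q0; move: cA'; rewrite inE => -[_] /=.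
by apply: contraTneq => ->; rewrite enorm0 -ltNge.
Qed.

End PositiveDefinite.

Section LyapunovFunctional.
Context {R : realType} {n : nat}.
Variables (r : R) (f : (R -> 'rV[R]_n) -> 'rV[R]_n) (p : R).
Hypotheses (r0 : 0 < r) (f0 : f (cst 0) = 0) (p1 : 1 < p).
Hypothesis f_lip : lipschitz_on_bounded_C0 r f.
Hypothesis f_complete : forall x0, holder_space r (1 - p^-1) x0 ->
  exists x, is_solution r f x0 x.
Implicit Types (x y z : R -> 'rV[R]_n) (s t u T K d e : R).
Local Notation sol := (sol r f).
Local Notation phi := (phi r f).
Local Notation Wnorm := (W1p_norm r p).

Section Along.
Variable V : (R -> 'rV[R]_n) -> R.
Hypothesis V_lip : lipschitz_on_bounded_W1p r p V.

Let W_phi x t (Wx : W1p r p x) (t0 : 0 <= t) : W1p r p (phi t x) :=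
  phi_W1p r0 f0 p1 f_lip f_complete Wx t0.

(** Such a functional depends only on the restriction of its argument to
    [[- r, 0]], where segments are determined by the flow. *)
Lemma lipschitz_eq x y : W1p r p x -> W1p r p y -> {in `[- r, 0], x =1 y} -> V x = V y.
Proof.
move=> Wx Wy xy.
have bnd (a b : R) : 0 <= a -> exists2 K, 0 <= K & a <= K /\ b <= K.
  by move=> a0; exists (Num.max a b); rewrite !le_max ?a0 ?lexx ?orbT.
have [K K0 [xK yK]] := bnd _ (Wnorm y) (W1p_norm_ge0 r p x).
have [M M0 HM] := V_lip K0.
have E : Wnorm (x - y) = 0.
  rewrite -(W1p_norm0 r0 f0 p1 f_lip); apply: eq_W1p_norm => s /xy xs.
  by rewrite -[LHS]/(x s - y s) xs subrr.
have := HM x y Wx Wy xK yK; rewrite E mulr0 normr_le0 subr_eq0.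
by move/eqP.
Qed.

Lemma lipschitz_phiD x t s : W1p r p x -> 0 <= t -> 0 <= s ->
  V (phi s (phi t x)) = V (phi (t + s) x).
Proof.
move=> Wx t0 s0; apply: lipschitz_eq.
- exact: W_phi (W_phi Wx t0) s0.
- exact: W_phi Wx (addr_ge0 t0 s0).
- exact: (phiD r0 f_lip t0 s0 (W1p_has_sol r0 p1 f_complete Wx)).
Qed.

Lemma lipschitz_phi0 x : W1p r p x -> V (phi 0 x) = V x.
Proof.
move=> Wx; apply: (lipschitz_eq (W_phi Wx (lexx 0)) Wx).
exact: phi0 (W1p_has_sol r0 p1 f_complete Wx).
Qed.

Lemma lipschitz_left_continuous x t e : W1p r p x -> 0 < t -> 0 < e ->
  exists2 d : R, 0 < d & forall s, 0 <= s -> s < t -> t - s < d ->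
    V (phi t x) <= V (phi s x) + e.
Proof.
move=> Wx t0 e0; have sx := W1p_solP r0 p1 f_complete Wx.
have [K K0 xK] := sol_bounded t sx.
have [C C0' HC] := norm_segment_le r0 f0 p1 f_lip K0.
pose B := Num.max 0 (derive_norm r p x + C * K).
have B0 : 0 <= B by rewrite le_max lexx.
have bound s : 0 <= s -> s <= t -> Wnorm (phi s x) <= B.
  move=> s0 st; rewrite le_max; apply/orP; right.
  apply: (HC _ _ _ _ sx Wx K0 (lexx K) s0) => u ru us; apply: xK => //.
  exact: le_trans st.
have [M M0 HM] := V_lip B0.
have M1 : 0 < M + 1 by rewrite ltr_wpDl.
have [d d0 Hd] := segment_continuous r0 f0 p1 f_lip sx Wx (ltW t0) (divr_gt0 e0 M1).
exists d => // s s0 st ts; have sle := ltW st; have tge := ltW t0.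
have ts' : `|t - s| < d by rewrite ger0_norm// subr_ge0.
have H1 := HM _ _ (W_phi Wx tge) (W_phi Wx s0) (bound t tge (lexx t)) (bound s s0 sle).
have H2 : Wnorm (phi t x - phi s x) <= e / (M + 1) := Hd t s tge (lexx t) s0 sle ts'.
have H3 : M * (e / (M + 1)) <= e.
  rewrite mulrCA ler_piMr ?(ltW e0)// ler_pdivrMr// mul1r; lra.
rewrite -lerBlDl; apply: (le_trans (ler_norm _)); apply: (le_trans H1).
exact: le_trans (ler_wpM2l M0 H2) H3.
Qed.

(** The Dini derivative at [phi t x] is the right derivative at time [t] of the
    functional along the trajectory. *)
Lemma decrease_of_upper_dini x a b (m : R) : W1p r p x -> 0 <= a -> a <= b ->
  (forall t, a <= t -> t < b -> (upper_dini r f V (phi t x) <= m%:E)%E) ->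
  V (phi b x) <= V (phi a x) + m * (b - a).
Proof.
move=> Wx a0 ab dini.
apply: (@increment_le_of_right_slope R (fun t => V (phi t x))) => // [t at0 tb e e0|t at0 tb e e0].
  have t0 : 0 < t by exact: le_lt_trans at0.
  have [d d0 H] := lipschitz_left_continuous Wx t0 e0.
  by exists d => // s as0 st ts; apply: H => //; exact: le_trans as0.
have t0 : 0 <= t by exact: le_trans at0.
have : (upper_dini r f V (phi t x) < (m + e)%:E)%E.
  by apply: le_lt_trans (dini t at0 tb) _; rewrite lte_fin ltrDl.
move=> /limf_esup_right_lt[d d0 H]; exists d => // h h0 hd.
have := H h h0 hd; rewrite (lipschitz_phiD Wx t0 (ltW h0)).
rewrite mulrC ltr_pdivrMr// ltrBlDl => /ltW; exact.
Qed.

End Along.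

(** The same functional works: [enorm (x 0)] is at most the Sobolev norm, so the
    decay rate [V] is bounded below by a function of [x 0]. *)
Lemma W1p_norm_lyapunov_enorm_lyapunov :
  (exists (V : (R -> 'rV[R]_n) -> R) (a1 a2 : R -> R),
    [/\ forall x, W1p r p x -> 0 <= V x,
        lipschitz_on_bounded_W1p r p V,
        class_Kinfty a1, class_Kinfty a2 &
        forall x, W1p r p x ->
          [/\ a1 (Wnorm x) <= V x, V x <= a2 (Wnorm x) &
              (upper_dini r f V x <= (- V x)%:E)%E]]) ->
  exists (V : (R -> 'rV[R]_n) -> R) (Q : 'rV[R]_n -> R) (a1 a2 : R -> R),
    [/\ (forall x, W1p r p x -> 0 <= V x) /\ lipschitz_on_bounded_W1p r p V,
        [/\ continuous Q, forall xi, 0 <= Q xi & positive_definite Q],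
        class_Kinfty a1, class_Kinfty a2 &
        forall x, W1p r p x ->
          [/\ a1 (enorm (x 0)) <= V x, V x <= a2 (Wnorm x) &
              (upper_dini r f V x <= (- Q (x 0))%:E)%E]].
Proof.
move=> [V [a1 [a2 [V0 V_lip a1K a2K H]]]].
have K1 := a1K.1.
exists V, (fun v => a1 (enorm v)), a1, a2; split=> //.
  split; first exact: class_K_enorm_continuous.
    by move=> v; apply: class_K_ge0 => //; exact: enorm_ge0.
  split; first by rewrite enorm0; case: K1.
  move=> v v0; apply: class_K_gt0 => //; rewrite lt_neqAle enorm_ge0 andbT eq_sym.
  by apply: contra v0 => /eqP/enorm_eq0/eqP.
move=> x Wx; have [Hl Hu Hd] := H x Wx.
have xle : a1 (enorm (x 0)) <= V x.
  apply: le_trans Hl; apply: class_K_le => //; first exact: enorm_ge0.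
  apply: le_trans (sup_le_W1p_norm r p x).
  by apply: (le_sup_norm (W1p_C0 Wx)); rewrite in_itv/= oppr_le0 (ltW r0) lexx.
by split=> //; apply: (le_trans Hd); rewrite lee_fin lerN2.
Qed.

Section Lyapunov.
Variables (V : (R -> 'rV[R]_n) -> R) (Q : 'rV[R]_n -> R) (a1 a2 : R -> R).
Hypotheses (V0 : forall x, W1p r p x -> 0 <= V x)
  (V_lip : lipschitz_on_bounded_W1p r p V).
Hypotheses (cQ : continuous Q) (Q_ge0 : forall v, 0 <= Q v)
  (Q_gt0 : forall v, v != 0 -> 0 < Q v).
Hypotheses (a1K : class_Kinfty a1) (a2K : class_Kinfty a2).
Hypothesis VH : forall x, W1p r p x ->
  [/\ a1 (enorm (x 0)) <= V x, V x <= a2 (Wnorm x) &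
      (upper_dini r f V x <= (- Q (x 0))%:E)%E].

Let W_phi x t (Wx : W1p r p x) (t0 : 0 <= t) : W1p r p (phi t x) :=
  phi_W1p r0 f0 p1 f_lip f_complete Wx t0.

Let phi_at0 x t : phi t x 0 = sol x t.
Proof. by rewrite phiE /segment_at addr0. Qed.

Lemma lyapunov_decrease x a b (q : R) : W1p r p x -> 0 <= a -> a <= b ->
  (forall t, a <= t -> t < b -> q <= Q (sol x t)) ->
  V (phi b x) <= V (phi a x) - q * (b - a).
Proof.
move=> Wx a0 ab xq; rewrite -mulNr; apply: decrease_of_upper_dini => // t at0 tb.
have t0 : 0 <= t by exact: le_trans at0.
have [_ _] := VH (W_phi Wx t0); rewrite phi_at0 => H; apply: (le_trans H).
by rewrite lee_fin lerN2 xq.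
Qed.

Lemma lyapunov_nonincr x a b : W1p r p x -> 0 <= a -> a <= b ->
  V (phi b x) <= V (phi a x).
Proof.
move=> Wx a0 ab; have := @lyapunov_decrease x a b 0 Wx a0 ab.
by rewrite mul0r subr0; apply=> t _ _.
Qed.

Lemma a1_enorm_sol_le x t : W1p r p x -> 0 <= t ->
  a1 (enorm (sol x t)) <= a2 (Wnorm x).
Proof.
move=> Wx t0; have [H _ _] := VH (W_phi Wx t0); have [_ H2 _] := VH Wx.
move: H; rewrite phi_at0 => H; apply: (le_trans H).
apply: le_trans (lyapunov_nonincr Wx (lexx 0) t0) _.
by rewrite (lipschitz_phi0 V_lip Wx).
Qed.

(** The functional bounds the solution pointwise, and the smallness of the
    derivatives of its segments then follows from the equation. *)
Lemma lyapunov_LS : LS_X r f p.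
Proof.
move=> e e0; have [M M0 HM] := norm_segment_le r0 f0 p1 f_lip (ltW e0).
have M1 : 0 < 2 * (M + 1) by rewrite mulr_gt0// ltr_wpDl.
(* M * k is at most e / 2; the other half is left to the initial derivative. *)
pose k := Num.min e (e / (2 * (M + 1))).
have k0 : 0 < k by rewrite lt_min e0 divr_gt0.
have ke : k <= e by rewrite ge_min lexx.
have Mk : M * k <= e / 2.
  apply: (@le_trans _ _ (M * (e / (2 * (M + 1))))).
    by rewrite ler_wpM2l// ge_min lexx orbT.
  have -> : M * (e / (2 * (M + 1))) = e / 2 * (M / (M + 1)).
    by field; rewrite gt_eqF// ltr_wpDl.
  by rewrite ler_piMr ?divr_ge0 ?(ltW e0)// ler_pdivrMr ?ltr_wpDl// mul1r lerDl.
have [d' d'0 a2d'] := class_K_small a2K.1 (class_K_gt0 a1K.1 k0).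
pose d := Num.min d' (Num.min k (e / 2)).
have [dd' dk de] : [/\ d <= d', d <= k & d <= e / 2].
  by split; rewrite /d ge_min ?lexx// ge_min ?lexx ?orbT.
have d0 : 0 < d by rewrite lt_min d'0 lt_min k0 divr_gt0.
exists d => //; apply: ge_ereal_sup => _ [t [x [t0 Wx xd ->]]]; rewrite lee_fin.
have sx := W1p_solP r0 p1 f_complete Wx.
have N0 := W1p_norm_ge0 r p x.
have xk s : - r <= s -> s <= t -> enorm (sol x s) <= k.
  move=> rs _; have [s0|/ltW s0] := leP s 0.
    by apply: (le_trans (enorm_init_le r0 p1 f_complete Wx rs s0)); exact: le_trans dk.
  apply/ltW/(class_K_lt_inv a1K.1 (ltW k0)).
  apply: (le_lt_trans (a1_enorm_sol_le Wx s0)); apply: le_lt_trans a2d'.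
  by apply: (class_K_le a2K.1 N0); exact: le_trans dd'.
apply: (le_trans (HM _ _ _ _ sx Wx (ltW k0) ke t0 xk)).
rewrite [e](_ : _ = e / 2 + e / 2); last by field.
apply: lerD Mk; apply: le_trans (derive_le_W1p_norm r p x) _.
exact: le_trans de.
Qed.

Section Bounded.
Variables (x : R -> 'rV[R]_n) (K : R).
Hypotheses (Wx : W1p r p x) (K0 : 0 <= K).
Hypothesis xK : forall s, - r <= s -> enorm (sol x s) <= K.

Lemma sol_time_lipschitz : exists2 L : R, 0 <= L &
  forall s t, 0 <= s -> s <= t -> enorm (sol x t - sol x s) <= L * (t - s).
Proof.
have sx := W1p_solP r0 p1 f_complete Wx.
have [M M0 fM] := f_bound f0 f_lip K0.
exists (M * K) => [|s t s0 st]; first by rewrite mulr_ge0// ltW.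
apply: (sol_increment r0 sx s0 st) => u su _.
have u0 : 0 <= u by rewrite (le_trans s0)// ltW.
have uK : sup_norm r (segment_at (sol x) u) <= K.
  by apply: sup_norm_segment => // v rv _; exact: xK.
apply: (le_trans (fM _ (C0_sol sx u0) uK)); apply: ler_wpM2l => //; exact: ltW.
Qed.

(** Each visit above the level [e] lasts, up to halving the level, for a fixed
    time, hence costs a fixed amount of the nonnegative functional. *)
Lemma sol_vanishes e : 0 < e ->
  exists2 T, 0 <= T & forall t, T <= t -> enorm (sol x t) <= e.
Proof.
move=> e0; have e20 : 0 < e / 2 by rewrite divr_gt0.
have [q q0 Qq] := positive_on_annulus K cQ Q_gt0 e20.
have [L L0 xL] := sol_time_lipschitz.
have L1 : 0 < 2 * (L + 1) by rewrite mulr_gt0// ltr_wpDl.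
(* During a time h the solution moves by at most e / 2. *)
pose h := e / (2 * (L + 1)); have h0 : 0 < h by rewrite divr_gt0.
have Lh : L * h <= e / 2.
  have -> : L * h = e / 2 * (L / (L + 1)).
    by rewrite /h; field; rewrite gt_eqF// ltr_wpDl.
  by rewrite ler_piMr ?divr_ge0 ?(ltW e0)// ler_pdivrMr ?ltr_wpDl// mul1r lerDl.
apply: contrapT => noT.
have visits T : 0 <= T -> exists t, T <= t /\ e < enorm (sol x t).
  move=> T0; apply: contrapT => H; apply: noT; exists T => // t Tt.
  by rewrite leNgt; apply/negP => et; apply: H; exists t.
have drop t : 0 <= t -> e < enorm (sol x t) ->
    V (phi (t + h) x) <= V (phi t x) - q * h.
  move=> t0 et; have th : t <= t + h by rewrite lerDl ltW.
  have := @lyapunov_decrease x t (t + h) q Wx t0 th.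
  rewrite [t + h - t](_ : _ = h); last by ring.
  apply=> s ts sth; apply: Qq; last first.
    by apply: xK; rewrite (le_trans _ ts)// (le_trans _ t0)// oppr_le0 ltW.
  have H1 := xL t s t0 ts; have H2 := ler_enormB (sol x s) (sol x t).
  have H3 : L * (s - t) <= L * h by rewrite ler_wpM2l//; lra.
  have := ler_norm (enorm (sol x t) - enorm (sol x s)).
  rewrite distrC; lra.
have iter_drop k : exists2 t, 0 <= t & V (phi t x) <= V x - k%:R * (q * h).
  elim: k => [|k [T T0 VT]].
    by exists 0 => //; rewrite mul0r subr0 (lipschitz_phi0 V_lip Wx).
  have [t [Tt et]] := visits T T0; have t0 := le_trans T0 Tt.
  exists (t + h); first by rewrite addr_ge0// ltW.
  have H1 := drop t t0 et; have H2 := lyapunov_nonincr Wx T0 Tt.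
  by rewrite -natr1 mulrDl mul1r; lra.
have qh : 0 < q * h by rewrite mulr_gt0.
have [t t0] := iter_drop (Num.truncn (V x / (q * h))).+1.
have := truncnS_gt (V x / (q * h)); rewrite ltr_pdivrMr//.
have := V0 (W_phi Wx t0); lra.
Qed.

End Bounded.

(** Once the solution stays small for a duration [r], so does the Sobolev norm of
    its segments. *)
Lemma lyapunov_GA : GA_X r f p.
Proof.
move=> x Wx; have [B B0 a1B] : exists2 B, 0 <= B & a2 (Wnorm x) < a1 B.
  have /cvgryPgt/(_ (a2 (Wnorm x)))[B [_ HB]] := a1K.2.
  exists (Num.max 0 (B + 1)); first by rewrite le_max lexx.
  by apply: HB; rewrite lt_max ltrDl ltr01 orbT.
pose K := Num.max B (Wnorm x); have K0 : 0 <= K by rewrite le_max B0.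
have xK s : - r <= s -> enorm (sol x s) <= K.
  move=> rs; rewrite le_max; have [s0|/ltW s0] := leP s 0.
    by rewrite (enorm_init_le r0 p1 f_complete Wx rs s0) orbT.
  apply/orP; left; apply/ltW/(class_K_lt_inv a1K.1 B0).
  exact: le_lt_trans (a1_enorm_sol_le Wx s0) a1B.
have sx := W1p_solP r0 p1 f_complete Wx.
apply/cvgrPdist_le => e e0.
have [M M0 HM] := norm_segment_le_late r0 f0 p1 f_lip (ltW e0).
have M1 : 0 < M + 1 by rewrite ltr_wpDl.
pose k := Num.min e (e / (M + 1)).
have k0 : 0 < k by rewrite lt_min e0 divr_gt0.
have ke : k <= e by rewrite ge_min lexx.
have Mk : M * k <= e.
  apply: (@le_trans _ _ (M * (e / (M + 1)))).
    by rewrite ler_wpM2l// ge_min lexx orbT.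
  by rewrite mulrCA ler_piMr ?(ltW e0)// ler_pdivrMr// mul1r lerDl.
have [T T0 xT] := sol_vanishes Wx K0 xK k0.
(* The solution is small from T on; the flow is restarted at T + r, whose initial
   path lies in that range, and r more makes the segments forget that path. *)
exists (T + r + r); split; first exact: num_real.
move=> t /ltW Tt; rewrite sub0r normrN ger0_norm ?W1p_norm_ge0//.
apply: le_trans Mk.
have Tr0 : 0 <= T + r by rewrite addr_ge0// ltW.
have shifted := is_solution_shift sx Tr0.
have rt : r <= t - (T + r) by lra.
have -> : phi t x = segment_at (fun s => sol x (T + r + s)) (t - (T + r)).
  by rewrite phiE; apply/funext => s; rewrite /segment_at; congr (sol x _); ring.
apply: (HM _ _ _ _ shifted (ltW k0) ke rt) => s rs _; apply: xT; lra.
Qed.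

Lemma lyapunov_GAS : GAS_X r f p.
Proof. by split; [exact: lyapunov_LS|exact: lyapunov_GA]. Qed.

End Lyapunov.
End LyapunovFunctional.

(** * The equivalence *)

Theorem theorem6 (R : realType) (n : nat) (r : R)
    (f : (R -> 'rV[R]_n) -> 'rV[R]_n) (p : R)
    (r_gt0 : 0 < r) (f0 : f (cst 0) = 0) (f_lip : lipschitz_on_bounded_C0 r f)
    (p_gt1 : 1 < p)
    (f_complete : forall x0, holder_space r (1 - p^-1) x0 ->
                    exists x, is_solution r f x0 x) :
  [<-> GAS_X r f p;
       UGAS_X r f p;
       exists (V : (R -> 'rV[R]_n) -> R) (a1 a2 : R -> R),
         [/\ forall x, W1p r p x -> 0 <= V x,
             lipschitz_on_bounded_W1p r p V,
             class_Kinfty a1, class_Kinfty a2 &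
             forall x, W1p r p x ->
               [/\ a1 (W1p_norm r p x) <= V x, V x <= a2 (W1p_norm r p x) &
                   (upper_dini r f V x <= (- V x)%:E)%E]];
       exists (V : (R -> 'rV[R]_n) -> R) (Q : 'rV[R]_n -> R) (a1 a2 : R -> R),
         [/\ (forall x, W1p r p x -> 0 <= V x) /\
               lipschitz_on_bounded_W1p r p V,
             [/\ continuous Q, forall xi, 0 <= Q xi & positive_definite Q],
             class_Kinfty a1, class_Kinfty a2 &
             forall x, W1p r p x ->
               [/\ a1 (enorm (x 0)) <= V x, V x <= a2 (W1p_norm r p x) &
                   (upper_dini r f V x <= (- Q (x 0))%:E)%E]]].
Proof.
tfae.
- exact: GAS_UGAS.
- move=> [sigma KL bound]; exact: (UGAS_converse_functional r_gt0 f0 p_gt1 f_lip f_complete KL).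
- exact: W1p_norm_lyapunov_enorm_lyapunov.
- move=> [V [Q [a1 [a2 [[V0 V_lip] [cQ Q0 [_ Qpos]] a1K a2K VH]]]]].
  exact: (lyapunov_GAS r_gt0 f0 p_gt1 f_lip f_complete V0 V_lip cQ Q0 Qpos a1K a2K VH).
Qed.
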